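(* Let $\rho$ be a quasi-periodic labelling, and let $G_\rho\le \mathrm{Homeo}^+(\mathbf{R})$ be the associated group. Then $\mathrm{H}^2_b(G_\rho;\mathbf{R})=0$.
   Context: Conventions: $0\in\mathbf{N}$; $\mathrm{Homeo}^+(M)$ is the group of orientation-preserving homeomorphisms of a connected $1$-manifold $M$ (possibly with boundary). Bounded cohomology. For a group $G$ and $n\ge 0$ let $C^n(G)$ be the space of functions $G^n\to\mathbf{R}$ ($G^0$ is a point), with $\delta^0=0$ and, for $n\ge 1$, $$\delta^n(f)(g_1,\ldots,g_{n+1})=f(g_2,\ldots,g_{n+1})+\sum_{i=1}^n(-1)^if(g_1,\ldots,g_ig_{i+1},\ldots,g_{n+1})+(-1)^{n+1}f(g_1,\ldots,g_n).$$ Bounded functions form a subcomplex $C^\bullet_b(G)$, and $\mathrm{H}^n_b(G;\mathbf{R})=\ker(\delta^n|_{C^n_b(G)})/\delta^{n-1}(C^{n-1}_b(G))$ is the bounded cohomology of $G$ with trivial real coefficients. The group $H$. Thompson's group $F$ is the group of orientation-preserving piecewise linear homeomorphisms of $[0,1]$ whose breakpoints (finitely many) lie in $\mathbf{Z}[\frac12]$ and whose derivatives, where they exist, are integer powers of $2$. $H\le F$ is the subgroup of elements whose slopes at $0$ and at $1$ coincide. $H$ can be generated by three elements; fix a generating set $\{\nu_1,\nu_2,\nu_3\}$ of $H$ (the choice is unimportant). Labellings. Let $\frac12\mathbf{Z}=\{\frac12k: k\in\mathbf{Z}\}$. A labelling is a map $\rho:\frac12\mathbf{Z}\to\{a,b,a^{-1},b^{-1}\}$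 with $\rho(k)\in\{a,a^{-1}\}$ for $k\in\mathbf{Z}$ and $\rho(k)\in\{b,b^{-1}\}$ for $k\in\frac12\mathbf{Z}\setminus\mathbf{Z}$. A block is a set $X=\{k,k+\frac12,\ldots,k+\frac12n\}$ with $k\in\frac12\mathbf{Z}$, $n\in\mathbf{N}$; put $W_\rho(X)=\rho(k)\rho(k+\frac12)\cdots\rho(k+\frac12n)$, a formal word. The formal inverse of a word $w_1\cdots w_n$ is $w_n^{-1}\cdots w_1^{-1}$, and $W_\rho^{-1}(X)$ is the formal inverse of $W_\rho(X)$. The labelling $\rho$ is quasi-periodic if: (1) for each block $X$ there is $n\in\mathbf{N}$ such that for every block $Y$ of size at least $n$, $W_\rho(X)$ is a subword (string of consecutive letters) of $W_\rho(Y)$; and (2) for each block $X$ there is a block $Y$ with $W_\rho(Y)=W_\rho^{-1}(X)$. The group $G_\rho$. For compact intervals $I,J$ of equal positive length, let $T_{J,I}:J\to I$ be the unique orientation-preserving isometry and $T^{or}_{J,I}:J\to I$ the unique orientation-reversing isometry. For $f\in\mathrm{Homeo}^+(I)$, $g\in\mathrm{Homeo}^+(J)$ write $f\cong_Tg$ if $f(x)=T_{J,I}(g(T_{I,J}(x)))$ for all $x\in I$, and $f\cong_{T^{or}}g$ if $f(x)=T^{or}_{J,I}(g(T^{or}_{I,J}(x)))$ for all $x\in I$. Given a labelling $\rho$, define homeomorphisms $\zeta_i,\chi_i$ ($i=1,2,3$) of $\mathbf{R}$ by: for all $n\in\mathbf{Z}$, $\zeta_i\restriction[n,n+1]\cong_T\nu_i$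 if $\rho(n+\frac12)=b$ and $\zeta_i\restriction[n,n+1]\cong_{T^{or}}\nu_i$ if $\rho(n+\frac12)=b^{-1}$; $\chi_i\restriction[n-\frac12,n+\frac12]\cong_T\nu_i$ if $\rho(n)=a$ and $\chi_i\restriction[n-\frac12,n+\frac12]\cong_{T^{or}}\nu_i$ if $\rho(n)=a^{-1}$. Then $G_\rho=\langle\zeta_1,\zeta_2,\zeta_3,\chi_1,\chi_2,\chi_3\rangle\le\mathrm{Homeo}^+(\mathbf{R})$. *)

(* Defs.v *)
From HB Require Import structures.
From mathcomp Require Import all_boot all_order all_algebra.
From mathcomp Require Import all_classical all_reals all_analysis.
From mathcomp Require Import ring lra zify.
Set Implicit Arguments.
Unset Strict Implicit.
Unset Printing Implicit Defensive.
Import Order.TTheory GRing.Theory Num.Theory.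
Import numFieldNormedType.Exports.
Local Open Scope classical_set_scope.
Local Open Scope ring_scope.

Section BoundedCohomology.
Variables (R : realType) (G : groupType).

Local Notation cochain n := (n.-tuple G -> R).

(* [merge i (g_1, ..., g_n+1) = (g_1, ..., g_i * g_i+1, ..., g_n+1)], where
   [i : 'I_n] counts from 0: it stands for the index i + 1 of the usual
   formula. *)
Definition merge (n : nat) (i : 'I_n) (g : n.+1.-tuple G) : n.-tuple G :=
  [tuple if (j < i)%N then tnth g (widen_ord (leqnSn n) j)
         else if j == i
              then (tnth g (widen_ord (leqnSn n) j) * tnth g (lift ord0 j))%g
              else tnth g (lift ord0 j) | j < n].

(* For n = 0 the formula gives f - f = 0. *)
Definition coboundary (n : nat) (f : cochain n) : cochain n.+1 := fun g =>
  f [tuple tnth g (lift ord0 j) | j < n]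
  + \sum_(i < n) (-1) ^+ i.+1 * f (merge i g)
  + (-1) ^+ n.+1 * f [tuple tnth g (widen_ord (leqnSn n) j) | j < n].

Definition bounded_cochain (n : nat) (f : cochain n) : Prop :=
  exists M : R, forall g, `|f g| <= M.

Definition bounded_cocycle_pred (n : nat) : {pred cochain n} :=
  fun f => `[< bounded_cochain f /\ coboundary f = 0 >].

Lemma coboundary_zmod_morphism n (f f' : cochain n) :
  coboundary (f - f') = coboundary f - coboundary f'.
Proof.
apply/funext => g; rewrite /coboundary.
have -> : \sum_(i < n) (-1) ^+ i.+1 * (f - f') (merge i g) =
    \sum_(i < n) ((-1) ^+ i.+1 * f (merge i g) - (-1) ^+ i.+1 * f' (merge i g)).
  by apply: eq_bigr => i _; rewrite -mulrBr.
by rewrite sumrB !fctE; ring.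
Qed.

Lemma bounded_cochainB n (f f' : cochain n) :
  bounded_cochain f -> bounded_cochain f' -> bounded_cochain (f - f').
Proof.
move=> [M fM] [M' fM']; exists (M + M') => g.
by rewrite fctE (le_trans (ler_normB _ _))// lerD.
Qed.

Lemma bounded_cochain0 n : bounded_cochain (0 : cochain n).
Proof. by exists 0 => g; rewrite normr0. Qed.

Lemma coboundary0 n : coboundary (0 : cochain n) = 0.
Proof. by rewrite -[in LHS](subrr 0) coboundary_zmod_morphism subrr. Qed.

Lemma bounded_cocycle_zmod_closed n : zmod_closed (@bounded_cocycle_pred n).
Proof.
split=> [|f f' /asboolP[bf cf] /asboolP[bf' cf']]; apply/asboolP.
  by split; [exact: bounded_cochain0|exact: coboundary0].
split; first exact: bounded_cochainB.
by rewrite coboundary_zmod_morphism cf cf' subrr.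
Qed.

HB.instance Definition _ n := GRing.isZmodClosed.Build (cochain n)
  (@bounded_cocycle_pred n) (@bounded_cocycle_zmod_closed n).

Record bounded_cocycle (n : nat) := BoundedCocycle {
  cocycle_val :> cochain n;
  _ : cocycle_val \in @bounded_cocycle_pred n }.

HB.instance Definition _ n := [isSub for @cocycle_val n].
HB.instance Definition _ n := [Choice of bounded_cocycle n by <:].
HB.instance Definition _ n :=
  [SubChoice_isSubZmodule of bounded_cocycle n by <:].

(* The incoming differential is 0 in degree 0. *)
Definition is_bounded_coboundary (n : nat) : cochain n -> Prop :=
  match n with
  | 0 => fun f => f = 0
  | m.+1 => fun f => exists h : cochain m, bounded_cochain h /\ f = coboundary h
  end.

Definition bounded_coboundary_pred (n : nat) : {pred bounded_cocycle n} :=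
  fun z => `[< is_bounded_coboundary (z : cochain n) >].

Let valB n (z z' : bounded_cocycle n) : val (z - z') = val z - val z'.
Proof. exact: raddfB. Qed.

Lemma bounded_coboundary_zmod_closed n :
  zmod_closed (@bounded_coboundary_pred n).
Proof.
case: n => [|n]; split=> [|z z' /asboolP + /asboolP]; first exact/asboolP.
- move=> /= z0 z'0; apply/asboolP.
  apply: etrans (valB z z') _.
  by change (cocycle_val z - cocycle_val z' = 0); rewrite z0 z'0 subrr.
- apply/asboolP; exists 0; split; [exact: bounded_cochain0|].
  by rewrite coboundary0.
- move=> [h [bh zh]] [h' [bh' zh']]; apply/asboolP; exists (h - h').
  split; first exact: bounded_cochainB.
  by rewrite coboundary_zmod_morphism -zh -zh'; exact: (valB z z').
Qed.

HB.instance Definition _ n := GRing.isZmodClosed.Build (bounded_cocycle n)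
  (@bounded_coboundary_pred n) (@bounded_coboundary_zmod_closed n).

Definition bounded_cohomology (n : nat) : zmodType :=
  Quotient.quot (@bounded_coboundary_pred n).

End BoundedCohomology.

Section Homeomorphisms.
Variables (R : realType) (I : set R).

(* Used for the connected 1-manifolds [I] = R and [I] = [0, 1].
   [f] is an orientation-preserving homeomorphism of [I] onto itself with
   inverse [g]. Both are extended by the identity outside [I], so that equality
   of functions on R is equality of homeomorphisms of [I]. *)
Record is_homeo_pair (f g : R -> R) : Prop := IsHomeoPair {
  homeo_fun : set_fun I I f;
  homeo_invfun : set_fun I I g;
  homeo_cancel : cancel f g;
  homeo_invcancel : cancel g f;
  homeo_continuous : {within I, continuous f};
  homeo_invcontinuous : {within I, continuous g};
  homeo_increasing : {in I &, {homo f : x y / x < y}};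
  homeo_outside : {in ~` I, f =1 id} }.

Record homeo := Homeo {
  homeo_val :> R -> R;
  homeo_inv : R -> R;
  homeoP : is_homeo_pair homeo_val homeo_inv }.

Lemma homeo_inj (f g : homeo) : f =1 g -> f = g.
Proof.
case: f g => f f' fP [g g' gP] /= /funext fg; subst g.
have : f' = g'.
  by apply/funext => x; rewrite -[LHS](homeo_cancel gP) (homeo_invcancel fP).
by move=> ?; subst g'; congr Homeo; exact: Prop_irrelevance.
Qed.

Lemma within_comp (f g : R -> R) : set_fun I I f ->
  {within I, continuous f} -> {within I, continuous g} ->
  {within I, continuous (g \o f)}.
Proof.
move=> fI /subspace_continuousP cf /subspace_continuousP cg.
apply/subspace_continuousP => x Ix.
move=> A gA.
have gA' : nbhs (f x) [set z : R | I z -> A (g z)] := cg _ (fI _ Ix) A gA.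
have nB : nbhs x [set y : R | I y -> I (f y) -> A (g (f y))] := cf _ Ix _ gA'.
by apply: filterS nB => y h Iy; exact: h Iy (fI _ Iy).
Qed.

Lemma homeo_id_subproof : is_homeo_pair idfun idfun.
Proof.
by split=> //; apply: continuous_subspaceT => x; exact: cvg_id.
Qed.

Lemma homeo_comp_subproof (f g : homeo) :
  is_homeo_pair (f \o g) (homeo_inv g \o homeo_inv f).
Proof.
case: f g => f f' [ff ff' fK f'K cf cf' mf fo] [g g' [gf gf' gK g'K cg cg' mg og]].
split=> /=.
- by move=> x /gf /ff.
- by move=> x /ff' /gf'.
- by move=> x; rewrite /= fK gK.
- by move=> x; rewrite /= g'K f'K.
- exact: within_comp.
- exact: within_comp.
- move=> x y Ix Iy xy; apply: mf; last exact: mg.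
    by apply/mem_set/gf; rewrite inE in Ix.
  by apply/mem_set/gf; rewrite inE in Iy.
- by move=> x Ix; rewrite /= og// fo.
Qed.

Lemma homeo_inv_subproof (f : homeo) : is_homeo_pair (homeo_inv f) f.
Proof.
case: f => f f' [ff ff' fK f'K cf cf' mf fo]; split=> //=.
  move=> x y; rewrite !inE => Ix Iy xy.
  rewrite ltNge le_eqVlt; apply/negP => /orP[/eqP /(can_inj f'K) yx|yx].
    by move: xy; rewrite yx ltxx.
  have := mf _ _ _ _ yx; rewrite !f'K !inE => /(_ (ff' _ Iy) (ff' _ Ix)).
  by rewrite ltNge (ltW xy).
by move=> x Ix; rewrite /= -{1}(fo x Ix) fK.
Qed.

HB.instance Definition _ := gen_eqMixin homeo.
HB.instance Definition _ := gen_choiceMixin homeo.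

Let one : homeo := Homeo homeo_id_subproof.
Let mul (f g : homeo) : homeo := Homeo (homeo_comp_subproof f g).
Let inv (f : homeo) : homeo := Homeo (homeo_inv_subproof f).

Let mulA : associative mul. Proof. by move=> f g h; exact: homeo_inj. Qed.
Let mul1 : left_id one mul. Proof. by move=> f; exact: homeo_inj. Qed.
Let mulr1 : right_id one mul. Proof. by move=> f; exact: homeo_inj. Qed.
Let mulV : left_inverse one inv mul.
Proof. by move=> f; apply: homeo_inj => x /=; rewrite homeo_cancel//; exact: homeoP. Qed.
Let mulVr : right_inverse one inv mul.
Proof. by move=> f; apply: homeo_inj => x /=; rewrite homeo_invcancel//; exact: homeoP. Qed.

(* The product is composition: [(f * g)%g x = f (g x)]. *)
HB.instance Definition _ := isGroup.Build homeo mulA mul1 mulr1 mulV mulVr.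

End Homeomorphisms.

Section GeneratedSubgroup.
Variable G : groupType.

Definition is_subgroup (S : set G) : Prop :=
  [/\ S 1%g, forall x y, S x -> S y -> S (x * y)%g & forall x, S x -> S x^-1%g].

Definition generated (A : set G) : set G := smallest is_subgroup A.

Lemma generated_is_subgroup (A : set G) : is_subgroup (generated A).
Proof.
split=> [S [[]]//|x y Sx Sy S SA|x Sx S SA].
  by have [[_ SM _] _] := SA; apply: SM; [exact: Sx|exact: Sy].
by have [[_ _ SV] _] := SA; apply: SV; exact: Sx.
Qed.

Definition generated_group (A : set G) : Type := set_type (generated A).

HB.instance Definition _ (A : set G) := SubChoice.on (generated_group A).

Lemma generated_group_closed (A : set G) :
  group_closed [in generated A].
Proof.
have [G1 GM GV] := generated_is_subgroup A.
split=> [|x y]; rewrite !inE// => xA yA.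
by apply: GM => //; exact: GV.
Qed.

HB.instance Definition _ (A : set G) := SubChoice_isSubGroup.Build G _
  (generated_group A) (@generated_group_closed A).

End GeneratedSubgroup.

Section ThompsonGroup.
Variable R : realType.
Local Notation unit_itv := (`[0, 1]%classic : set R).
Implicit Type f : homeo unit_itv.

Definition dyadic (x : R) : Prop := exists (k : int) (n : nat), x = k%:~R / 2 ^+ n.

Definition piecewise_linear f : Prop := exists s : seq R,
  [/\ path <%R 0 s, last 0 s = 1 &
      forall i, (i < size s)%N -> exists m c : R,
        forall x, x \in `[(0 :: s)`_i, s`_i] -> f x = m * x + c].

Definition breakpoint f (x : R) : Prop := (x \in `]0, 1[) /\ ~ derivable f x 1.

Definition thompsonF : set (homeo unit_itv) := [set f |
  [/\ piecewise_linear f,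
      forall x, breakpoint f x -> dyadic x &
      forall x, x \in `]0, 1[ -> derivable f x 1 ->
        exists k : int, 'D_1 f x = 2 ^ k]].

Definition slope_at0 f (m : R) : Prop := (f x - f 0) / (x - 0) @[x --> 0^'+] --> m.

Definition slope_at1 f (m : R) : Prop := (f x - f 1) / (x - 1) @[x --> 1^'-] --> m.

Definition groupH : set (homeo unit_itv) :=
  thompsonF `&` [set f | exists m, slope_at0 f m /\ slope_at1 f m].

End ThompsonGroup.

Inductive letter := La | Lb | LaV | LbV.

Definition letter_code (l : letter) : bool * bool :=
  match l with
  | La => (false, false) | Lb => (true, false)
  | LaV => (false, true) | LbV => (true, true)
  end.

Definition letter_decode (c : bool * bool) : letter :=
  match c with
  | (false, false) => La | (true, false) => Lb
  | (false, true) => LaV | (true, true) => LbV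
  end.

Lemma letter_codeK : cancel letter_code letter_decode.
Proof. by case. Qed.

HB.instance Definition _ := Equality.copy letter (can_type letter_codeK).

Definition letter_inv (l : letter) : letter :=
  match l with La => LaV | Lb => LbV | LaV => La | LbV => Lb end.

Definition word_inv (w : seq letter) : seq letter := rev (map letter_inv w).

(* The half-integer m/2 is represented by the integer m: [rho m] is the label of
   m/2, integers correspond to even m and the other half-integers to odd m. *)
Definition labelling (rho : int -> letter) : Prop :=
  (forall k : int, rho (2 * k) \in [:: La; LaV]) /\
  (forall k : int, rho (2 * k + 1) \in [:: Lb; LbV]).

(* The word of the block {k/2, (k+1)/2, ..., (k+n)/2}, which has n + 1
   elements. *)
Definition block_word (rho : int -> letter) (k : int) (n : nat) : seq letter :=
  [seq rho (k + i%:Z) | i <- iota 0 n.+1].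

Definition quasi_periodic (rho : int -> letter) : Prop :=
  (forall (k : int) (m : nat), exists n : nat, forall (l : int) (p : nat),
     (n <= p.+1)%N -> infix (block_word rho k m) (block_word rho l p)) /\
  (forall (k : int) (m : nat), exists (l : int) (p : nat),
     block_word rho l p = word_inv (block_word rho k m)).

Section GroupG.
Variable R : realType.

(* A pair (a, b) stands for the interval [a, b]; [isom J I] and [isom_or J I]
   are the isometries from J to I when both have the same length. *)
Definition isom (J I : R * R) (x : R) : R := I.1 + (x - J.1).

Definition isom_or (J I : R * R) (x : R) : R := I.2 - (x - J.1).

Definition conj_isom (J I : R * R) (f g : R -> R) : Prop :=
  forall x, x \in `[I.1, I.2] -> f x = isom J I (g (isom I J x)).

Definition conj_isom_or (J I : R * R) (f g : R -> R) : Prop :=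
  forall x, x \in `[I.1, I.2] -> f x = isom_or J I (g (isom_or I J x)).

Definition is_zeta (rho : int -> letter) (nu : homeo (`[0, 1]%classic : set R))
    (h : homeo [set: R]) : Prop := forall n : int,
  (rho (2 * n + 1) = Lb -> conj_isom (0, 1) (n%:~R, n%:~R + 1) h nu) /\
  (rho (2 * n + 1) = LbV -> conj_isom_or (0, 1) (n%:~R, n%:~R + 1) h nu).

Definition is_chi (rho : int -> letter) (nu : homeo (`[0, 1]%classic : set R))
    (h : homeo [set: R]) : Prop := forall n : int,
  (rho (2 * n) = La ->
     conj_isom (0, 1) (n%:~R - 2^-1, n%:~R + 2^-1) h nu) /\
  (rho (2 * n) = LaV ->
     conj_isom_or (0, 1) (n%:~R - 2^-1, n%:~R + 2^-1) h nu).

(* For a labelling rho, each of [is_zeta rho (nu i)] and [is_chi rho (nu i)]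
   holds of exactly one homeomorphism of R; see [zeta_exists], [zeta_unique],
   [chi_exists] and [chi_unique]. *)
Definition groupG_gens (rho : int -> letter)
    (nu : 'I_3 -> homeo (`[0, 1]%classic : set R)) : set (homeo [set: R]) :=
  [set h | exists i, is_zeta rho (nu i) h \/ is_chi rho (nu i) h].

Definition groupG rho nu : groupType := generated_group (groupG_gens rho nu).

End GroupG.

Section GeneratorsWellDefined.
Variable R : realType.
Local Notation unit_itv := (`[0, 1]%classic : set R).
Implicit Types (nu : homeo unit_itv) (rho : int -> letter).

Lemma increasing_bij_continuous (f g : R -> R) :
  cancel f g -> cancel g f -> {homo f : x y / x < y} -> continuous f.
Proof.
move=> fK gK mf x; have mg : {homo g : x y / x < y}.
  move=> a b ab; rewrite ltNge le_eqVlt; apply/negP => /orP[/eqP ba|/mf].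
    by move: ab; rewrite -(gK a) -(gK b) ba ltxx.
  by rewrite !gK ltNge (ltW ab).
apply/cvgrPdist_lt => e e0; near=> y.
have gy : g (f x - e) < y < g (f x + e).
  apply/andP; split; near: y.
    by apply: lt_nbhsr; rewrite -[ltRHS]fK; apply: mg; rewrite ltrBlDr ltrDl.
  by apply: lt_nbhsl; rewrite -[ltLHS]fK; apply: mg; rewrite ltrDl.
case/andP: gy => /mf + /mf; rewrite !gK => h1 h2.
by rewrite ltr_distlC h1 h2.
Unshelve. all: by end_near. Qed.

Lemma increasing_bij_homeo (f g : R -> R) :
  cancel f g -> cancel g f -> {homo f : x y / x < y} ->
  is_homeo_pair [set: R] f g.
Proof.
move=> fK gK mf; have mg : {homo g : x y / x < y}.
  move=> a b ab; rewrite ltNge le_eqVlt; apply/negP => /orP[/eqP ba|/mf].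
    by move: ab; rewrite -(gK a) -(gK b) ba ltxx.
  by rewrite !gK ltNge (ltW ab).
split=> //.
- by apply: continuous_subspaceT; exact: increasing_bij_continuous mf.
- by apply: continuous_subspaceT; exact: increasing_bij_continuous mg.
- by move=> x y _ _; exact: mf.
- by move=> x; rewrite inE /= => /(_ I).
Qed.

Lemma homeo_itv nu x : 0 <= x <= 1 -> 0 <= nu x <= 1.
Proof.
move=> x01; have : [set` `[0, 1]] (nu x).
  by apply: (homeo_fun (homeoP nu)); rewrite /= in_itv.
by rewrite /= in_itv.
Qed.

Lemma homeo_lt nu x y : 0 <= x -> x < y -> y <= 1 -> nu x < nu y.
Proof.
move=> x0 xy y1; apply: (homeo_increasing (homeoP nu)) => //.
  by rewrite inE /= in_itv /= x0 (le_trans (ltW xy)).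
by rewrite inE /= in_itv /= y1 (le_trans x0 (ltW xy)).
Qed.

Lemma homeoK nu x : (nu^-1)%g (nu x) = x.
Proof. exact: homeo_cancel (homeoP nu) x. Qed.

Lemma homeoVK nu x : nu ((nu^-1)%g x) = x.
Proof. exact: homeo_invcancel (homeoP nu) x. Qed.

Lemma homeo0 nu : nu 0 = 0.
Proof.
have /andP[n0 _] : 0 <= nu 0 <= 1 by apply: homeo_itv; rewrite lexx ler01.
have /andP[m0 m1] : 0 <= (nu^-1)%g 0 <= 1.
  by apply: homeo_itv; rewrite lexx ler01.
apply/eqP; rewrite eq_le n0 andbT leNgt; apply/negP => n0'.
move: m0; rewrite le_eqVlt => /orP[/eqP m0|m0].
  by have := homeoVK nu 0; rewrite -m0 => n00; rewrite n00 ltxx in n0'.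
by have := homeo_lt nu (lexx 0) m0 m1; rewrite homeoVK ltNge n0.
Qed.

Lemma homeo1 nu : nu 1 = 1.
Proof.
have /andP[_ n1] : 0 <= nu 1 <= 1 by apply: homeo_itv; rewrite lexx ler01.
have /andP[m0 m1] : 0 <= (nu^-1)%g 1 <= 1.
  by apply: homeo_itv; rewrite lexx ler01.
apply/eqP; rewrite eq_le n1 /= leNgt; apply/negP => n1'.
move: m1; rewrite le_eqVlt => /orP[/eqP m1|m1].
  by have := homeoVK nu 1; rewrite m1 => n11; rewrite n11 ltxx in n1'.
by have := homeo_lt nu m0 m1 (lexx 1); rewrite homeoVK ltNge n1.
Qed.

Let piece (b : bool) nu (t : R) : R := if b then 1 - nu (1 - t) else nu t.

Let piece0 b nu : piece b nu 0 = 0.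
Proof. by case: b; rewrite /piece ?subr0 ?homeo1 ?subrr ?homeo0. Qed.

Let piece1 b nu : piece b nu 1 = 1.
Proof. by case: b; rewrite /piece ?subrr ?homeo1 ?homeo0 ?subr0. Qed.

Let piece_lt b nu x y : 0 <= x -> x < y -> y <= 1 -> piece b nu x < piece b nu y.
Proof.
move=> x0 xy y1; case: b; rewrite /piece; last exact: homeo_lt.
by rewrite ltrD2l ltrN2; apply: homeo_lt; lra.
Qed.

Let pieceK b nu x : piece b (nu^-1)%g (piece b nu x) = x.
Proof. by case: b; rewrite /piece ?subKr ?homeoK ?subKr. Qed.

Let glue (c : R) (lab : int -> bool) nu (x : R) : R :=
  let n := Num.floor (x - c) in c + n%:~R + piece (lab n) nu (x - c - n%:~R).

Let glueE c lab nu (n : int) x : c + n%:~R <= x <= c + n%:~R + 1 ->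
  glue c lab nu x = c + n%:~R + piece (lab n) nu (x - c - n%:~R).
Proof.
move=> /andP[nx]; rewrite le_eqVlt => /orP[/eqP ->|xn]; rewrite /glue.
  have -> : c + n%:~R + 1 - c = (n + 1)%:~R :> R by rewrite intrD; ring.
  rewrite intrKfloor subrr piece0 intrD.
  by rewrite [X in piece _ _ X](_ : _ = 1) ?piece1; ring.
suff -> : Num.floor (x - c) = n by [].
by apply: floor_def; rewrite intrD; lra.
Qed.

Let floor_sub (c x : R) :
  c + (Num.floor (x - c))%:~R <= x < c + (Num.floor (x - c))%:~R + 1.
Proof.
have /andP[h1 h2] := floor_itv (x - c); rewrite intrD in h2.
by apply/andP; split; lra.
Qed.

Let glue_itv (c : R) lab nu x (n := Num.floor (x - c)) :
  c + n%:~R <= glue c lab nu x < c + n%:~R + 1.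
Proof.
have /andP[h1 h2] := floor_sub c x; rewrite -/n in h1 h2.
rewrite (@glueE _ _ _ n) ?h1 ?(ltW h2)//.
have -> : c + n%:~R <= c + n%:~R + piece (lab n) nu (x - c - n%:~R).
  rewrite lerDl -(piece0 (lab n) nu).
  have := h1; rewrite le_eqVlt => /orP[/eqP <-|h3].
    by rewrite [X in piece _ _ X <= _](_ : _ = c + n%:~R - c - n%:~R)//; ring.
  by apply/ltW/piece_lt; lra.
by rewrite ltrD2l -[ltRHS](piece1 (lab n) nu); apply: piece_lt; lra.
Qed.

Let glueK c lab nu : cancel (glue c lab nu) (glue c lab (nu^-1)%g).
Proof.
move=> x; set n := Num.floor (x - c).
have /andP[h1 h2] := glue_itv c lab nu x; rewrite -/n in h1 h2.
rewrite (@glueE _ _ _ n) ?h1 ?(ltW h2)//.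
have /andP[h3 h4] := floor_sub c x; rewrite -/n in h3 h4.
rewrite (@glueE _ _ _ n) ?h3 ?(ltW h4)//.
set p := piece _ nu _; have -> : c + n%:~R + p - c - n%:~R = p by ring.
by rewrite /p pieceK; ring.
Qed.

Let glue_lt c lab nu : {homo glue c lab nu : x y / x < y}.
Proof.
move=> x y xy; set n := Num.floor (x - c); set m := Num.floor (y - c).
have /andP[h1 h2] := floor_sub c x; rewrite -/n in h1 h2.
have /andP[h3 h4] := floor_sub c y; rewrite -/m in h3 h4.
have : (n <= m)%R by apply: le_floor; lra.
rewrite le_eqVlt => /orP[/eqP nm|nm].
  rewrite !(@glueE _ _ _ n) ?h1 ?(ltW h2) ?nm ?h3 ?(ltW h4)// -nm.
  by rewrite ltrD2l; apply: piece_lt; rewrite -?nm in h3 h4; lra.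
have /andP[_ h5] := glue_itv c lab nu x; rewrite -/n in h5.
have /andP[h6 _] := glue_itv c lab nu y; rewrite -/m in h6.
have : (n + 1)%:~R <= m%:~R :> R by rewrite ler_int; lia.
by rewrite intrD => ?; lra.
Qed.

Let glue_homeo c lab nu : homeo [set: R] := Homeo (increasing_bij_homeo
  (glueK c lab nu)
  (fun x => etrans (congr1 (fun u : homeo _ => glue c lab u _)
                      (esym (monoid.invgK nu))) (glueK c lab (nu^-1)%g x))
  (@glue_lt c lab nu)).

Lemma zeta_exists rho nu : exists h, is_zeta rho nu h.
Proof.
exists (glue_homeo 0 (fun n => rho (2 * n + 1) == LbV) nu) => n.
split=> rhon x; rewrite in_itv /= => xn; rewrite (@glueE _ _ _ n) ?add0r//.
  by rewrite rhon /piece /isom/= !subr0 add0r.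
by rewrite rhon /piece /isom_or/= !subr0; ring.
Qed.

Lemma chi_exists rho nu : exists h, is_chi rho nu h.
Proof.
exists (glue_homeo (- 2^-1) (fun n => rho (2 * n) == LaV) nu) => n.
split=> rhon x; rewrite in_itv /= => /andP[x1 x2];
  (rewrite (@glueE _ _ _ n); last by apply/andP; split; lra);
  rewrite rhon /piece /isom /isom_or/=.
  have -> : 0 + (x - (n%:~R - 2^-1)) = x - - 2^-1 - n%:~R by ring.
  by ring.
have -> : 1 - (x - (n%:~R - 2^-1)) = 1 - (x - - 2^-1 - n%:~R) by ring.
by field.
Qed.

Lemma zeta_unique rho nu h h' : labelling rho ->
  is_zeta rho nu h -> is_zeta rho nu h' -> h = h'.
Proof.
move=> [_ lab] hP h'P; apply: homeo_inj => x.
have /andP[x1 x2] := floor_sub 0 x; set n := Num.floor _ in x1 x2.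
have xn : x \in `[n%:~R, n%:~R + 1] by rewrite in_itv /=; lra.
have [[hb hbV] [h'b h'bV]] := (hP n, h'P n).
have := lab n; rewrite !inE => /orP[/eqP e|/eqP e].
  by rewrite (hb e) ?(h'b e).
by rewrite (hbV e) ?(h'bV e).
Qed.

Lemma chi_unique rho nu h h' : labelling rho ->
  is_chi rho nu h -> is_chi rho nu h' -> h = h'.
Proof.
move=> [lab _] hP h'P; apply: homeo_inj => x.
have /andP[x1 x2] := floor_sub (- 2^-1) x; set n := Num.floor _ in x1 x2.
have xn : x \in `[n%:~R - 2^-1, n%:~R + 2^-1].
  by rewrite in_itv /=; apply/andP; split; lra.
have [[hb hbV] [h'b h'bV]] := (hP n, h'P n).
have := lab n; rewrite !inE => /orP[/eqP e|/eqP e].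
  by rewrite (hb e) ?(h'b e).
by rewrite (hbV e) ?(h'bV e).
Qed.

End GeneratorsWellDefined.

(* Main.v *)
(** Let [E] be the central extension of [G_rho] by [R] defined by a bounded cocycle,
    and [phi] the homogeneous quasimorphism on [E] that is the identity on the
    centre. If [phi] is at bounded distance from a homomorphism, the cocycle has a
    bounded primitive. Commuting elements of [G_rho] have commuting lifts, so [phi]
    is additive on pairs that have arbitrarily many commuting conjugates.

    Since [rho] is quasi-periodic it is not periodic, so a long word occurs in [rho],
    up to inversion, at a syndetic set [V] of points that are far apart. Elements of
    [G_rho] fixing a neighbourhood of [V] are displaced by an element of [G_rho] that
    pushes each interval between consecutive points of [V] towards one of its ends,
    in the same way on all the copies of the interval: [phi] is additive on the
    elements that are trivial near [V]. Every [g] is a product [l * a] with [l]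
    supported in balls around [V] and [a] trivial near [V], and [phi l + phi a] does
    not depend on the choices, as one sees by comparing with a set [V'] far from [V].
    It is the required homomorphism.

    The elements of [G_rho] acting only at the occurrences of a word are produced by
    commutators of elements acting on overlapping half-cells, and by Higman's
    argument one nontrivial such element yields all the commutators of compactly
    supported elements of [H]. *)
Require Import Defs.
From HB Require Import structures.
From mathcomp Require Import all_boot all_order all_algebra.
From mathcomp Require Import all_classical all_reals all_analysis.
From mathcomp Require Import ring lra zify.
Set Implicit Arguments.
Unset Strict Implicit.
Unset Printing Implicit Defensive.
Import Order.TTheory GRing.Theory Num.Theory.
Import numFieldNormedType.Exports.
Local Open Scope classical_set_scope.
Local Open Scope ring_scope.

(** * Homogeneous quasimorphisms *)

(** Elements built from the labelling act in the same way at all the occurrences of a word, so their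
    supports run along the whole line and cannot be pushed away to one side. What can be displaced
    is an element trivial near a syndetic set: its support lies in bounded gaps, of finitely many
    types, and each gap has room to be squeezed towards an end. The other factor [l] is also within
    reach, because it is trivial near any second set of centers far from the first. The splitting
    has to be uniform. In [fragments] the bound [m] depends on the group element alone, so any
    sufficiently sparse set of centers serves, and two sets can be compared through a third one
    placed far from both. The remark used throughout is that a letter differs from its inverse: two
    occurrences of a word in opposite directions cannot send the same letter to the same place. It
    underlies aperiodicity, sparseness and the disjointness of copies. *)

Section Quasimorphisms.
Variables (R : realType) (E : groupType).
Implicit Types (f : E -> R) (x y : E).

Lemma bounded_multiples_eq0 (t C : R) : (forall n, n.+1%:R * t <= C) -> t <= 0.
Proof.
move=> tC; rewrite leNgt; apply/negP => t0.
have C0 : 0 <= C by apply: le_trans (tC 0%N); rewrite mul1r ltW.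
have := archi_boundP (divr_ge0 C0 (ltW t0)); set n := Num.bound _ => Cn.
have := tC n; rewrite leNgt => /negP; apply.
rewrite -ltr_pdivrMr//; apply: lt_trans Cn _.
by rewrite ltr_nat.
Qed.

Lemma bounded_multiples_norm_eq0 (t C : R) :
  (forall n, `|n.+1%:R * t| <= C) -> t = 0.
Proof.
move=> tC; apply/eqP; rewrite -normr_le0; apply: (@bounded_multiples_eq0 _ C) => n.
by have := tC n; rewrite normrM ger0_norm ?ler0n.
Qed.

Definition quasimorphism f (D : R) := forall x y, `|f (x * y)%g - f x - f y| <= D.

Definition homogeneous f := forall x n, f (x ^+ n)%g = n%:R * f x.

Section Homogenization.
Variables (f : E -> R) (D : R).
Hypothesis fD : quasimorphism f D.

Let D0 : 0 <= D. Proof. exact: le_trans (normr_ge0 _) (fD 1%g 1%g). Qed.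

Let quasi_expg x n : `|f (x ^+ n.+1)%g - n.+1%:R * f x| <= n.+1%:R * D.
Proof.
elim: n => [|n IHn]; first by rewrite expg1 !mul1r subrr normr0.
rewrite expgSr; have := fD (x ^+ n.+1)%g x.
move: IHn; rewrite !ler_norml -[n.+2%:R]natr1; set m := n.+1%:R => /andP[? ?] /andP[? ?].
by apply/andP; split; nra.
Qed.

(** The limit of [f (x ^+ n) / n], taken as a supremum: the lower estimates with [- D] never exceed
    the upper estimates with [+ D], so no convergence has to be proved. *)
Definition homogenize x : R := sup [set (f (x ^+ n.+1)%g - D) / n.+1%:R | n in [set: nat]].

Let homogenizeP x n : `|f (x ^+ n.+1)%g - n.+1%:R * homogenize x| <= D.
Proof.
have cross m k : (f (x ^+ m.+1)%g - D) / m.+1%:R <= (f (x ^+ k.+1)%g + D) / k.+1%:R.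
  rewrite ler_pdivrMr ?ltr0n// mulrAC ler_pdivlMr ?ltr0n//.
  have := quasi_expg (x ^+ m.+1)%g k; have := quasi_expg (x ^+ k.+1)%g m.
  rewrite -!expgnA (mulnC k.+1) !ler_norml => /andP[? ?] /andP[? ?]; nra.
have hs : has_sup [set (f (x ^+ n.+1)%g - D) / n.+1%:R | n in [set: nat]].
  split; first by exists ((f (x ^+ 1)%g - D) / 1%:R); exists 0%N.
  by exists ((f (x ^+ 1)%g + D) / 1%:R) => _ [m _ <-]; exact: cross.
have h1 : (f (x ^+ n.+1)%g - D) / n.+1%:R <= homogenize x.
  by apply: ub_le_sup; [exact: hs.2|exists n].
have h2 : homogenize x <= (f (x ^+ n.+1)%g + D) / n.+1%:R.
  by apply: ge_sup => [|_ [m _ <-]]; [exact: hs.1|exact: cross].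
move: h1 h2; rewrite ler_pdivrMr ?ltr0n// ler_pdivlMr ?ltr0n// mulrC => h1 h2.
by rewrite ler_norml; apply/andP; split; lra.
Qed.

Lemma homogenize_close x : `|f x - homogenize x| <= D.
Proof. by have := homogenizeP x 0; rewrite expg1 mul1r. Qed.

Lemma homogenize_homogeneous : homogeneous homogenize.
Proof.
have f1 : homogenize 1%g = 0.
  apply: (@bounded_multiples_norm_eq0 _ (D + `|f 1%g|)) => n.
  have := homogenizeP 1%g n; rewrite expg1n => h.
  have -> : n.+1%:R * homogenize 1%g = f 1%g - (f 1%g - n.+1%:R * homogenize 1%g) by ring.
  by rewrite (le_trans (ler_normB _ _))// addrC lerD.
move=> x [|k]; first by rewrite mul0r expg0 f1.
apply/eqP; rewrite -subr_eq0; apply/eqP.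
apply: (@bounded_multiples_norm_eq0 _ (D + D)) => n.
have := homogenizeP (x ^+ k.+1)%g n.
have := homogenizeP x (k.+1 * n.+1).-1; rewrite prednK// -expgnA natrM.
rewrite !ler_norml => /andP[? ?] /andP[? ?]; apply/andP; split; nra.
Qed.

Lemma homogenize_quasimorphism : quasimorphism homogenize (4 * D).
Proof.
move=> x y; have := homogenize_close (x * y)%g.
have := homogenize_close x; have := homogenize_close y; have := fD x y.
rewrite !ler_norml => /andP[? ?] /andP[? ?] /andP[? ?] /andP[? ?].
by apply/andP; split; lra.
Qed.

End Homogenization.

Section Homogeneous.
Variables (f : E -> R) (D : R).
Hypotheses (fD : quasimorphism f D) (fX : homogeneous f).

Lemma homogeneousJ x y : f (x ^ y)%g = f x.
Proof.
apply/eqP; rewrite -subr_eq0; apply/eqP.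
apply: (@bounded_multiples_norm_eq0 _ (D + D + `|f y^-1%g| + `|f y|)) => n.
rewrite mulrBr -!fX -conjXg; set z := (x ^+ _)%g; rewrite conjgE.
have := fD y^-1%g (z * y)%g; have := fD z y.
have := ler_norm (f y); have := ler_norm (- f y); rewrite normrN.
have := ler_norm (f y^-1%g); have := ler_norm (- f y^-1%g); rewrite normrN.
rewrite !ler_norml => ? ? ? ? /andP[? ?] /andP[? ?].
by apply/andP; split; lra.
Qed.

Lemma homogeneous_commuteM x y : commute x y -> f (x * y)%g = f x + f y.
Proof.
move=> xy; apply/eqP; rewrite -subr_eq0; apply/eqP.
apply: (@bounded_multiples_norm_eq0 _ D) => n.
by rewrite mulrBr mulrDr -!fX expgMn// opprD addrA.
Qed.

(* With [N] commuting copies of the pair [(x, y)], the defect of [f] at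
   [(x, y)] is multiplied by [N] and still bounded. *)
Lemma commuting_conjugatesM t x y :
  (forall n x' y', x' \in [:: x; y] -> y' \in [:: x; y] ->
     commute (x' ^ (t ^+ n.+1))%g y') ->
  f (x * y)%g = f x + f y.
Proof.
move=> txy.
have comm i j x' y' : (i < j)%N -> x' \in [:: x; y] -> y' \in [:: x; y] ->
    commute (x' ^ (t ^+ j))%g (y' ^ (t ^+ i))%g.
  move=> ij x'P y'P; rewrite -(subnK ij) addnS -addSn expgnDr conjgM.
  by rewrite /commute -!conjMg; congr conjg; exact: txy.
pose P z N := (\prod_(i < N) z ^ (t ^+ i))%g.
have PS z N : P z N.+1 = (P z N * z ^ (t ^+ N))%g by rewrite /P big_ord_recr.
have commP N z z' : z \in [:: x; y] -> z' \in [:: x; y] ->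
    commute (P z N) (z' ^ (t ^+ N))%g.
  by move=> zP z'P; apply: commute_sym; apply: commute_prod => i _; exact: comm.
have xP : x \in [:: x; y] by rewrite !inE eqxx.
have yP : y \in [:: x; y] by rewrite !inE eqxx orbT.
have fP z N : z \in [:: x; y] -> f (P z N) = N%:R * f z.
  move=> zP; elim: N => [|N IHN]; first by rewrite /P big_ord0 mul0r -(expg0 1%g) fX mul0r.
  rewrite PS homogeneous_commuteM; last exact: commP.
  by rewrite IHN homogeneousJ -natr1 mulrDl mul1r.
have fPM N : f (P x N * P y N)%g = N%:R * f (x * y)%g.
  elim: N => [|N IHN]; first by rewrite /P !big_ord0 mulg1 mul0r -(expg0 1%g) fX mul0r.
  have -> : (P x N.+1 * P y N.+1 = (P x N * P y N) * (x * y) ^ (t ^+ N))%g.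
    move: (commP N y x yP xP); rewrite !PS conjMg.
    move: (P x N) (P y N) (x ^ _)%g (y ^ _)%g => p q a b qa.
    by rewrite -!mulgA; congr (_ * _)%g; rewrite !mulgA qa.
  rewrite [LHS]homogeneous_commuteM; first by rewrite IHN homogeneousJ -natr1 mulrDl mul1r.
  rewrite conjMg; apply: commuteM; apply: commute_sym; apply: commuteM; apply: commute_sym;
    exact: commP.
apply/eqP; rewrite -subr_eq0 opprD addrA; apply/eqP.
apply: (@bounded_multiples_norm_eq0 _ D) => n.
by rewrite !mulrBr -fPM -!fP//.
Qed.

End Homogeneous.

End Quasimorphisms.

(** * Central extensions *)

Section TwoCocycles.
Variables (R : realType) (G : groupType).

Lemma coboundary1E (f : 1.-tuple G -> R) (g h : G) :
  coboundary f [tuple g; h] = f [tuple h] - f [tuple (g * h)%g] + f [tuple g].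
Proof.
rewrite /coboundary big_ord1 !expr1 sqrrN expr1n mulN1r mul1r.
by congr (f _ - f _ + f _); apply/eq_from_tnth => i; case: i => [[|//] ?];
  rewrite /merge ?tnth_mktuple !(tnth_nth g).
Qed.

Lemma coboundary2E (f : 2.-tuple G -> R) (g h k : G) :
  coboundary f [tuple g; h; k] = f [tuple h; k] - f [tuple (g * h)%g; k]
    + f [tuple g; (h * k)%g] - f [tuple g; h].
Proof.
rewrite /coboundary big_ord_recl big_ord1 /bump /= expr1 sqrrN expr1n.
rewrite -[3%N]/(2.+1)%N exprS sqrrN expr1n mulr1 !mulN1r mul1r addrA.
by congr (f _ - f _ + f _ - f _); apply/eq_from_tnth => i; case: i => [[|[|//]] ?];
  rewrite /merge ?tnth_mktuple !(tnth_nth g).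
Qed.

Record cocycle2 := Cocycle2 {
  cocycle2_fun :> G -> G -> R;
  cocycle2P : forall g h k, cocycle2_fun h k + cocycle2_fun g (h * k)%g =
    cocycle2_fun (g * h)%g k + cocycle2_fun g h }.

Definition extension (c : cocycle2) : Type := (G * R)%type.

Section Extension.
Variable c : cocycle2.

Lemma cocycle2_1g k : c 1%g k = c 1%g 1%g.
Proof. by have := cocycle2P c 1%g 1%g k; rewrite !mul1g => /addrI. Qed.

Lemma cocycle2_g1 k : c k 1%g = c 1%g 1%g.
Proof.
by have := cocycle2P c k 1%g 1%g; rewrite !mulg1 => /addIr.
Qed.

HB.instance Definition _ := Choice.on (extension c).

(** The cocycle need not be normalized, so the unit carries the correction [- c 1 1]. *)
Let one : extension c := (1%g, - c 1%g 1%g).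
Let mul (x y : extension c) : extension c :=
  ((x.1 * y.1)%g, x.2 + y.2 + c x.1 y.1).
Let inv (x : extension c) : extension c :=
  (x.1^-1%g, - x.2 - c x.1^-1%g x.1 - c 1%g 1%g).

Let mulA : associative mul.
Proof.
move=> [g a] [h b] [k d]; congr pair; rewrite /= ?mulgA//.
have := cocycle2P c g h k; lra.
Qed.

Let mul1 : left_id one mul.
Proof. by move=> [g a]; congr pair; rewrite /= ?mul1g// cocycle2_1g; ring. Qed.

Let mulr1 : right_id one mul.
Proof. by move=> [g a]; congr pair; rewrite /= ?mulg1// cocycle2_g1; ring. Qed.

Let mulV : left_inverse one inv mul.
Proof. by move=> [g a]; congr pair; rewrite /= ?mulVg//; ring. Qed.

Let mulVr : right_inverse one inv mul.
Proof.
move=> [g a]; congr pair; rewrite /= ?mulgV//.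
have := cocycle2P c g g^-1%g g; rewrite mulgV mulVg cocycle2_1g cocycle2_g1; lra.
Qed.

HB.instance Definition _ :=
  isGroup.Build (extension c) mulA mul1 mulr1 mulV mulVr.

Implicit Types x y : extension c.

Lemma ext_mulE x y : (x * y)%g = ((x.1 * y.1)%g, x.2 + y.2 + c x.1 y.1).
Proof. by []. Qed.

Lemma ext_fstM x y : (x * y)%g.1 = (x.1 * y.1)%g. Proof. by []. Qed.

Lemma ext_fstV x : x^-1%g.1 = x.1^-1%g. Proof. by []. Qed.

Lemma ext_fstX x n : (x ^+ n)%g.1 = (x.1 ^+ n)%g.
Proof. by elim: n => [//|n IHn]; rewrite !expgS ext_fstM IHn. Qed.

Definition ext_central (r : R) : extension c := (1%g, r - c 1%g 1%g).

Lemma ext_shift x r : ((x.1, x.2 + r) : extension c) = (x * ext_central r)%g.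
Proof. by rewrite ext_mulE mulg1 cocycle2_g1; congr pair; rewrite /=; ring. Qed.

Lemma ext_central_commute x r : commute x (ext_central r).
Proof.
by rewrite /commute !ext_mulE mulg1 mul1g cocycle2_g1 cocycle2_1g (addrC x.2).
Qed.

Lemma ext_centralX r n : (ext_central r ^+ n)%g = ext_central (n%:R * r).
Proof.
elim: n => [|n IHn]; first by rewrite expg0 mul0r /ext_central sub0r.
rewrite expgS IHn ext_mulE mulg1 /ext_central -[n.+1%:R]natr1 /=.
by congr pair; ring.
Qed.

Section QM.
Variables (M : R).
Hypothesis cM : forall g h, `|c g h| <= M.

Lemma ext_snd_quasi : quasimorphism (fun x => x.2) M.
Proof.
move=> x y; rewrite ext_mulE /=; apply: le_trans (cM x.1 y.1).
by rewrite [X in `|X|](_ : _ = c x.1 y.1)//; ring.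
Qed.

Definition ext_qm x : R := homogenize (fun x => x.2) M x.

Let qmX : homogeneous ext_qm := homogenize_homogeneous ext_snd_quasi.

Let qmD : quasimorphism ext_qm (4 * M) := homogenize_quasimorphism ext_snd_quasi.

Lemma ext_qm_central r : ext_qm (ext_central r) = r.
Proof.
apply/eqP; rewrite -subr_eq0; apply/eqP.
apply: (@bounded_multiples_norm_eq0 _ _ (M + M)) => n.
rewrite mulrBr -qmX ext_centralX.
have := homogenize_close ext_snd_quasi (ext_central (n.+1%:R * r)) => /=.
rewrite -/(ext_qm _); have := cM 1%g 1%g.
by rewrite !ler_norml => /andP[? ?] /andP[? ?]; apply/andP; split; lra.
Qed.

Lemma ext_qm_shift x r : ext_qm (x.1, x.2 + r) = ext_qm x + r.
Proof.
rewrite ext_shift (homogeneous_commuteM qmD qmX) ?ext_qm_central//.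
exact: ext_central_commute.
Qed.

(** The lifts commute up to a central [r], so [x ^ y] is [x] times this central element, and the
    conjugation invariance of [ext_qm] forces [r = 0]. Boundedness of the cocycle enters here,
    through [ext_qm]. *)
Lemma ext_lift_commute x y : commute x.1 y.1 -> commute x y.
Proof.
move=> xy; pose r := (x * y)%g.2 - (y * x)%g.2.
have xyr : (x * y)%g = (y * x * ext_central r)%g.
  rewrite -ext_shift; apply: injective_projections => /=; first exact: xy.
  by rewrite /r/=; ring.
have : ext_qm (x ^ y)%g = ext_qm x by exact: homogeneousJ qmD qmX x y.
rewrite conjgE xyr -mulgA mulKg -ext_shift ext_qm_shift => xr.
have r0 : r = 0 by lra.
by rewrite /commute xyr r0 -ext_shift addr0 -surjective_pairing.
Qed.

End QM.

End Extension.

(* On the extension, [psi (l * a) := phi l + phi a], for [l] over [Sup P] and [a]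
   over [Fix P], is a homomorphism at bounded distance from [phi], and
   [g |-> psi (g, 0)] is a bounded primitive of [c]. *)
Lemma bounded_coboundary_criterion (c : 2.-tuple G -> R)
    (Conf : Type) (Sup Fix : Conf -> set G) (perp : Conf -> Conf -> Prop)
    (ok : G -> Conf -> Prop) :
  bounded_cochain c -> coboundary c = 0 ->
  (forall P, is_subgroup (Sup P)) ->
  (forall P, is_subgroup (Fix P)) ->
  (forall P, exists t, forall n x y, Fix P x -> Fix P y ->
     commute (x ^ (t ^+ n.+1))%g y) ->
  (forall P Q, perp P Q -> [/\ Sup P `<=` Fix Q, Sup Q `<=` Fix P &
     forall x y, Sup P x -> Sup Q y -> commute x y]) ->
  (forall g P P', ok g P -> ok g P' -> exists Q,
     [/\ perp P Q, perp P' Q & exists2 l, Sup Q l & Fix Q (l^-1 * g)%g]) ->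
  (forall g h, exists P l m,
     [/\ ok g P, ok h P & ok (g * h)%g P] /\
     [/\ Sup P l, Sup P m, Fix P (l^-1 * g)%g, Fix P (m^-1 * h)%g &
       Fix P ((l^-1 * g) ^ m)%g]) ->
  is_bounded_coboundary c.
Proof.
move=> [M cM] c0 SupG FixG disp perpP perp_ex dec_ex.
have c2P g h k : c [tuple h; k] + c [tuple g; (h * k)%g] =
    c [tuple (g * h)%g; k] + c [tuple g; h].
  have : coboundary c [tuple g; h; k] = 0 by rewrite c0.
  by rewrite coboundary2E => ?; lra.
pose c2 := @Cocycle2 (fun g h => c [tuple g; h]) c2P.
have c2M g h : `|c2 g h| <= M by exact: cM.
pose phi := @ext_qm c2 M.
have phiD : quasimorphism phi (4 * M) := homogenize_quasimorphism (ext_snd_quasi c2M).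
have phiX : homogeneous phi := homogenize_homogeneous (ext_snd_quasi c2M).
have SupM P x y : Sup P x -> Sup P y -> Sup P (x * y)%g by have [] := SupG P; auto.
have FixM P x y : Fix P x -> Fix P y -> Fix P (x * y)%g by have [] := FixG P; auto.
have FixV P x : Fix P x -> Fix P x^-1%g by have [] := FixG P; auto.
have fix_add P (x y : extension c2) : Fix P x.1 -> Fix P y.1 ->
    phi (x * y)%g = phi x + phi y.
  move=> Px Py; have [t tP] := disp P.
  apply: (commuting_conjugatesM phiD phiX (t := (t, 0) : extension c2)).
  have PP z : z \in [:: x; y] -> Fix P z.1 by rewrite !inE => /orP[] /eqP ->.
  move=> n x' y' /PP Px' /PP Py'; apply: (ext_lift_commute c2M).
  rewrite conjgE !ext_fstM ext_fstV ext_fstX -conjgE; exact: tP.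
(* [v] is the value proposed for [psi x] by one decomposition; different [P], [l], [a] may serve for
   the same [x]. *)
pose Dec (x : extension c2) v := exists P (l a : extension c2),
  [/\ ok x.1 P, Sup P l.1, Fix P a.1, x = (l * a)%g & v = phi l + phi a].
have compare P Q (l a m : extension c2) : perp P Q -> Sup P l.1 -> Fix P a.1 ->
    Sup Q m.1 -> Fix Q (m^-1 * (l * a))%g.1 ->
    phi l + phi a = phi m + phi (m^-1 * (l * a))%g.
  move=> /perpP[PQ QP com] Pl Pa Qm; set a' := (_ * (l * a))%g => Qa'.
  have lm : commute l m by apply: (ext_lift_commute c2M); exact: com.
  (* The two decompositions become [l * (m * b)] and [m * (l * b)], and both sides equal
     [phi l + phi m + phi b]. *)
  pose b := (m^-1 * a)%g.
  have ab : a = (m * b)%g by rewrite /b mulVKg.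
  have a'b : a' = (l * b)%g.
    by rewrite /a' /b !mulgA (commuteV lm).
  have Pb : Fix P b.1 by apply: FixM => //; apply: FixV; exact: QP.
  have Qb : Fix Q b.1.
    have -> : b = (l^-1 * a')%g by rewrite a'b mulKg.
    by apply: FixM => //; apply: FixV; exact: PQ.
  rewrite a'b ab (fix_add P)//; last exact: QP.
  by rewrite (fix_add Q)//; [ring|exact: PQ].
have Dec_uniq x v v' : Dec x v -> Dec x v' -> v = v'.
  move=> [P [l [a [okP Pl Pa xE ->]]]] [P' [l' [a' [okP' Pl' Pa' xE' ->]]]].
  have [Q [PQ P'Q [m Qm Qm']]] := perp_ex _ _ _ okP okP'.
  have := @compare P Q l a (m, 0) PQ Pl Pa Qm; rewrite -xE => -> //.
  by have := @compare P' Q l' a' (m, 0) P'Q Pl' Pa' Qm; rewrite -xE' => ->.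
have DecM x y : exists v w, [/\ Dec x v, Dec y w & Dec (x * y)%g (v + w)].
  have [P [l [m [[okx oky okxy] [Pl Pm Plx Pmy Plxm]]]]] := dec_ex x.1 y.1.
  pose l' : extension c2 := (l, 0); pose m' : extension c2 := (m, 0).
  exists (phi l' + phi (l'^-1 * x)%g), (phi m' + phi (m'^-1 * y)%g); split.
  - by exists P, l', (l'^-1 * x)%g; rewrite mulVKg.
  - by exists P, m', (m'^-1 * y)%g; rewrite mulVKg.
  - exists P, (l' * m')%g, ((l'^-1 * x) ^ m' * (m'^-1 * y))%g; split=> //.
    + exact: SupM.
    + exact: FixM.
    + by rewrite conjgE -!mulgA !mulVKg.
    + rewrite (fix_add P _ (m'^-1 * y)%g)// (homogeneousJ phiD phiX).
      (* Elements of [Sup P] lie in [Fix Q] for [Q] perpendicular to [P], so [phi] is additive on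
         them as well. *)
      have [Q [PQ _ _]] := perp_ex _ _ _ okx okx.
      have [sPQ _ _] := perpP _ _ PQ.
      by rewrite (fix_add Q)//; [ring|exact: sPQ|exact: sPQ].
have Dec_ex x : exists v, Dec x v by have [v [_ [xv _ _]]] := DecM x x; exists v.
pose psi x := get (Dec x).
have psiP x : Dec x (psi x) by have [v xv] := Dec_ex x; exact: getI xv.
have psiM x y : psi (x * y)%g = psi x + psi y.
  have [v [w [xv yw xyvw]]] := DecM x y.
  rewrite (Dec_uniq _ _ _ (psiP (x * y)%g) xyvw).
  by rewrite (Dec_uniq _ _ _ (psiP x) xv) (Dec_uniq _ _ _ (psiP y) yw).
have psi_close x : `|psi x - phi x| <= 4 * M.
  have [P [l [a [_ _ _ -> ->]]]] := psiP x.
  by rewrite distrC opprD addrA; exact: phiD.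
have psi_shift x r : psi (x.1, x.2 + r) = psi x + r.
  have [P [l [a [okx Pl Pa xE xv]]]] := psiP x.
  apply: Dec_uniq (psiP _) _; exists P, l, (a.1, a.2 + r); split=> //.
    by rewrite !ext_shift mulgA -xE.
  by rewrite /phi ext_qm_shift// addrA xv.
exists (fun g => psi (tnth g ord0, 0)); split.
  exists (4 * M + M) => g; have := psi_close (tnth g ord0, 0).
  have := homogenize_close (ext_snd_quasi c2M) (tnth g ord0, 0).
  rewrite -/(ext_qm _ _) -/phi /= !ler_norml => /andP[? ?] /andP[? ?].
  by apply/andP; split; lra.
apply/funext => -[[|g [|h []]] // sz].
have -> : Tuple sz = [tuple g; h] by exact: val_inj.
rewrite coboundary1E !(tnth_nth g)/=.
have := psiM (g, 0) (h, 0); rewrite ext_mulE /= !add0r.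
by have := psi_shift ((g * h)%g, 0) (c [tuple g; h]); rewrite /= add0r => -> ?; lra.
Qed.

End TwoCocycles.

(** * Occurrences of words in a labelling *)

(* [aff b q] acts on half-integers as an isometry of the line preserving the
   set of integers, in the coordinates in which [k : int] stands for [k / 2]. *)
Definition aff (b : bool) (q j : int) : int := if b then 2 * q - j else 2 * q + j.

Definition aff_inv (b : bool) (q : int) : int := if b then q else - q.

Lemma affK b q : cancel (aff b q) (aff b (aff_inv b q)).
Proof. by case: b => j; rewrite /aff /aff_inv; lia. Qed.

Lemma affVK b q : cancel (aff b (aff_inv b q)) (aff b q).
Proof. by case: b => j; rewrite /aff /aff_inv; lia. Qed.

Lemma aff_comp b q b' q' : exists q'', forall j,
  aff b q (aff b' q' j) = aff (b (+) b') q'' j.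
Proof.
by exists (if b then q - q' else q + q'); case: b; case: b' => j; rewrite /aff/=; lia.
Qed.

Section Patterns.
Variable e : int -> bool.

(* [aff b q] maps the window [[l, h]] to an occurrence of its word (for [b]
   false) or of the inverse of its word (for [b] true). *)
Definition occurs (l h : int) (b : bool) (q : int) : Prop :=
  forall j, l <= j <= h -> e (aff b q j) = b (+) e j.

Definition vertices (j l h : int) : set int :=
  [set m | exists b q, occurs l h b q /\ m = aff b q j].

Definition recurrent : Prop := forall l h : int, exists n : int, forall x : int,
  exists q : int, x <= l + 2 * q <= x + n /\ occurs l h false q.

Definition reversible : Prop := forall l h : int, exists q : int, occurs l h true q.

Lemma occurs_id l h : occurs l h false 0.
Proof. by move=> j _; rewrite /aff mulr0 add0r. Qed.

Lemma vertices_ref j l h : vertices j l h j.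
Proof. by exists false, 0; split; [exact: occurs_id|rewrite /aff; lia]. Qed.

Lemma occurs_comp l h b q l' h' b' q' : occurs l h b q -> occurs l' h' b' q' ->
  (forall j, l' <= j <= h' -> l <= aff b' q' j <= h) ->
  exists2 q'', occurs l' h' (b (+) b') q'' & 
    forall j, aff b q (aff b' q' j) = aff (b (+) b') q'' j.
Proof.
move=> oc oc' lh; have [q'' q''E] := aff_comp b q b' q'.
by exists q'' => // j jlh; rewrite -q''E oc ?lh// oc'// addbA.
Qed.

Lemma occurs_inv l h b q l' h' : occurs l h b q ->
  (forall j, l' <= j <= h' -> l <= aff b (aff_inv b q) j <= h) ->
  occurs l' h' b (aff_inv b q).
Proof.
move=> oc lh j jlh; have := oc _ (lh _ jlh); rewrite affVK => ->.
by rewrite addbA addbb.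
Qed.

Lemma occurs_vertices k r l h b q i : occurs l h b q ->
  l <= i - r -> i + r <= h ->
  vertices k (k - r) (k + r) i -> vertices k (k - r) (k + r) (aff b q i).
Proof.
move=> oc li ih [b' [q' [oc' iE]]].
have [j|q'' oc'' q''E] := occurs_comp oc oc'.
  by move: li ih; rewrite iE /aff; case: (b'); lia.
by exists (b (+) b'), q''; rewrite iE.
Qed.

Lemma occurs_verticesV k r l h b q i : occurs l h b q ->
  l <= i - r -> i + r <= h ->
  vertices k (k - r) (k + r) (aff b q i) -> vertices k (k - r) (k + r) i.
Proof.
move=> oc li ih Vi; rewrite -[i](affK b q).
apply: (@occurs_vertices _ _ (aff b q i - r) (aff b q i + r)) => //.
by apply: occurs_inv oc _ => j; move: li ih; rewrite /aff /aff_inv; case: (b); lia.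
Qed.

(* Otherwise the letter at the common image would be its own inverse. *)
Lemma occurs_opposite l h b b' q q' j : occurs l h b q -> occurs l h b' q' ->
  b != b' -> l <= j <= h -> aff b q j <> aff b' q' j.
Proof.
move=> oc oc' bb' jlh jj'; have := oc _ jlh; rewrite jj' oc'//.
by move: bb'; case: (b); case: (b'); case: (e j).
Qed.

Lemma occurs_inj l h b b' q q' j : occurs l h b q -> occurs l h b' q' ->
  l <= j <= h -> aff b q j = aff b' q' j -> b = b' /\ q = q'.
Proof.
move=> oc oc' jlh jj'; case: (eqVneq b b') => [bb'|bb'].
  by split=> //; move: jj'; rewrite bb' /aff; case: (b'); lia.
by have := occurs_opposite oc oc' bb' jlh.
Qed.

Hypotheses (eQ1 : recurrent) (eQ2 : reversible).

(** By [reversible] the window [[0, 2 * q]], one full period, has a reflection [j |-> 2 * q' - j]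
    that inverts letters. The residue of [q'] modulo the period is its own reflection up to
    multiples of the period, so its letter would equal its inverse. *)
Lemma aperiodic q : q <> 0 -> exists k, e (k + 2 * q) <> e k.
Proof.
wlog q0 : q / 0 < q => [wl q0|_].
  have [/wl|q0'] := ltP 0 q; first exact.
  have qN : 0 < - q by lia.
  have [k kE] := wl (- q) qN ltac:(lia).
  exists (k + 2 * - q); rewrite -addrA -mulrDr addNr mulr0 addr0.
  by move=> /esym.
apply: contrapT => /forallNP per.
have {}per k : e (k + 2 * q) = e k by exact: contrapT (per k).
have perN n k : e (k + 2 * q * n%:Z) = e k.
  elim: n k => [|n IHn] k; first by rewrite mulr0 addr0.
  by rewrite -(IHn k) -(per (k + 2 * q * n%:Z)); congr e; rewrite [Posz n.+1]intS; ring.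
have perZ (n : int) k : e (k + 2 * q * n) = e k.
  case: n => n; first exact: perN.
  by rewrite -(perN n.+1 (k + 2 * q * Negz n)); congr e; rewrite NegzE; ring.
have [q' q'P] := eQ2 0 (2 * q).
have j02 : 0 <= (q' %% (2 * q))%Z <= 2 * q.
  by rewrite modz_ge0 ?ltW ?ltz_pmod//; lia.
have := q'P _ j02; rewrite /aff /=.
have -> : 2 * q' - (q' %% (2 * q))%Z =
    (q' %% (2 * q))%Z + 2 * q * (2 * (q' %/ (2 * q))%Z).
  by have := divz_eq q' (2 * q); lia.
by rewrite perZ; case: e.
Qed.

Lemma aperiodic_window (k : int) (N : nat) : exists r : int, forall q : int, q <> 0 ->
  `|q| <= N%:Z -> exists i, `|i - k| <= r /\ e (i + 2 * q) <> e i.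
Proof.
elim: N => [|N [r rP]]; first by exists 0 => q q0 qN; exfalso; lia.
have [//|i iP] := @aperiodic N.+1%:Z.
have [//|i' i'P] := @aperiodic (- N.+1%:Z).
exists (Num.max r (Num.max `|i - k| `|i' - k|)) => q q0 qN.
have [qN'|qN'] := leP `|q| N%:Z.
  by have [i0 [i0r i0P]] := rP q q0 qN'; exists i0; split=> //; lia.
have [qE|qE] : q = N.+1%:Z \/ q = - N.+1%:Z by lia.
  by exists i; rewrite qE; split=> //; lia.
by exists i'; rewrite qE; split=> //; lia.
Qed.

(** Two close occurrences of the same orientation give a short shift preserving the middle of the
    window, which [aperiodic_window] excludes; two of opposite orientations send some letter near
    [k] to the same place. The [2 * |N|] in the radius keeps the shifted letter inside the
    window. *)
Lemma vertices_sparse (k N : int) : exists r0 : int, forall r, r0 <= r ->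
  forall m m', vertices k (k - r) (k + r) m -> vertices k (k - r) (k + r) m' ->
  m <> m' -> N <= `|m - m'|.
Proof.
have [r0 r0P] := aperiodic_window k `|N|%N.
exists (Num.max r0 0 + 2 * `|N|) => r rr0 m m' [b [q [oc mE]]] [b' [q' [oc' m'E]]] mm'.
rewrite leNgt; apply/negP => mN.
have [bb'|bb'] := eqVneq b b'; last first.
  have := @occurs_opposite _ _ _ _ _ _ (if b then q - q' else q' - q) oc oc' bb'.
  by move: bb' mE m'E; rewrite /aff; case: (b); case: (b') => // _ ? ?; apply; lia.
subst b'; pose d := if b then q - q' else q' - q.
have [||i [ik /eqP]] := r0P d.
- by move: mE m'E; rewrite /d /aff; case: (b); lia.
- by move: mE m'E; rewrite /d /aff; case: (b); lia.
have dN : `|2 * d| <= `|N| by move: mE m'E; rewrite /d /aff; case: (b); lia.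
have ir : k - r <= i <= k + r by lia.
have idr : k - r <= i + 2 * d <= k + r by lia.
have : aff b q (i + 2 * d) = aff b q' i by rewrite /aff /d; case: (b); lia.
by move=> /(congr1 e); rewrite oc// oc'// => /addbI ->; rewrite eqxx.
Qed.

Lemma vertices_syndetic (k r : int) : exists2 n : int, 0 <= n & forall x : int,
  exists2 m, x <= m <= x + n & vertices k (k - r) (k + r) m.
Proof.
have [n nP] := eQ1 (k - r) (k + r); exists (Num.max n 0); first by lia.
move=> x; have [q [qx qP]] := nP (x - r).
by exists (aff false q k); [rewrite /aff; lia|exists false, q].
Qed.

End Patterns.

(** * From quasi-periodic labellings to sign sequences *)

Section Labels.
Variable rho : int -> letter.
Hypotheses (rho_labelling : labelling rho) (rho_qp : quasi_periodic rho).

Definition sign (k : int) : bool := (letter_code (rho k)).2.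

(** The kind of letter, [a] or [b], is the parity of the index. Hence an occurrence of a word is a
    translation by an even number, an occurrence of its inverse a reflection [j |-> 2 * q - j], and
    beyond this only the [sign] matters. *)
Lemma label_parity k : (letter_code (rho k)).1 = (k %% 2 != 0)%Z.
Proof.
have [lab_a lab_b] := rho_labelling.
have [kE|kE] : k = 2 * (k %/ 2)%Z \/ k = 2 * (k %/ 2)%Z + 1 by lia.
  have -> : (k %% 2 != 0)%Z = false by lia.
  by have := lab_a (k %/ 2)%Z; rewrite -kE !inE => /orP[] /eqP ->.
have -> : (k %% 2 != 0)%Z = true by lia.
by have := lab_b (k %/ 2)%Z; rewrite -kE !inE => /orP[] /eqP ->.
Qed.

Lemma block_wordP k n i : (i <= n)%N -> nth La (block_word rho k n) i = rho (k + i%:Z).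
Proof.
by move=> ni; rewrite (nth_map 0%N) ?size_iota// nth_iota.
Qed.

Lemma size_block_word k n : size (block_word rho k n) = n.+1.
Proof. by rewrite size_map size_iota. Qed.

Lemma sign_recurrent : recurrent sign.
Proof.
move=> l h; have [hl|lh] := ltP h l.
  by exists 2 => x; exists ((x - l + 1) %/ 2)%Z; split; [lia|move=> j; lia].
have [qp _] := rho_qp; have [n nP] := qp l `|h - l|%N.
exists n%:Z => x.
have [s1 [s2 sE]] : exists s1 s2 : seq letter, block_word rho x n =
    @cat letter s1 (@cat letter (block_word rho l `|h - l|%N) s2).
  exact/infixP/nP.
have sz : (size s1 + `|h - l| <= n)%N.
  have := congr1 size sE; rewrite !size_cat !size_block_word; lia.
have rhoE (i : nat) : (i <= `|h - l|)%N -> rho (x + (size s1 + i)%N%:Z) = rho (l + i%:Z).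
  move=> il; rewrite -(@block_wordP x n); last by lia.
  rewrite sE nth_cat ltnNge leq_addr [~~ true]/= addKn nth_cat.
  rewrite size_block_word ltnS il.
  by rewrite block_wordP.
have := congr1 (fun a => (letter_code a).1) (rhoE 0%N isT).
rewrite !label_parity addn0 addr0 => par.
exists ((x + (size s1)%:Z - l) %/ 2)%Z.
have qE : 2 * ((x + (size s1)%:Z - l) %/ 2)%Z = x + (size s1)%:Z - l by lia.
split; first by lia.
move=> j jlh; rewrite /aff qE /=.
have := rhoE `|j - l|%N; rewrite /sign => jE.
have -> : x + (size s1)%:Z - l + j = x + (size s1 + `|j - l|)%N%:Z by lia.
by rewrite jE; [congr (letter_code (rho _)).2; lia|lia].
Qed.

Lemma sign_reversible : reversible sign.
Proof.
move=> l h; have [hl|lh] := ltP h l; first by exists 0 => j; lia.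
have [_ qp] := rho_qp; have [x [p wE]] := qp l `|h - l|%N.
have pE : p = `|h - l|%N.
  by have := congr1 size wE; rewrite size_rev size_map !size_block_word => -[].
have rhoE (i : nat) : (i <= `|h - l|)%N ->
    rho (x + (`|h - l| - i)%N%:Z) = letter_inv (rho (l + i%:Z)).
  move=> il; rewrite -(@block_wordP x p); last by lia.
  rewrite wE /word_inv nth_rev; rewrite size_map size_block_word; last by lia.
  rewrite (nth_map La) ?size_block_word; last by lia.
  by rewrite block_wordP; [congr (letter_inv (rho (_ + _%:Z))); lia|lia].
have parV a : (letter_code (letter_inv a)).1 = (letter_code a).1 by case: a.
have signV a : (letter_code (letter_inv a)).2 = ~~ (letter_code a).2 by case: a.
have := congr1 (fun a => (letter_code a).1) (rhoE 0%N isT).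
rewrite parV !label_parity subn0 addr0 => par.
exists ((x + h) %/ 2)%Z.
have qE : 2 * ((x + h) %/ 2)%Z = x + h by lia.
move=> j jlh; rewrite /aff qE /sign addTb -signV.
have := rhoE `|j - l|%N.
have -> : x + (`|h - l| - `|j - l|)%N%:Z = x + h - j by lia.
have -> : l + `|j - l|%N%:Z = j by lia.
by move=> ->//; lia.
Qed.

End Labels.

(** * Homeomorphisms acting cell by cell *)

Section UnitHomeo.
Variable R : realType.
Local Notation unit_itv := (`[0, 1]%classic : set R).
Implicit Types u v : homeo unit_itv.

Lemma homeo_mulE (I : set R) (f g : homeo I) x : (f * g)%g x = f (g x).
Proof. by []. Qed.

Lemma homeo_invK (I : set R) (f : homeo I) x : (f^-1)%g (f x) = x.
Proof. exact: homeo_cancel (homeoP f) x. Qed.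

Lemma homeo_invVK (I : set R) (f : homeo I) x : f ((f^-1)%g x) = x.
Proof. exact: homeo_invcancel (homeoP f) x. Qed.

Lemma unit_out u x : ~~ (0 < x < 1) -> u x = x.
Proof.
move=> nx; have [->|x0] := eqVneq x 0; first exact: homeo0.
have [->|x1] := eqVneq x 1; first exact: homeo1.
apply: (homeo_outside (homeoP u)); rewrite inE /= in_itv /= => /andP[? ?].
by move/negP: nx; apply; rewrite !lt_def x0 eq_sym x1/=; apply/andP.
Qed.

Lemma unit_in u x : 0 < x < 1 -> 0 < u x < 1.
Proof.
move=> /andP[x0 x1]; apply/andP; split.
  by rewrite -[ltLHS](homeo0 u); apply: homeo_lt => //; exact: ltW.
by rewrite -[ltRHS](homeo1 u); apply: homeo_lt => //; exact: ltW.
Qed.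

Lemma unit_lt u : {homo u : x y / x < y}.
Proof.
move=> x y xy.
have [x01|nx] := boolP (0 < x < 1); have [y01|ny] := boolP (0 < y < 1).
- by apply: homeo_lt => //; lra.
- by rewrite (unit_out u ny); have := unit_in u x01; lra.
- by rewrite (unit_out u nx); have := unit_in u y01; lra.
- by rewrite !unit_out.
Qed.

Lemma unit_homeo_pair (f g : R -> R) : cancel f g -> cancel g f ->
  {homo f : x y / x < y} -> (forall x, ~~ (0 < x < 1) -> f x = x) ->
  is_homeo_pair unit_itv f g.
Proof.
move=> fK gK flt fo.
have [ff fg _ _ cf cg _ _] := increasing_bij_homeo fK gK flt.
have go x : ~~ (0 < x < 1) -> g x = x by move=> /fo fx; rewrite -{1}fx fK.
have f0 : f 0 = 0 by apply: fo; rewrite ltxx.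
have f1 : f 1 = 1 by apply: fo; rewrite ltxx andbF.
have glt : {homo g : x y / x < y}.
  move=> x y xy; rewrite ltNge le_eqVlt; apply/negP => /orP[/eqP yx|/flt].
    by move: xy; rewrite -(gK x) -(gK y) yx ltxx.
  by rewrite !gK ltNge (ltW xy).
have g0 : g 0 = 0 by apply: go; rewrite ltxx.
have g1 : g 1 = 1 by apply: go; rewrite ltxx andbF.
have itvP (h : R -> R) : h 0 = 0 -> h 1 = 1 -> {homo h : x y / x < y} ->
    set_fun unit_itv unit_itv h.
  move=> h0 h1 hlt x /=; rewrite !in_itv /= => /andP[x0 x1].
  have hle : {homo h : x y / x <= y}.
    by move=> a b; rewrite !le_eqVlt => /orP[/eqP ->|/hlt ->]; rewrite ?eqxx ?orbT.
  by rewrite -{1}h0 -[X in _ && (_ <= X)]h1 !hle.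
split=> //; try exact: itvP.
- by apply: continuous_subspaceT; exact: increasing_bij_continuous flt.
- by apply: continuous_subspaceT; exact: increasing_bij_continuous glt.
- by move=> x y _ _; exact: flt.
- move=> x; rewrite inE /= in_itv /= => /negP nx; apply: fo.
  by apply: contra nx => /andP[? ?]; apply/andP; split; exact: ltW.
Qed.

End UnitHomeo.

Section Cells.
Variable R : realType.
Local Notation unit_itv := (`[0, 1]%classic : set R).
Local Notation T := (homeo [set: R]).
Implicit Types (u v : homeo unit_itv) (x : R) (k : int).

(** [aff b q] on the real line, where the index [k] stands for [k / 2]; compare [affR_half]. *)
Definition affR (b : bool) (q : int) x : R := if b then q%:~R - x else q%:~R + x.

Lemma affRK b q : cancel (affR b q) (affR b (aff_inv b q)).
Proof. by case: b => x; rewrite /affR /aff_inv ?rmorphN/=; ring. Qed.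

Lemma affRVK b q : cancel (affR b (aff_inv b q)) (affR b q).
Proof. by case: b => x; rewrite /affR /aff_inv ?rmorphN/=; ring. Qed.

(* [chart b k] maps [[0, 1]] onto the cell of [k / 2], the interval of length 1
   centred there. The generators [zeta] and [chi] both act through these charts,
   on the cells of odd and of even [k] respectively. *)
Definition chart (b : bool) k (t : R) : R :=
  if b then (k%:~R + 1) / 2 - t else (k%:~R - 1) / 2 + t.

Definition chartV (b : bool) k x : R :=
  if b then (k%:~R + 1) / 2 - x else x - (k%:~R - 1) / 2.

Lemma chartK b k : cancel (chart b k) (chartV b k).
Proof. by case: b => x; rewrite /chart /chartV; ring. Qed.

Lemma chartVK b k : cancel (chartV b k) (chart b k).
Proof. by case: b => x; rewrite /chart /chartV; ring. Qed.

Lemma chart_aff b b0 q k t : chart (b (+) b0) (aff b q k) t = affR b q (chart b0 k t).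
Proof.
by case: b; case: b0; rewrite /chart /aff /affR/= ?(rmorphB, rmorphD, rmorphM)/=; field.
Qed.

Lemma chartV_aff b b0 q k x : chartV (b (+) b0) (aff b q k) (affR b q x) = chartV b0 k x.
Proof.
apply: (can_inj (chartK b0 k)); rewrite chartVK; apply: (can_inj (affRK b q)).
by rewrite -chart_aff chartVK.
Qed.

Definition local (b : bool) k (u : R -> R) x : R := chart b k (u (chartV b k x)).

(** A reflection flips the chart and a translation keeps it. Combined with [occurs], this makes
    cellwise elements act alike on all copies of a word, inverted ones included. *)
Lemma local_aff b b0 q k (u : R -> R) x :
  local (b (+) b0) (aff b q k) u (affR b q x) = affR b q (local b0 k u x).
Proof. by rewrite /local chartV_aff chart_aff. Qed.

Lemma local_comp b k (u v : R -> R) x : local b k u (local b k v x) = local b k (u \o v) x.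
Proof. by rewrite /local chartK. Qed.

Lemma chartV_in b k x : (k%:~R - 1 < 2 * x < k%:~R + 1) = (0 < chartV b k x < 1).
Proof. by rewrite /chartV; case: b; apply/idP/idP => /andP[? ?]; apply/andP; split; lra. Qed.

Lemma local_out b k u x : ~~ (k%:~R - 1 < 2 * x < k%:~R + 1) -> local b k u x = x.
Proof. by rewrite (chartV_in b) => /unit_out nx; rewrite /local nx chartVK. Qed.

Lemma local_in b k u x : k%:~R - 1 < 2 * x < k%:~R + 1 ->
  k%:~R - 1 < 2 * local b k u x < k%:~R + 1.
Proof. by rewrite !(chartV_in b) /local chartK; exact: unit_in. Qed.

Lemma local_lt b k u : {homo local b k u : x y / x < y}.
Proof.
move=> x y xy; rewrite /local /chart; case: b => /=.
  by rewrite ltrD2l ltrN2; apply: unit_lt; rewrite /chartV; lra.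
by rewrite ltrD2l; apply: unit_lt; rewrite /chartV; lra.
Qed.

Definition oddz k : bool := (k %% 2 != 0)%Z.

(** The cells of one parity tile the line. They are half-open here, but every [local] fixes the
    endpoints, so [cellwiseE] holds on closed cells. *)
Definition cell_index (p : bool) x : int := 2 * Num.floor (x + (~~ p)%:R / 2) + p%:Z.

Lemma cell_indexP p x :
  (cell_index p x)%:~R - 1 <= 2 * x < (cell_index p x)%:~R + 1.
Proof.
rewrite /cell_index; have := floor_itv (x + (~~ p)%:R / 2).
rewrite !rmorphD rmorphM/=; case: p => /=; rewrite ?mul0r => /andP[? ?];
  by apply/andP; split; lra.
Qed.

Lemma oddz_cell_index p x : oddz (cell_index p x) = p.
Proof. by rewrite /oddz /cell_index; case: p; lia. Qed.

Lemma cell_index_uniq k x : k%:~R - 1 <= 2 * x < k%:~R + 1 ->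
  cell_index (oddz k) x = k.
Proof.
move=> /andP[k1 k2].
have kE : k = 2 * (k %/ 2)%Z + (oddz k)%:Z by rewrite /oddz; lia.
rewrite [RHS]kE /cell_index; congr (2 * _ + _).
apply: floor_def; move: k1 k2; rewrite {1 2}kE !rmorphD rmorphM/=.
by case: (oddz k) => /= ? ?; apply/andP; split; lra.
Qed.

Section Phi.
Variable e : int -> bool.

Definition cellwise_fun p (V : set int) u x : R :=
  let k := cell_index p x in if k \in V then local (e k) k u x else x.

Lemma cellwise_in p V u x (k := cell_index p x) :
  k%:~R - 1 <= 2 * cellwise_fun p V u x < k%:~R + 1.
Proof.
have := cell_indexP p x; rewrite /cellwise_fun -/k => kx; case: ifP => // _.
have [kx'|/local_out->//] := boolP (k%:~R - 1 < 2 * x < k%:~R + 1).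
by have /andP[h1 h2] := local_in (e k) u kx'; rewrite (ltW h1) h2.
Qed.

Lemma cell_index_cellwise p V u x :
  cell_index p (cellwise_fun p V u x) = cell_index p x.
Proof. by rewrite -{1}(oddz_cell_index p x) cell_index_uniq// cellwise_in. Qed.

Lemma cellwise_comp p V u v x :
  cellwise_fun p V u (cellwise_fun p V v x) = cellwise_fun p V (u * v)%g x.
Proof.
have := cell_index_cellwise p V v x; rewrite /cellwise_fun /= => ->.
by case: ifP => kV; rewrite kV ?local_comp.
Qed.

Lemma cellwise_one p V x : cellwise_fun p V 1%g x = x.
Proof. by rewrite /cellwise_fun; case: ifP => // _; rewrite /local/= chartVK. Qed.

Lemma cellwiseK p V u : cancel (cellwise_fun p V u) (cellwise_fun p V u^-1%g).
Proof. by move=> x; rewrite cellwise_comp mulVg cellwise_one. Qed.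

Lemma cellwiseVK p V u : cancel (cellwise_fun p V u^-1%g) (cellwise_fun p V u).
Proof. by move=> x; rewrite cellwise_comp mulgV cellwise_one. Qed.

Lemma cellwise_lt p V u : {homo cellwise_fun p V u : x y / x < y}.
Proof.
move=> x y xy.
have [kxy|kxy] := eqVneq (cell_index p x) (cell_index p y).
  by rewrite /cellwise_fun -kxy; case: ifP => // _; exact: local_lt.
have /= /andP[_ ux] := cellwise_in p V u x.
have /= /andP[uy _] := cellwise_in p V u y.
have : (cell_index p x < cell_index p y)%R.
  rewrite lt_neqAle kxy; have : x + (~~ p)%:R / 2 <= y + (~~ p)%:R / 2 by lra.
  by move=> /le_floor; rewrite /cell_index; lia.
have := oddz_cell_index p x; have := oddz_cell_index p y; rewrite /oddz => o1 o2 lt12.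
have : cell_index p x + 2 <= cell_index p y by lia.
by rewrite -(ler_int R) rmorphD/= => ?; lra.
Qed.

(** For [V = setT] this is a [zeta] ([p] true) or a [chi] ([p] false). For smaller [V] it is not
    obvious that it lies in the group; this is the purpose of the localization. *)
Definition cellwise p V u : T := Homeo
  (increasing_bij_homeo (@cellwiseK p V u) (@cellwiseVK p V u) (@cellwise_lt p V u)).

Lemma cellwiseE k V u x : k%:~R - 1 <= 2 * x <= k%:~R + 1 ->
  cellwise (oddz k) V u x = if k \in V then local (e k) k u x else x.
Proof.
move=> /andP[k1]; rewrite le_eqVlt => /orP[/eqP xk|k2]; last first.
  by rewrite /= /cellwise_fun cell_index_uniq// k1.
have -> : oddz k = oddz (k + 2) by rewrite /oddz; lia.
rewrite /= /cellwise_fun cell_index_uniq; last first.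
  by rewrite rmorphD/= xk; apply/andP; split; lra.
rewrite !local_out ?if_same// xk ?ltxx ?andbF// rmorphD/=.
by apply/negP => /andP[? ?]; lra.
Qed.

Lemma cellwiseM p V u v : cellwise p V (u * v)%g = (cellwise p V u * cellwise p V v)%g.
Proof. by apply: homeo_inj => x; rewrite homeo_mulE /= cellwise_comp. Qed.

Lemma cellwiseV p V u : cellwise p V u^-1%g = (cellwise p V u)^-1%g.
Proof. exact: homeo_inj. Qed.

Lemma cellwise1 p V : cellwise p V 1%g = 1%g.
Proof. by apply: homeo_inj => x; rewrite /= cellwise_one. Qed.

Lemma cellwise_fullJ p V u v :
  (cellwise p setT v * cellwise p V u * (cellwise p setT v)^-1)%g =
  cellwise p V (v * u * v^-1)%g.
Proof.
apply: homeo_inj => x; rewrite -cellwiseV !homeo_mulE /=.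
have k1 := cell_index_cellwise p setT v^-1%g x.
have k2 := cell_index_cellwise p V u (cellwise_fun p setT v^-1%g x).
move: k2; rewrite k1; move: k1; rewrite /cellwise_fun /= !in_setT => -> ->.
case: ifP => kV; rewrite ?kV; first by rewrite !local_comp.
by rewrite local_comp /local /= homeo_invVK chartVK.
Qed.

Lemma cellwise_move p V u x : `|2 * cellwise p V u x - 2 * x| <= 2.
Proof.
have := cellwise_in p V u x; have := cell_indexP p x => /andP[? ?] /andP[? ?].
by rewrite ler_norml; apply/andP; split; rewrite /=; lra.
Qed.

End Phi.

End Cells.

(** * Compressing intervals *)

Section Compression.
Variables (R : realType) (I : set R) (L : set (homeo I)) (A B : R).
Hypotheses (LG : is_subgroup L)
  (L_lt : forall f, L f -> {homo f : x y / x < y})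
  (L_in : forall f x, L f -> A < x < B -> A < f x < B)
  (L_micro : forall x c d, A <= c -> c < x < d -> d <= B -> exists f,
     [/\ L f, f x != x & forall y, A < y < B -> ~~ (c < y < d) -> f y = y]).

(** The infimum of the orbit of [x] under the elements fixing []A, c]] is [c]: a larger infimum
    would be moved down by some [g] supported beyond [c], and [g] would carry nearby orbit points
    below it. *)
Lemma push_down c x y : A <= c -> c < x < B -> c < y ->
  exists f, [/\ L f, f x < y & forall z, A < z <= c -> f z = z].
Proof.
move=> Ac /andP[cx xB] cy; have [L1 LM LV] := LG.
pose S := [set f x | f in [set f | L f /\ forall z, A < z <= c -> f z = z]].
have Sx : S x by exists 1%g.
have lbS : lbound S c.
  move=> _ [f [Lf fc] <-].
  have [Ac0|Ac'] := eqVneq A c.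
    by have := @L_in f x Lf ltac:(lra); lra.
  have Ac2 : A < c by rewrite lt_neqAle Ac' Ac.
  by rewrite -(fc c) ?Ac2 ?lexx// ltW// L_lt.
have hS : has_inf S by split; [exists x|exists c].
have cs : c <= inf S by apply: lb_le_inf => //; exists x.
have sx : inf S <= x by apply: ge_inf => //; exists c.
have [sy|ys] := ltP (inf S) y.
  have [_ [f [Lf fc] <-] fy] := inf_lt hS.1 sy.
  by exists f.
have [|g [Lg gs gid]] := L_micro Ac (_ : c < inf S < B) (lexx B); first lra.
have gc z : A < z <= c -> g z = z by move=> zc; apply: gid; [lra|apply/negP; lra].
wlog gs' : g Lg gs gid gc / g (inf S) < inf S => [wl|].
  have [gs'|sg|gs'] := ltgtP (g (inf S)) (inf S); first exact: (wl g).
    apply: (wl g^-1%g); first exact: LV.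
    - by apply: contra gs => /eqP sE; rewrite -{1}sE homeo_invVK.
    - by move=> z zAB zc; rewrite -{1}(gid z zAB zc) homeo_invK.
    - by move=> z zc; rewrite -{1}(gc z zc) homeo_invK.
    - by rewrite ltNge le_eqVlt; apply/negP => /orP[/eqP sE|/(L_lt Lg)];
        [move: sg; rewrite {2}sE homeo_invVK ltxx|rewrite homeo_invVK; lra].
  by rewrite gs' eqxx in gs.
have sg : inf S < (g^-1)%g (inf S).
  rewrite ltNge le_eqVlt; apply/negP => /orP[/eqP sE|/(L_lt Lg)].
    by move: gs'; rewrite -{1}sE homeo_invVK ltxx.
  by rewrite homeo_invVK; lra.
have [_ [f [Lf fc] <-] fg] := inf_lt hS.1 sg.
have : inf S <= (g * f)%g x.
  apply: ge_inf; first by exists c.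
  exists (g * f)%g => //; split; first exact: LM.
  by move=> z zc; rewrite homeo_mulE fc// gc.
by have := L_lt Lg fg; rewrite homeo_mulE homeo_invVK; lra.
Qed.

Lemma push_up x y : A < x < B -> A < y < B -> exists f, L f /\ y < f x.
Proof.
move=> xAB /andP[Ay yB]; have [_ _ LV] := LG.
have [||f [Lf fyx _]] := @push_down A y x (lexx A); first by rewrite Ay.
  by case/andP: xAB.
exists f^-1%g; split; first exact: LV.
rewrite ltNge le_eqVlt; apply/negP => /orP[/eqP fE|/(L_lt Lf)].
  by move: fyx; rewrite -fE homeo_invVK ltxx.
by rewrite homeo_invVK; lra.
Qed.

(** Push [a] above the middle of []p, q[], then pull the image of [b] below [q] by an element fixing
    everything up to that middle. *)
Lemma compress a b p q : A < a -> a <= b -> b < B -> A <= p -> p < q -> q <= B ->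
  exists f, [/\ L f, p < f a & f b < q].
Proof.
move=> Aa ab bB Ap pq qB; have [_ LM _] := LG.
have [||f [Lf fa]] := @push_up a ((p + q) / 2); [lra|lra|].
have fb : f a <= f b.
  by move: ab; rewrite le_eqVlt => /orP[/eqP ->|/(L_lt Lf)/ltW].
have /andP[_ fbB] := @L_in f b Lf ltac:(lra).
have [|||g [Lg gfb gid]] := @push_down ((p + q) / 2) (f b) q; [lra|lra|lra|].
exists (g * f)%g; split; [exact: LM| |by rewrite homeo_mulE].
rewrite homeo_mulE; apply: (@lt_trans _ _ ((p + q) / 2)); first by lra.
rewrite -{1}(gid ((p + q) / 2)); last by lra.
exact: L_lt.
Qed.

End Compression.

(** * Elements of Thompson's group *)

Section Dyadic.
Variable R : realType.
Implicit Types x y : R.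

Lemma dyadicD x y : dyadic x -> dyadic y -> dyadic (x + y).
Proof.
move=> [k [n ->]] [k' [n' ->]].
exists (k * 2 ^+ n' + k' * 2 ^+ n), (n + n')%N.
rewrite rmorphD !rmorphM !rmorphXn/= exprD; field.
by rewrite !expf_neq0.
Qed.

Lemma dyadicN x : dyadic x -> dyadic (- x).
Proof. by move=> [k [n ->]]; exists (- k), n; rewrite rmorphN mulNr. Qed.

Lemma dyadic_half x : dyadic x -> dyadic (x / 2).
Proof.
move=> [k [n ->]]; exists k, n.+1; rewrite exprS; field.
by rewrite expf_neq0.
Qed.

Lemma dyadic_int (k : int) : dyadic (k%:~R : R).
Proof. by exists k, 0%N; rewrite expr0 divr1. Qed.

Lemma dyadic_dense x y : x < y -> exists2 z, dyadic z & x < z < y.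
Proof.
move=> xy; have xy0 : 0 <= (y - x)^-1 by rewrite invr_ge0 subr_ge0 ltW.
have := archi_boundP xy0; set n := Num.bound _ => xyn.
have p0 : 0 < 2 ^+ n :> R by rewrite exprn_gt0.
have yxn : 1 < (y - x) * 2 ^+ n.
  rewrite -ltr_pdivrMl ?subr_gt0// mulr1; apply: lt_trans xyn _.
  by rewrite -natrX ltr_nat ltn_expl.
exists ((Num.floor (x * 2 ^+ n) + 1)%:~R / 2 ^+ n); first by eexists; exists n.
have := floor_itv (x * 2 ^+ n); rewrite rmorphD/= ltr_pdivlMr// ltr_pdivrMr// => /andP[? ?].
by apply/andP; split=> //; lra.
Qed.

End Dyadic.

Section LinearPieces.
Variable R : realType.
Implicit Types (f : R -> R) (x m c d : R).

(** One side suffices and is all there is when [x] is the right end of a listed piece at which [f]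
    happens to be derivable. *)
Lemma derive_linear_left f m c x d : 0 < d -> derivable f x 1 ->
  (forall y, x - d <= y <= x -> f y = m * y + c) -> 'D_1 f x = m.
Proof.
move=> d0 df fE.
have dleft : (0 : R)^'- `=>` (0 : R)^'.
  move=> S; rewrite /dnbhs /at_left /within /=.
  by apply: filterS => y Sy y0; apply: Sy; rewrite lt_eqF.
have : h^-1 *: (f (h *: 1 + x) - f x) @[h --> (0 : R)^'-] --> 'D_1 f x.
  by apply: cvg_trans df; apply: cvg_app.
have : h^-1 *: (f (h *: 1 + x) - f x) @[h --> (0 : R)^'-] --> m.
  apply: cvg_near_cst; near=> h.
  have h0 : h < 0 by near: h; exact: nbhs_left_lt.
  have hd : - d < h by near: h; apply: nbhs_left_gt; rewrite oppr_lt0.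
  rewrite [h *: 1]mulr1 (fE (h + x)); last by lra.
  rewrite (fE x); last by lra.
  by rewrite /GRing.scale/=; field; rewrite lt_eqF.
by move=> hm hD; exact: cvg_unique hD hm.
Unshelve. all: by end_near. Qed.

Lemma derivable_linear_near f m c x d : 0 < d ->
  (forall y, x - d <= y <= x + d -> f y = m * y + c) -> derivable f x 1.
Proof.
move=> d0 fE; apply: (@cvgP _ _ m); apply: cvg_near_cst; near=> h.
have h0 : h != 0 by near: h; exact: nbhs_dnbhs_neq.
have : `|h| < d.
  near: h; apply: nbhs_dnbhs; apply: filterS (nbhsx_ballx (0 : R) d d0) => h.
  by rewrite /ball /= sub0r normrN.
rewrite ltr_norml => /andP[? ?].
rewrite /= [h *: 1]mulr1 (fE (h + x)); last by lra.
rewrite (fE x); last by lra.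
by rewrite /GRing.scale/=; field.
Unshelve. all: by end_near. Qed.

Lemma path_le_last (s : seq R) x0 : path <%R x0 s -> x0 <= last x0 s.
Proof.
elim: s x0 => [//|y s IHs] x0 /= /andP[x0y /IHs]; exact/le_trans/ltW.
Qed.

Lemma path_piece (s : seq R) (x0 x : R) : path <%R x0 s -> x0 < x -> x <= last x0 s ->
  exists2 i, (i < size s)%N & (x0 :: s)`_i < x <= s`_i.
Proof.
elim: s x0 => [|y s IHs] x0 /=; first by move=> _ ? ?; lra.
move=> /andP[x0y ys] x0x xs; have [xy|yx] := leP x y.
  by exists 0%N => //=; rewrite x0x.
by have [i si xi] := IHs _ ys yx xs; exists i.+1.
Qed.

End LinearPieces.

Section GroupH.
Variable R : realType.
Local Notation unit_itv := (`[0, 1]%classic : set R).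
Implicit Types (u v w f : homeo unit_itv).

Lemma thompsonF_pieces f (s : seq R) : path <%R 0 s -> last 0 s = 1 ->
  (forall i, (i < size s)%N -> dyadic s`_i /\ exists (k : int) (c : R),
     forall x, (0 :: s)`_i <= x <= s`_i -> f x = 2 ^ k * x + c) ->
  thompsonF f.
Proof.
move=> ps ls sP; split.
- exists s; split=> // i si; have [_ [k [c fE]]] := sP i si.
  by exists (2 ^ k), c => x; rewrite in_itv /=; exact: fE.
- move=> x [/= ]; rewrite in_itv /= => /andP[x0 x1] ndf.
  have [|i si /andP[ix xi]] := path_piece ps x0; first by rewrite ls ltW.
  have [dys [k [c fE]]] := sP i si.
  move: xi; rewrite le_eqVlt => /orP[/eqP ->//|xi]; exfalso; apply: ndf.
  pose d := Num.min (x - (0 :: s)`_i) (s`_i - x).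
  have d1 : d <= x - (0 :: s)`_i by rewrite ge_min lexx.
  have d2 : d <= s`_i - x by rewrite ge_min lexx orbT.
  apply: (@derivable_linear_near _ f (2 ^ k) c x d); last by move=> y ?; apply: fE; lra.
  by rewrite lt_min !subr_gt0 ix.
- move=> x; rewrite in_itv /= => /andP[x0 x1] df.
  have [|i si /andP[ix xi]] := path_piece ps x0; first by rewrite ls ltW.
  have [dys [k [c fE]]] := sP i si; exists k.
  apply: (@derive_linear_left _ f (2 ^ k) c x (x - (0 :: s)`_i)) => //.
    by rewrite subr_gt0.
  by move=> y ?; apply: fE; lra.
Qed.

Definition germ0 f (m : R) := exists2 d : R, 0 < d & forall x, 0 <= x <= d -> f x = m * x.

Lemma thompsonF_germ0 f : thompsonF f -> exists k : int, germ0 f (2 ^ k).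
Proof.
move=> [[s [ps ls sP]] _ dP].
case: s ps ls sP => [|a s] /=; first by move=> _ ? _; lra.
move=> /andP[a0 ps] ls sP; have [m [c fE]] := sP 0%N isT.
have {}fE x : 0 <= x <= a -> f x = m * x + c by move=> xa; apply: fE; rewrite in_itv.
have c0 : c = 0 by have := fE 0; rewrite homeo0 mulr0 add0r lexx ltW// => <-.
have a1 : a <= 1.
  by rewrite -ls; exact: path_le_last.
have df : derivable f (a / 2) 1.
  by apply: (@derivable_linear_near _ f m c _ (a / 2)); [lra|move=> y ?; apply: fE; lra].
have [|k kE] := dP (a / 2) _ df; first by rewrite in_itv /=; lra.
exists k; exists a => // x xa; rewrite fE// c0 addr0 -kE.
by rewrite (@derive_linear_left _ f m c _ (a / 2))//; [lra|move=> y ?; apply: fE; lra].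
Qed.

End GroupH.
Ltac split_ifs := repeat match goal with
  | |- context [if (?a <= ?b) then _ else _] => case: (leP a b) => ?
  end.

(** * Explicit piecewise linear elements *)

Section Bumps.
Variable R : realType.
Local Notation unit_itv := (`[0, 1]%classic : set R).
Implicit Types (u v w f g : homeo unit_itv) (c d x y : R).

(** The inverse of the standard generator [x_0] of [F], rescaled from [[0, 1]] to [[c, d]]: slopes
    2, 1 and 1/2. *)
Definition bump c d x : R :=
  if x <= c then x else
  if x <= c + (d - c) / 4 then 2 * x - c else
  if x <= c + (d - c) / 2 then x + (d - c) / 4 else
  if x <= d then (x + d) / 2 else x.

Definition bumpV c d x : R :=
  if x <= c then x else
  if x <= c + (d - c) / 2 then (x + c) / 2 else
  if x <= d - (d - c) / 4 then x - (d - c) / 4 else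
  if x <= d then 2 * x - d else x.

Lemma bumpK c d : c < d -> cancel (bump c d) (bumpV c d).
Proof. by move=> cd x; rewrite /bump; split_ifs; rewrite /bumpV; split_ifs; lra. Qed.

Lemma bumpVK c d : c < d -> cancel (bumpV c d) (bump c d).
Proof. by move=> cd x; rewrite /bumpV; split_ifs; rewrite /bump; split_ifs; lra. Qed.

Lemma bump_lt c d : c < d -> {homo bump c d : x y / x < y}.
Proof. by move=> cd x y xy; rewrite /bump; split_ifs; lra. Qed.

Lemma bump_out c d x : c < d -> ~~ (c < x < d) -> bump c d x = x.
Proof. by move=> cd; rewrite negb_and -!leNgt => /orP[] ?; rewrite /bump; split_ifs; lra. Qed.

Lemma bump_gt c d x : c < x < d -> x < bump c d x < d.
Proof. by move=> /andP[? ?]; rewrite /bump; split_ifs; apply/andP; split; lra. Qed.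

Lemma bump_homeo_exists c d : 0 <= c -> c < d -> d <= 1 ->
  exists u, u =1 bump c d.
Proof.
move=> c0 cd d1; suff uP : is_homeo_pair unit_itv (bump c d) (bumpV c d).
  by exists (Homeo uP).
apply: unit_homeo_pair; [exact: bumpK|exact: bumpVK|exact: bump_lt|].
move=> x nx; apply: bump_out => //; apply: contra nx => /andP[? ?]; apply/andP; split; lra.
Qed.

Lemma thompson_bump u c d : dyadic c -> dyadic d -> 0 < c -> c < d -> d < 1 ->
  u =1 bump c d -> thompsonF u.
Proof.
move=> dyc dyd c0 cd d1 uE.
have dyh : dyadic ((d - c) / 2) by apply/dyadic_half/dyadicD => //; exact: dyadicN.
have dyq : dyadic ((d - c) / 4).
  by rewrite (_ : _ / 4 = (d - c) / 2 / 2); [exact: dyadic_half|field].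
apply: (@thompsonF_pieces _ u [:: c; c + (d - c) / 4; c + (d - c) / 2; d; 1]) => //.
  by rewrite /= c0 d1 !andbT; apply/and3P; split; lra.
case=> [|[|[|[|[|//]]]]] _; (split; first by [|exact: dyadicD|exact: (@dyadic_int _ 1)]).
- by exists 0, 0 => x /=; rewrite expr0z uE /bump => ?; split_ifs; lra.
- by exists 1, (- c) => x /=; rewrite expr1z uE /bump => ?; split_ifs; lra.
- by exists 0, ((d - c) / 4) => x /=; rewrite expr0z uE /bump => ?; split_ifs; lra.
- by exists (- 1), (d / 2) => x /=; rewrite exprN1 uE /bump => ?; split_ifs; lra.
- by exists 0, 0 => x /=; rewrite expr0z uE /bump => ?; split_ifs; lra.
Qed.

Lemma near_id_slope0 u m : 0 < m -> (forall x, 0 <= x <= m -> u x = x) -> slope_at0 u 1.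
Proof.
move=> m0 uE; apply: cvg_near_cst; near=> x.
have x0 : 0 < x by near: x; exact: nbhs_right_gt.
have xm : x < m by near: x; exact: nbhs_right_lt.
by rewrite homeo0 uE ?ltW// subr0 divff// gt_eqF.
Unshelve. all: by end_near. Qed.

Lemma near_id_slope1 u m : 0 < m -> (forall x, 1 - m <= x <= 1 -> u x = x) -> slope_at1 u 1.
Proof.
move=> m0 uE; apply: cvg_near_cst; near=> x.
have x0 : x < 1 by near: x; exact: nbhs_left_lt.
have xm : 1 - m < x by near: x; apply: nbhs_left_gt; rewrite ltrBlDr ltrDl.
by rewrite homeo1 uE ?ltW// divff// subr_eq0 lt_eqF.
Unshelve. all: by end_near. Qed.

Definition groupK : set (homeo unit_itv) := [set u | groupH u /\
  exists2 m, 0 < m & forall x, ~~ (m < x < 1 - m) -> u x = x].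

Lemma groupK_bump c d : dyadic c -> dyadic d -> 0 < c -> c < d -> d < 1 ->
  exists2 u, groupK u & u =1 bump c d.
Proof.
move=> dyc dyd c0 cd d1; have [|u uE] := @bump_homeo_exists c d (ltW c0) cd; first exact: ltW.
exists u => //; have m0 : 0 < Num.min c (1 - d) by rewrite lt_min c0 subr_gt0.
have m1 : Num.min c (1 - d) <= c by rewrite ge_min lexx.
have m2 : Num.min c (1 - d) <= 1 - d by rewrite ge_min lexx orbT.
have uid x : ~~ (Num.min c (1 - d) < x < 1 - Num.min c (1 - d)) -> u x = x.
  by move=> nx; rewrite uE bump_out//; apply: contra nx => /andP[? ?]; apply/andP; split; lra.
split; last by exists (Num.min c (1 - d)).
split; first exact: thompson_bump uE.
exists 1; split.
  by apply: near_id_slope0 m0 _ => x ?; apply: uid; apply/negP; lra.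
by apply: near_id_slope1 m0 _ => x ?; apply: uid; apply/negP; lra.
Qed.

(** In [H] slope 2 at 0 must come with slope 2 at 1, hence a bump on [[0, 1/4]] together with an
    inverse bump on [[3/4, 1]]. Its powers correct germs at 0 in [groupH_decomp]. *)
Lemma kappa_exists : exists f,
  [/\ groupH f, germ0 f 2 & forall x, 4^-1 <= x <= 3 / 4 -> f x = x].
Proof.
have [|||u uE] := @bump_homeo_exists 0 4^-1; [lra|lra|lra|].
have [|||v vE] := @bump_homeo_exists (3 / 4) 1; [lra|lra|lra|].
have vVE x : (v^-1)%g x = bumpV (3 / 4) 1 x.
  have b34 : 3 / 4 < 1 :> R by lra.
  by rewrite -{1}(bumpVK b34 x) -vE homeo_invK.
pose f := (u * v^-1)%g; exists f.
have fE x : f x = bump 0 4^-1 (bumpV (3 / 4) 1 x) by rewrite /f homeo_mulE uE vVE.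
have fl x : x <= 3 / 4 -> f x = bump 0 4^-1 x.
  by move=> x34; rewrite fE; congr bump; rewrite /bumpV x34.
have fr x : 3 / 4 <= x -> f x = bumpV (3 / 4) 1 x.
  by move=> x34; rewrite fE bump_out// /bumpV; split_ifs; apply/negP; lra.
clearbody f.
have dyq k : dyadic ((k%:~R : R) / 16).
  by exists k, 4%N; congr (_ / _); rewrite -natrX.
split.
- split.
    apply: (@thompsonF_pieces _ f [:: 1 / 16; 2 / 16; 4 / 16; 12 / 16; 14 / 16; 15 / 16; 1]) => //.
      by rewrite /= !andbT; do !(apply/andP; split); lra.
    case=> [|[|[|[|[|[|[|//]]]]]]] _; split; try exact: (dyq 1); try exact: (dyq 2);
      try exact: (dyq 4); try exact: (dyq 12); try exact: (dyq 14); try exact: (dyq 15);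
      try exact: (@dyadic_int _ 1).
    + by exists 1, 0 => x /= ?; rewrite expr1z fl /bump; split_ifs; lra.
    + by exists 0, (1 / 16) => x /= ?; rewrite expr0z fl /bump; split_ifs; lra.
    + by exists (- 1), (1 / 8) => x /= ?; rewrite exprN1 fl /bump; split_ifs; lra.
    + by exists 0, 0 => x /= ?; rewrite expr0z fl /bump; split_ifs; lra.
    + by exists (- 1), (3 / 8) => x /= ?; rewrite exprN1 fr /bumpV; split_ifs; lra.
    + by exists 0, (- 1 / 16) => x /= ?; rewrite expr0z fr /bumpV; split_ifs; lra.
    + by exists 1, (- 1) => x /= ?; rewrite expr1z fr /bumpV; split_ifs; lra.
  exists 2; split; apply: cvg_near_cst; near=> x.
    have x0 : 0 < x by near: x; exact: nbhs_right_gt.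
    have xm : x < 1 / 16 by near: x; apply: nbhs_right_lt; lra.
    have -> : f x = 2 * x by rewrite fl /bump; split_ifs; lra.
    by rewrite homeo0 !subr0 mulfK// gt_eqF.
  have x0 : x < 1 by near: x; exact: nbhs_left_lt.
  have xm : 15 / 16 < x by near: x; apply: nbhs_left_gt; lra.
  have -> : f x = 2 * x - 1 by rewrite fr /bumpV; split_ifs; lra.
  rewrite homeo1; have -> : 2 * x - 1 - 1 = 2 * (x - 1) by ring.
  by rewrite mulfK// subr_eq0 lt_eqF.
- exists (1 / 16); first by lra.
  by move=> x ?; rewrite fl /bump; split_ifs; lra.
- by move=> x ?; rewrite fl /bump; split_ifs; lra.
Unshelve. all: by end_near. Qed.

End Bumps.

Section CompactlySupported.
Variable R : realType.
Implicit Types (u v f g : homeo (`[0, 1]%classic : set R)) (c d x y : R).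

Lemma germ0_mul f g (a b : R) : 0 < b -> germ0 f a -> germ0 g b -> germ0 (f * g)%g (a * b).
Proof.
move=> b0 [m m0 fE] [m' m'0 gE]; exists (Num.min m' (m / b)).
  by rewrite lt_min m'0 divr_gt0.
move=> x /andP[x0]; rewrite le_min ler_pdivlMr// => /andP[xm' xm].
rewrite homeo_mulE gE ?x0// fE ?mulrA// mulr_ge0 ?(ltW b0)//=.
by rewrite (mulrC b).
Qed.

Lemma germ0_inv f (a : R) : 0 < a -> germ0 f a -> germ0 f^-1%g a^-1.
Proof.
move=> a0 [m m0 fE]; exists (a * m); first exact: mulr_gt0.
move=> x /andP[x0 xm].
have xa : 0 <= a^-1 * x <= m by rewrite mulr_ge0 ?invr_ge0 ?(ltW a0)//= ler_pdivrMl.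
by rewrite -{1}(mulVKf (lt0r_neq0 a0) x) -(fE _ xa) homeo_invK.
Qed.

Hypothesis HG : is_subgroup (@groupH R).

Definition fixes_interval f := exists a b : R,
  [/\ 0 <= a, a < b, b <= 1 & forall x, a < x < b -> f x = x].

(** A power [h] of the element of [kappa_exists] has the same germ at 0 as [f]; then [f * h^-1] is
    trivial near 0, and [h] is trivial on [[1/4, 3/4]]. *)
Lemma groupH_decomp f : groupH f -> exists g h,
  [/\ groupH g, groupH h, fixes_interval g, fixes_interval h & f = (g * h)%g].
Proof.
have [H1 HM HV] := HG => fH; have [k fk] := thompsonF_germ0 fH.1.
have [c [cH c2 cid]] := kappa_exists R.
have pow2_gt0 (j : int) : 0 < (2 : R) ^ j by rewrite exprz_gt0.
have [h [hH hk hid]] : exists h, [/\ groupH h, germ0 h (2 ^ k) &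
    forall x, 4^-1 <= x <= 3 / 4 -> h x = x].
  have cX (n : nat) : exists h, [/\ groupH h, germ0 h (2 ^+ n) &
      forall x, 4^-1 <= x <= 3 / 4 -> h x = x].
    elim: n => [|n [h [hH hn hid]]].
      by exists 1%g; split=> //; exists 1 => // x _; rewrite expr0 mul1r.
    exists (c * h)%g; split; [exact: HM|rewrite exprS; exact: germ0_mul|].
    by move=> x x4; rewrite homeo_mulE hid// cid.
  case: k {fk} => n; first exact: cX.
  have [h [hH hn hid]] := cX n.+1; exists h^-1%g; split; first exact: HV.
    by rewrite NegzE -exprnN; apply: germ0_inv => //; rewrite exprn_gt0.
  by move=> x x4; rewrite -{1}(hid _ x4) homeo_invK.
exists (f * h^-1)%g, h; split=> //; last by rewrite mulgVK.
- by apply: HM => //; exact: HV.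
- have [|m m0 mE] := germ0_mul _ fk (germ0_inv (pow2_gt0 k) hk).
    by rewrite invr_gt0.
  exists 0, (Num.min m 1); split; rewrite ?lexx ?ge_min ?lexx ?orbT//.
    by rewrite lt_min m0 ltr01.
  move=> x /andP[x0]; rewrite lt_min => /andP[xm _].
  by rewrite mE ?(ltW x0) ?ltW// divff ?mul1r// gt_eqF.
- by exists 4^-1, (3 / 4); split=> [| | |x ?]; [lra|lra|lra|apply: hid; lra].
Qed.

Lemma groupK_subgroup : is_subgroup (@groupK R).
Proof.
have [H1 HM HV] := HG; split.
- by split=> //; exists 1.
- move=> u v [uH [m m0 uE]] [vH [m' m'0 vE]]; split; first exact: HM.
  exists (Num.min m m'); first by rewrite lt_min m0.
  have h1 : Num.min m m' <= m by rewrite ge_min lexx.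
  have h2 : Num.min m m' <= m' by rewrite ge_min lexx orbT.
  move=> x nx; rewrite homeo_mulE vE ?uE//; apply: contra nx => /andP[? ?]; apply/andP; split; lra.
- move=> u [uH [m m0 uE]]; split; first exact: HV.
  by exists m => // x nx; rewrite -{1}(uE x nx) homeo_invK.
Qed.

Lemma groupK_micro x c d : 0 <= c -> c < x < d -> d <= 1 -> exists u,
  [/\ groupK u, x < u x < d & forall y, ~~ (c < y < d) -> u y = y].
Proof.
move=> c0 /andP[cx xd] d1.
have [c' dyc' /andP[cc' c'x]] := dyadic_dense cx.
have [d' dyd' /andP[xd' d'd]] := dyadic_dense xd.
have [|||u uK uE] := groupK_bump dyc' dyd'; [lra|lra|lra|].
exists u; split=> //.
  rewrite uE; have := @bump_gt R c' d' x; rewrite c'x xd' => /(_ isT) /andP[? ?].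
  by apply/andP; split; lra.
move=> y ny; rewrite uE bump_out//; first lra.
by apply: contra ny => /andP[? ?]; apply/andP; split; lra.
Qed.

Lemma groupK_compress a b p q : 0 < a -> a <= b -> b < 1 -> 0 <= p -> p < q -> q <= 1 ->
  exists u, [/\ groupK u, p < u a & u b < q].
Proof.
apply: compress; first exact: groupK_subgroup.
- by move=> f _; exact: unit_lt.
- by move=> f x _; exact: unit_in.
- move=> x c d c0 cxd d1; have [u [uK xu uid]] := groupK_micro c0 cxd d1.
  by exists u; split=> // [|y _]; [rewrite gt_eqF//; lra|exact: uid].
Qed.

(** [v] is supported in []x, d[]: it fixes [x] and moves [u x], so the commutator moves [x]. *)
Lemma groupK_commutator_micro x c d : 0 <= c -> c < x < d -> d <= 1 -> exists u v,
  [/\ groupK u, groupK v, [~ u, v]%g x != x & forall y, ~~ (c < y < d) -> [~ u, v]%g y = y].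
Proof.
move=> c0 cxd d1; have [u [uK xu uid]] := groupK_micro c0 cxd d1.
have [|||v [vK uv vid]] := @groupK_micro (u x) x d; [lra|lra|lra|].
exists u, v; split=> //.
  have -> : [~ u, v]%g x = (u^-1)%g ((v^-1)%g (u (v x))) by [].
  rewrite vid ?ltxx//; apply/eqP => /(congr1 u); rewrite homeo_invVK.
  by move=> /(congr1 v); rewrite homeo_invVK => uvE; move: uv; rewrite -uvE ltxx.
move=> y ny; have -> : [~ u, v]%g y = (u^-1)%g ((v^-1)%g (u (v y))) by [].
have vy : v y = y by apply: vid; apply: contra ny => /andP[? ?]; apply/andP; split; lra.
have uy : u y = y by exact: uid.
by rewrite vy uy -{1}vy homeo_invK -{1}uy homeo_invK.
Qed.

End CompactlySupported.

(** * Localization *)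

Lemma disjoint_commute (R : realType) (I : set R) (f g : homeo I) (S : set R) :
  (forall x, ~ S x -> f x = x) -> (forall x, S x -> g x = x) -> commute f g.
Proof.
move=> fS gS; apply: homeo_inj => x; rewrite !homeo_mulE.
have [Sx|nSx] := pselect (S x).
  rewrite (gS x Sx); have [/gS->//|/fS ffx] := pselect (S (f x)).
  by have := congr1 (f^-1)%g ffx; rewrite !homeo_invK => ->; rewrite gS.
rewrite (fS x nSx); have [/gS ggx|/fS->//] := pselect (S (g x)).
by have := congr1 (g^-1)%g ggx; rewrite !homeo_invK => ->; rewrite fS.
Qed.

Lemma commg_commuteMl (E : groupType) (x a y : E) : commute a y ->
  [~ x, y]%g = [~ a^-1 * x, y]%g.
Proof.
move=> ay; rewrite !commgEl !conjgE invgM invgK -!mulgA; congr (_ * _)%g.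
by rewrite !mulgA (commuteV ay) -!mulgA mulVKg.
Qed.

Section Localization.
Variable R : realType.
Local Notation unit_itv := (`[0, 1]%classic : set R).
Local Notation T := (homeo [set: R]).
Variables (e : int -> bool) (G : set T).
Hypotheses (HG : is_subgroup (@groupH R)) (GG : is_subgroup G)
  (G_full : forall p u, groupH u -> G (cellwise e p setT u)).
Implicit Types (u v w : homeo unit_itv) (x : R) (V W : set int).

Let GM f g : G f -> G g -> G (f * g)%g. Proof. by have [_ + _] := GG; exact. Qed.
Let GV f : G f -> G f^-1%g. Proof. by have [_ _] := GG; exact. Qed.

Lemma cellwise_ext p V W u : (forall k, oddz k = p -> (V k <-> W k)) ->
  cellwise e p V u = cellwise e p W u.
Proof.
move=> VW; apply: homeo_inj => x; rewrite /= /cellwise_fun.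
suff -> : (cell_index p x \in V) = (cell_index p x \in W) by [].
by apply/idP/idP; rewrite !inE => /VW; apply; exact: oddz_cell_index.
Qed.

(** Commutators intersect the sets of active cells; this is how supports get localized. *)
Lemma cellwise_comm p V W u v :
  [~ cellwise e p V u, cellwise e p W v]%g = cellwise e p (V `&` W) [~ u, v]%g.
Proof.
apply: homeo_inj => x; pose k := cell_index p x.
have cellP V' w y : cell_index p y = k -> cellwise e p V' w y =
    (if k \in V' then local (e k) k w y else y) /\ cell_index p (cellwise e p V' w y) = k.
  by move=> <-; split=> //; rewrite [LHS]cell_index_cellwise.
have -> : [~ cellwise e p V u, cellwise e p W v]%g x = cellwise e p V u^-1%g
    (cellwise e p W v^-1%g (cellwise e p V u (cellwise e p W v x))) by [].
have [E1 k1] := cellP W v x erefl.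
have [E2 k2] := cellP V u _ k1.
have [E3 k3] := cellP W v^-1%g _ k2.
have [E4 _] := cellP V u^-1%g _ k3.
have [E5 _] := cellP (V `&` W) [~ u, v]%g x erefl.
rewrite E4 E3 E2 E1 E5 in_setI.
have locK w y : local (e k) k (w^-1)%g (local (e k) k w y) = y.
  by rewrite /local chartK homeo_invK chartVK.
by case: (k \in V); case: (k \in W) => //=; rewrite ?locK// !local_comp.
Qed.

Lemma cellwise_normal p V u h : groupH h -> G (cellwise e p V u) ->
  G (cellwise e p V (u ^ h)%g).
Proof.
have [_ _ HV] := HG => hH Gu; rewrite conjgE mulgA -{2}[h]invgK -cellwise_fullJ.
by apply: GM; [apply: GM => //|apply: GV]; apply: G_full; exact: HV.
Qed.

(** Commutators of compactly supported elements are what Higman's argument yields, and by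
    [groupK_commutator_micro] they still move points inside arbitrarily small intervals. *)
Definition good p V := forall u v, groupK u -> groupK v ->
  G (cellwise e p V [~ u, v]%g).

(* Higman's argument: if [w] displaces an open set [J], then
   [[[p, w], q] = [p, q]] whenever [p] and [q] are supported in [J]. *)
Lemma moved_good p V w x : G (cellwise e p V w) -> w x != x -> good p V.
Proof.
move=> Gw wx u v uK vK.
have [J0 [J1 [J00 J01 J11 wJ]]] : exists a b : R, [/\ 0 <= a, a < b, b <= 1 &
    forall y, a < y < b -> ~~ (a < w y < b)].
  have x01 : 0 < x < 1 by apply: contraT => /unit_out wx'; rewrite wx' eqxx in wx.
  have := unit_in w x01; have [xw|wx'|/eqP] := ltgtP x (w x); last by rewrite eq_sym (negbTE wx).
    exists x, (w x); split=> //; [lra|lra|] => y /andP[/(unit_lt w) ? _].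
    by apply/negP; lra.
  exists (w x), x; split=> //; [lra|lra|] => y /andP[_ /(unit_lt w) ?].
  by apply/negP; lra.
have [KG1 KM KV] := groupK_subgroup HG; have K_H (f : homeo unit_itv) : groupK f -> groupH f by case.
have [m m0 mJ] : exists2 m, 0 < m & forall y, ~~ (m < y < 1 - m) -> u y = y /\ v y = y.
  have [_ [m m0 uE]] := uK; have [_ [m' m'0 vE]] := vK.
  exists (Num.min m m'); first by rewrite lt_min m0.
  have h1 : Num.min m m' <= m by rewrite ge_min lexx.
  have h2 : Num.min m m' <= m' by rewrite ge_min lexx orbT.
  by move=> y ny; rewrite uE ?vE//;
    apply: contra ny => /andP[? ?]; apply/andP; split; lra.
(* [k] carries the supports of [u] and [v] into []J0, J1[]; the [2^-1] keeps its two arguments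
   ordered when [m] is large. *)
have [k [kK Jk0 Jk1]] : exists k, [/\ groupK k, J0 < k (Num.min m 2^-1) &
    k (Num.max (1 - m) 2^-1) < J1].
  apply: groupK_compress => //.
  - by rewrite lt_min m0; lra.
  - by rewrite le_max [X in _ || X]ge_min lexx !orbT.
  - by rewrite gt_max; apply/andP; split; lra.
have conj_supp (f : homeo unit_itv) : (forall y, ~~ (m < y < 1 - m) -> f y = y) ->
    forall y, ~~ (J0 < y < J1) -> (f ^ k^-1)%g y = y.
  move=> fE y ny; have -> : (f ^ k^-1)%g y = k (f ((k^-1)%g y)).
    by rewrite conjgE invgK.
  rewrite fE ?homeo_invVK//; apply: contra ny => /andP[ym y1m].
  apply/andP; split.
    apply: lt_trans Jk0 _; rewrite -(homeo_invVK k y); apply: unit_lt.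
    by rewrite gt_min ym.
  apply: lt_trans _ Jk1; rewrite -(homeo_invVK k y); apply: unit_lt.
  by rewrite lt_max y1m.
have uJ := conj_supp u (fun y ny => (mJ y ny).1).
have vJ := conj_supp v (fun y ny => (mJ y ny).2).
have K'H : groupH k^-1%g by apply: K_H; exact: KV.
suff : G (cellwise e p V [~ u ^ k^-1, v ^ k^-1]%g).
  by move=> /(cellwise_normal (K_H _ kK)); rewrite -conjRg conjgKV.
have KJ (f : homeo unit_itv) : groupK f -> groupH (f ^ k^-1)%g.
  by move=> fK; apply: K_H; rewrite conjgE invgK; apply: (KM) => //; apply: KM => //; exact: KV.
move: (KJ _ uK) (KJ _ vK) uJ vJ => uH vH uJ vJ.
move: uH vH uJ vJ {uK vK mJ}.
move: (u ^ _)%g (v ^ _)%g => {}u {}v uH vH uJ vJ.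
(* [s] is trivial on []J0, J1[], so it commutes with [v] and may be divided out of [u]; and
   [s^-1 * u = w^-1 * w ^ u] localizes to [G] because [w] does. *)
pose s := (u ^ w)%g.
have sJ y : J0 < y < J1 -> s y = y.
  move=> yJ; have -> : s y = (w^-1)%g (u (w y)) by [].
  by rewrite uJ ?homeo_invK//; exact: wJ.
have sv : commute s v.
  apply/commute_sym/(@disjoint_commute _ _ v s [set y | J0 < y < J1]) => y.
    by move=> /negP; exact: vJ.
  exact: sJ.
pose t := (s^-1 * u)%g.
have Gt : G (cellwise e p V t).
  have -> : t = (w^-1 * w ^ u)%g by rewrite /t /s !conjgE !invgM invgK !mulgA.
  by rewrite cellwiseM cellwiseV; apply: GM; [exact: GV|exact: cellwise_normal].
rewrite (commg_commuteMl u sv).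
rewrite commgEl cellwiseM cellwiseV; apply: GM; first exact: GV.
exact: cellwise_normal.
Qed.

(* Lower endpoint, in the chart of the cell of [j], of the half-interval between
   [j] and [j + 1] (for [d] true) or [j - 1] (for [d] false). *)
Definition half_lo (b d : bool) : R := if b == d then 0 else 2^-1.

(** Reversing a cell exchanges its halves; this detects neighbours of the wrong relative
    orientation. *)
Lemma half_lo_flip b d (t : R) : half_lo b d < t < half_lo b d + 2^-1 ->
  ~~ (half_lo b d < 1 - t < half_lo b d + 2^-1).
Proof.
by rewrite /half_lo; case: ifP => _ /andP[? ?]; apply/negP => /andP[? ?]; lra.
Qed.

Definition neighbour (d : bool) (j : int) : int := if d then j + 1 else j - 1.

Definition half_left (d : bool) (j : int) : R := (if d then j else j - 1)%:~R / 2.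

Lemma half_loP d j x :
  (half_left d j < x < half_left d j + 2^-1) =
  (half_lo (e j) d < chartV (e j) j x < half_lo (e j) d + 2^-1).
Proof.
rewrite /half_left /half_lo /chartV; case: d; case: (e j) => /=; rewrite ?rmorphB /=;
  by apply/idP/idP => /andP[? ?]; apply/andP; split; lra.
Qed.

Lemma half_loP_neighbour d j x :
  (half_left d j < x < half_left d j + 2^-1) =
  (half_lo (e (neighbour d j)) (~~ d) < chartV (e (neighbour d j)) (neighbour d j) x
     < half_lo (e (neighbour d j)) (~~ d) + 2^-1).
Proof.
rewrite /half_left /half_lo /chartV /neighbour; case: d; case: (e _) => /=;
  rewrite ?rmorphB ?rmorphD /=;
  by apply/idP/idP => /andP[? ?]; apply/andP; split; lra.
Qed.

(** Reading a word one letter further: the same [b] must fit both cells, so that the pair is a copy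
    of [j] and [neighbour d j], possibly reflected as a whole. *)
Definition step j d W : set int := [set m | exists b q,
  [/\ m = aff b q j, e m = b (+) e j, W (aff b q (neighbour d j)) &
      e (aff b q (neighbour d j)) = b (+) e (neighbour d j)]].

Lemma aff_refl j m : oddz m = oddz j -> exists q, m = aff (e m (+) e j) q j.
Proof.
rewrite /oddz => jm; exists (if e m (+) e j then (m + j) %/ 2 else (m - j) %/ 2)%Z.
by rewrite /aff; case: (_ (+) _); lia.
Qed.

Lemma aff_injq b q q1 j : aff b q j = aff b q1 j -> q1 = q.
Proof. by rewrite /aff; case: b; lia. Qed.

Lemma oddz_aff b q j : oddz (aff b q j) = oddz j.
Proof. by rewrite /oddz /aff; case: b; lia. Qed.

Lemma aff_cell b q k x : k%:~R - 1 < 2 * x < k%:~R + 1 ->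
  (aff b q k)%:~R - 1 < 2 * affR b q x < (aff b q k)%:~R + 1.
Proof.
rewrite /aff /affR; case: b; rewrite ?(rmorphB, rmorphD, rmorphM)/= => /andP[? ?];
  by apply/andP; split; lra.
Qed.

Section Step.
Variables (j : int) (d : bool) (W : set int).
Let j' := neighbour d j.
Let lo := half_lo (e j) d.
Let lo' := half_lo (e j') (~~ d).

Let lo01 : 0 <= lo /\ lo + 2^-1 <= 1.
Proof. by rewrite /lo /half_lo; case: ifP; split; lra. Qed.

Let lo'01 : 0 <= lo' /\ lo' + 2^-1 <= 1.
Proof. by rewrite /lo' /half_lo; case: ifP; split; lra. Qed.

Let half_eq x : (lo < chartV (e j) j x < lo + 2^-1) =
  (lo' < chartV (e j') j' x < lo' + 2^-1).
Proof. by rewrite -half_loP -half_loP_neighbour. Qed.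

Definition transfer (v : R -> R) (t : R) : R :=
  chartV (e j) j (local (e j') j' v (chart (e j) j t)).

Lemma transfer_exists v : (forall t, ~~ (lo' < t < lo' + 2^-1) -> v t = t) ->
  exists v', v' =1 transfer v /\ forall t, ~~ (lo < t < lo + 2^-1) -> v' t = t.
Proof.
move=> vid.
have tid t : ~~ (lo < t < lo + 2^-1) -> transfer v t = t.
  rewrite -{1 2}(chartK (e j) j t) half_eq => /vid vt.
  by rewrite /transfer /local vt chartVK chartK.
suff vP : is_homeo_pair unit_itv (transfer v) (transfer v^-1%g).
  by exists (Homeo vP).
apply: unit_homeo_pair.
- by move=> t; rewrite /transfer chartVK /local chartK homeo_invK chartVK chartK.
- by move=> t; rewrite /transfer chartVK /local chartK homeo_invVK chartVK chartK.
- move=> s t st; rewrite /transfer /chartV /chart; case: (e j).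
    by rewrite ltrD2l ltrN2; apply: local_lt; rewrite ltrD2l ltrN2.
  by rewrite ltrD2r; apply: local_lt; rewrite ltrD2l.
- move=> t nt; apply: tid; apply: contra nt => /andP[? ?]; case: lo01 => ? ?.
  by apply/andP; split; lra.
Qed.

Definition half_cells : set R := [set x | let m := cell_index (oddz j) x in
  lo < chartV (e m) m x < lo + 2^-1].

(** Adjacent cells share a half. If the neighbour has the wrong relative orientation, then [v] acts
    on its other half and is trivial on the shared one, by [half_lo_flip]. *)
Lemma step_agree v v' x : (forall t, ~~ (lo' < t < lo' + 2^-1) -> v t = t) ->
  v' =1 transfer v -> half_cells x ->
  cellwise e (oddz j') W v x = cellwise e (oddz j) (step j d W) v' x.
Proof.
move=> vid v'E xD; have {xD} : let m := cell_index (oddz j) x in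
  lo < chartV (e m) m x < lo + 2^-1 by [].
have -> : cellwise e (oddz j) (step j d W) v' x =
  let m := cell_index (oddz j) x in
  if m \in step j d W then local (e m) m v' x else x by [].
have := aff_refl (oddz_cell_index (oddz j) x); move: (cell_index _ x) => m [q]; cbv zeta.
have : e m = (e m (+) e j) (+) e j by rewrite -addbA addbb addbF.
move: (e m (+) e j) => b em mE.
pose x0 := affR b (aff_inv b q) x; have xE : x = affR b q x0 by rewrite affRVK.
have -> : chartV (e m) m x = chartV (e j) j x0 by rewrite em mE xE chartV_aff.
rewrite half_eq => x0D.
have x0cell : j'%:~R - 1 < 2 * x0 < j'%:~R + 1.
  rewrite (chartV_in (e j')); move: x0D => /andP[? ?]; case: lo'01 => ? ?.
  by apply/andP; split; lra.
pose m' := aff b q j'.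
have /andP[xm'1 xm'2] : m'%:~R - 1 < 2 * x < m'%:~R + 1 by rewrite xE; exact: aff_cell.
rewrite -(oddz_aff b q j') (@cellwiseE _ _ m') -/m'; last by rewrite !ltW.
have -> : local (e m) m v' x = affR b q (local (e j') j' v x0).
  by rewrite em mE xE local_aff /local v'E /transfer !chartVK.
have stepE : (m \in step j d W) = (m' \in W) && (e m' == b (+) e j').
  apply/idP/idP; last first.
    by move=> /andP[/set_mem Wm' /eqP em']; apply/mem_set; exists b, q.
  move=> /set_mem[b1 [q1 [mE1 em1 Wm1 em'1]]].
  have bb1 : b1 = b by move: em1; rewrite em => /addIb.
  have qq1 : q1 = q by move: mE1; rewrite mE bb1 => /aff_injq.
  by move: Wm1 em'1; rewrite bb1 qq1 => Wm' em'; rewrite mem_set //= em' eqxx.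
rewrite stepE; have [em'|em'] := eqVneq (e m') (b (+) e j').
  rewrite andbT em'; congr (if _ then _ else _).
  by rewrite /m' [in LHS]xE local_aff.
rewrite andbF; case: ifP => // _.
have -> : e m' = ~~ (b (+) e j') by move: em'; case: (e m'); case: (_ (+) _).
rewrite /local; suff -> : v (chartV (~~ (b (+) e j')) m' x) = chartV (~~ (b (+) e j')) m' x.
  by rewrite chartVK.
apply: vid; have chN c k y : chartV (~~ c) k y = 1 - chartV c k y.
  by rewrite /chartV; case: c => /=; field.
by rewrite chN {1 2}xE chartV_aff; exact: half_lo_flip.
Qed.

(* The commutator of an element supported in half-cells of vertices of [V] with
   one supported in half-cells of vertices of [W] only lives on the half-cells
   shared by neighbours with the prescribed relative orientation. *)
Lemma good_step V : good (oddz j) V -> good (oddz j') W ->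
  good (oddz j) (V `&` step j d W).
Proof.
move=> goodV goodW; have [lo'0 lo'1] := lo'01; have [lo0 lo1] := lo01.
have [||| v1 [v2 [v1K v2K vy0 vid]]] :=
  @groupK_commutator_micro R (lo' + 4^-1) lo' (lo' + 2^-1); [lra|lra|lra|].
move: (goodW v1 v2 v1K v2K) vy0 vid; set v := [~ v1, v2]%g; set y0 := lo' + 4^-1.
move: v => v GWv vy0 vid.
have [v' [v'E v'id]] := transfer_exists vid.
pose y := chartV (e j) j (chart (e j') j' y0).
have yD : lo < y < lo + 2^-1.
  by rewrite /y half_eq chartK /y0; apply/andP; split; lra.
have v'y : v' y != y.
  rewrite v'E /transfer /y chartVK /local chartK.
  apply: contra vy0 => /eqP /(can_inj (chartVK _ _)) /(can_inj (chartK _ _)) ->.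
  exact: eqxx.
(* [u] will be chosen to move [y] and to fix [z]; as [v' z = y], it cannot commute with [v']. *)
pose z := (v'^-1)%g y.
have v'z : v' z = y by rewrite /z homeo_invVK.
have zy : z != y by apply: contra v'y => /eqP {1}<-; rewrite v'z.
have [a [b [aD bD yab zab]]] : exists a b, [/\ lo <= a, b <= lo + 2^-1, a < y < b &
    ~~ (a < z < b)].
  have [zy'|yz|zy'] := ltgtP z y; last by rewrite zy' eqxx in zy.
    by exists (Num.max lo z), (lo + 2^-1); split=> //;
      [rewrite le_max lexx|rewrite gt_max zy'; lra|rewrite gt_max ltxx andbF].
  exists lo, (Num.min z (lo + 2^-1)); split=> //.
  - by rewrite ge_min lexx orbT.
  - by rewrite lt_min yz; lra.
  - by rewrite lt_min ltxx andbF.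
have [u1 [u2 [u1K u2K uy uid]]] := groupK_commutator_micro
  (le_trans lo0 aD) yab (le_trans bD lo1).
move: (goodV u1 u2 u1K u2K) uy uid; move: [~ u1, u2]%g => u GVu uy uid.
have [x wx] : exists x, [~ u, v']%g x != x.
  apply: contrapT => /forallNP nx.
  have : [~ u, v']%g == 1%g.
    by apply/eqP/homeo_inj => x; have /negP/negPn/eqP := nx x.
  move=> /commgP /(congr1 (fun f : homeo unit_itv => f z)); rewrite !homeo_mulE v'z (uid z)//.
  by rewrite v'z => uyE; rewrite uyE eqxx in uy.
apply: moved_good wx.
(* [B] splits as [X * C] with [X] supported on the half-cells and [C] trivial there. Both [A] and
   [[~ A, X]] commute with [C], whence [[~ A, B] = [~ A, X]]. *)
pose A := cellwise e (oddz j) V u; pose B := cellwise e (oddz j') W v.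
pose Y := step j d W; pose X := cellwise e (oddz j) Y v'.
pose C := (X^-1 * B)%g.
have Chalf_cells x1 : half_cells x1 -> C x1 = x1.
  move=> Dx; rewrite /C homeo_mulE; suff -> : B x1 = X x1 by rewrite homeo_invK.
  exact: step_agree.
have offD V' w x1 : (forall t, ~~ (lo < t < lo + 2^-1) -> w t = t) -> ~ half_cells x1 ->
    cellwise e (oddz j) V' w x1 = x1.
  move=> wid /negP nD; rewrite /= /cellwise_fun; case: ifP => // _.
  by rewrite /local wid// chartVK.
have ulo t : ~~ (lo < t < lo + 2^-1) -> u t = t.
  by move=> nt; apply: uid; apply: contra nt => /andP[? ?]; apply/andP; split; lra.
have wlo t : ~~ (lo < t < lo + 2^-1) -> [~ u, v']%g t = t.
  move=> nt; have -> : [~ u, v']%g t = (u^-1)%g ((v'^-1)%g (u (v' t))) by [].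
  have [vt ut] := (v'id _ nt, ulo _ nt).
  by rewrite vt ut -{1}vt homeo_invK -{1}ut homeo_invK.
have AC : commute A C by apply: (disjoint_commute (S := half_cells)) => // x1; exact: offD.
have AXC : commute [~ A, X]%g C.
  by apply: (disjoint_commute (S := half_cells)) => // x1; rewrite cellwise_comm; exact: offD.
suff -> : cellwise e (oddz j) (V `&` Y) [~ u, v']%g = [~ A, B]%g.
  rewrite commgEl; apply: GM; first exact: GV.
  by rewrite conjgE; apply: GM; [exact: GV|exact: GM].
rewrite -cellwise_comm -/A -/X; have -> : B = (X * C)%g by rewrite /C mulVKg.
move: AC AXC; clearbody A X C => AC AXC.
have -> : [~ A, X * C]%g = ([~ A, X] ^ C)%g.
  have AC' : (A ^ C = A)%g by rewrite conjgE AC mulKg.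
  by rewrite !commgEl conjgM [in RHS]conjMg conjVg AC'.
by rewrite conjgE AXC mulKg.
Qed.

End Step.

End Localization.

(** * Elements acting only on the copies of a window *)

Section Windows.
Variable R : realType.
Local Notation unit_itv := (`[0, 1]%classic : set R).
Local Notation T := (homeo [set: R]).
Variables (e : int -> bool) (G : set T).
Hypotheses (HG : is_subgroup (@groupH R)) (GG : is_subgroup G)
  (G_full : forall p u, groupH u -> G (cellwise e p setT u)).
Implicit Types (u v w : homeo unit_itv) (x y : R) (V W : set int) (f : T).

(** The window is cut between [j] and its neighbour; an occurrence of the whole is a pair of
    occurrences of the parts given by the same isometry, which is what [step] records. *)
Lemma vertices_split d j l h : (if d then l <= j < h else l < j <= h) ->
  vertices e j l h =
  (if d then vertices e j l j else vertices e j j h) `&`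
  step e j d (if d then vertices e (j + 1) (j + 1) h else vertices e (j - 1) l (j - 1)).
Proof.
move=> lh; apply/seteqP; split=> m.
  move=> [b [q [oc mE]]]; split; case: d lh => lh.
  - by exists b, q; split=> // i ?; apply: oc; lia.
  - by exists b, q; split=> // i ?; apply: oc; lia.
  - exists b, q; split; rewrite /neighbour ?mE ?oc//; try by lia.
    by exists b, q; split=> // i ?; apply: oc; lia.
  - exists b, q; split; rewrite /neighbour ?mE ?oc//; try by lia.
    by exists b, q; split=> // i ?; apply: oc; lia.
move=> [V1 [b [q [mE em V2 em2]]]]; exists b, q; split=> //.
case: d lh V1 V2 em2 => lh [b1 [q1 [oc1 mE1]]] [b2 [q2 [oc2 mE2]]] /=; rewrite /neighbour => em2 i ilh.
- have jl : l <= j <= j by lia.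
  have bb1 : b = b1 by move: em; rewrite mE1 oc1// => /addIb.
  have jh : j + 1 <= j + 1 <= h by lia.
  have bb2 : b = b2 by move: em2; rewrite /neighbour mE2 oc2// => /addIb.
  have [ij|ji] := leP i j.
    by move: mE mE1; rewrite -bb1 => -> /aff_injq qq1; rewrite -qq1 bb1 oc1 //; lia.
  by move: mE2; rewrite -bb2 /neighbour => /aff_injq qq2; rewrite -qq2 bb2 oc2 //; lia.
- have jl : j <= j <= h by lia.
  have bb1 : b = b1 by move: em; rewrite mE1 oc1// => /addIb.
  have jh : l <= j - 1 <= j - 1 by lia.
  have bb2 : b = b2 by move: em2; rewrite /neighbour mE2 oc2// => /addIb.
  have [ij|ji] := leP j i.
    by move: mE mE1; rewrite -bb1 => -> /aff_injq qq1; rewrite -qq1 bb1 oc1 //; lia.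
  by move: mE2; rewrite -bb2 /neighbour => /aff_injq qq2; rewrite -qq2 bb2 oc2 //; lia.
Qed.

Let good V p := @good R e G p V.

Lemma vertices_good_refl j : good (vertices e j j j) (oddz j).
Proof.
move=> u v [uH _] [vH _]; rewrite (_ : cellwise _ _ _ _ = cellwise e (oddz j) setT [~ u, v]%g).
  apply: G_full; have [_ HM HV] := HG.
  by rewrite commgEl conjgE; apply: (HM); [exact: HV|apply: (HM); [exact: HV|exact: HM]].
apply: cellwise_ext => k /(aff_refl e)[q kE]; split=> // _.
exists (e k (+) e j), q; split=> // i ij; have -> : i = j by lia.
by rewrite -kE -addbA addbb addbF.
Qed.

Lemma vertices_good j l h : l <= j <= h -> good (vertices e j l h) (oddz j).
Proof.
(* Windows ending at the marked cell come first; [up] then adds the letters to its right. *)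
have low j' (n : nat) : good (vertices e j' (j' - n%:Z) j') (oddz j').
  elim: n j' => [|n IHn] j'; first by rewrite subr0; exact: vertices_good_refl.
  rewrite (@vertices_split false j'); last by lia.
  apply: (good_step HG GG G_full) => //; first exact: vertices_good_refl.
  by have := IHn (j' - 1); have -> : j' - 1 - n%:Z = j' - n.+1%:Z by lia.
have up (n : nat) j' l' : l' <= j' -> good (vertices e j' l' (j' + n%:Z)) (oddz j').
  elim: n j' l' => [|n IHn] j' l' lj.
    by rewrite addr0 (_ : l' = j' - `|j' - l'|%N%:Z); [exact: low|lia].
  rewrite (@vertices_split true j'); last by lia.
  apply: (good_step HG GG G_full) => //.
    by rewrite (_ : l' = j' - `|j' - l'|%N%:Z); [exact: low|lia].
  have := IHn (j' + 1) (j' + 1) (lexx _).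
  by have -> : j' + 1 + n%:Z = j' + n.+1%:Z by lia.
move=> /andP[lj jh]; rewrite (_ : h = j + `|h - j|%N%:Z); first exact: up.
lia.
Qed.

Variables (l l0 h0 h : int).
Hypotheses (ll0 : l <= l0) (h0h : h0 <= h) (l0h0 : l0 + 2 <= h0).
Let A : R := l0%:~R / 2.
Let B : R := h0%:~R / 2.
Hypothesis copies_disjoint : forall b q b' q' x y,
  occurs e l h b q -> occurs e l h b' q' -> A < x < B -> A <= y <= B ->
  affR b q x = affR b' q' y -> b = b' /\ q = q'.

(** Occurrences are those of the whole window [[l, h]], whereas the support consists of copies of
    [[l0 / 2, h0 / 2]]: the letters of the margin serve to keep the copies apart. *)
Definition copywise : set T := [set f | [/\ G f,
  forall b q x, occurs e l h b q -> A <= x <= B -> f (affR b q x) = affR b q (f x),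
  forall x, (forall b q y, occurs e l h b q -> A <= y <= B -> x <> affR b q y) ->
    f x = x,
  f A = A & f B = B]].

Lemma homeo_setT_lt f : {homo f : x y / x < y}.
Proof.
by move=> x y; apply: (homeo_increasing (homeoP f)); rewrite in_setT.
Qed.

Lemma homeo_setT_le f : {homo f : x y / x <= y}.
Proof.
move=> x y; rewrite le_eqVlt => /orP[/eqP ->//|xy].
exact/ltW/homeo_setT_lt.
Qed.

Lemma copywise_in f x : copywise f -> A <= x <= B -> A <= f x <= B.
Proof.
move=> [_ _ _ fA fB] /andP[Ax xB].
by rewrite -{1}fA -[X in _ && (_ <= X)]fB !homeo_setT_le.
Qed.

Lemma copywise_subgroup : is_subgroup copywise.
Proof.
have [G1 GM GV] := GG; split=> [|f g fL gL|f fL].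
- by split.
- have [[Gf fc fo fA fB] [Gg gc go gA gB]] := (fL, gL).
  split; [exact: GM| | |by rewrite homeo_mulE gA|by rewrite homeo_mulE gB].
    by move=> b q x oc xAB; rewrite !homeo_mulE gc// fc//; exact: copywise_in.
  by move=> x xo; rewrite homeo_mulE go// fo.
- have [Gf fc fo fA fB] := fL.
  have fVA : (f^-1)%g A = A by rewrite -{1}fA homeo_invK.
  have fVB : (f^-1)%g B = B by rewrite -{1}fB homeo_invK.
  split=> //; first exact: GV.
    move=> b q x oc /andP[Ax xB]; rewrite -{1}(homeo_invVK f x) -fc ?homeo_invK//.
    by rewrite -{1}fVA -[X in _ && (_ <= X)]fVB !homeo_setT_le.
  by move=> x xo; rewrite -{1}(fo x xo) homeo_invK.
Qed.

Lemma affR_cell b q k x : (k%:~R - 1 <= 2 * x <= k%:~R + 1) =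
  ((aff b q k)%:~R - 1 <= 2 * affR b q x <= (aff b q k)%:~R + 1).
Proof.
rewrite /aff /affR; case: b; rewrite ?(rmorphB, rmorphD, rmorphM)/=;
  by apply/idP/idP => /andP[? ?]; apply/andP; split; lra.
Qed.

Section OneCell.
Variables (j : int) (w : homeo unit_itv).
Hypothesis jlh : l0 < j < h0.
Let V := vertices e j l h.
Let f := cellwise e (oddz j) V w.

Let cellAB x : j%:~R - 1 <= 2 * x <= j%:~R + 1 -> A <= x <= B.
Proof.
have : l0 + 1 <= j /\ j + 1 <= h0 by lia.
rewrite -!(ler_int R) !rmorphD/= => -[? ?] /andP[? ?].
by rewrite /A /B; apply/andP; split; lra.
Qed.

Let ocell_AB x : j%:~R - 1 < 2 * x < j%:~R + 1 -> A < x < B.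
Proof.
have : l0 + 1 <= j /\ j + 1 <= h0 by lia.
rewrite -!(ler_int R) !rmorphD/= => -[? ?] /andP[? ?].
by rewrite /A /B; apply/andP; split; lra.
Qed.

Let jlh' : l <= j <= h. Proof. by lia. Qed.

Let fE x : f x = let k := cell_index (oddz j) x in
  if k \in V then local (e k) k w x else x.
Proof. by []. Qed.

(** The active cell may come from another occurrence [(b', q')]. Either [copies_disjoint] or
    [occurs_inj] identifies it with [(b, q)], or the point is fixed on both sides. *)
Lemma cellwise_copy b q x : occurs e l h b q -> A <= x <= B ->
  f (affR b q x) = affR b q (local (e j) j w x).
Proof.
move=> oc xAB; rewrite fE /=; set k := cell_index _ _.
have kx := cell_indexP (oddz j) (affR b q x); rewrite -/k in kx.
have kE : j%:~R - 1 < 2 * x < j%:~R + 1 -> k = aff b q j.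
  move=> /(aff_cell b q)/andP[? ?].
  by rewrite /k -(oddz_aff b q j) cell_index_uniq// ltW.
have [kV|kV] := boolP (k \in V); last first.
  have [xj|/local_out->//] := boolP (j%:~R - 1 < 2 * x < j%:~R + 1).
  by move: kV; rewrite kE// => /negP[]; apply/mem_set; exists b, q.
have [b' [q' [oc' kE']]] := set_mem kV.
pose x' := affR b' (aff_inv b' q') (affR b q x).
have xE : affR b q x = affR b' q' x' by rewrite affRVK.
have ek : e k = b' (+) e j by rewrite kE' oc'.
have -> : local (e k) k w (affR b q x) = affR b' q' (local (e j) j w x').
  by rewrite ek kE' xE local_aff.
have [xj'|xj'] := boolP (j%:~R - 1 < 2 * x' < j%:~R + 1).
  have [bb' qq'] := copies_disjoint oc' oc (ocell_AB xj') xAB (esym xE).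
  by move: xE; rewrite -bb' -qq' => /(can_inj (affRK b' q')) ->.
rewrite (local_out _ _ xj') -xE local_out//; apply: contra xj' => xj.
have [bb' qq'] := occurs_inj oc oc' jlh' (etrans (esym (kE xj)) kE').
by rewrite /x' -bb' -qq' affRK.
Qed.

Lemma cellwise_copywise : G f -> copywise f.
Proof.
move=> Gf; have AE : A = affR false 0 A by rewrite /affR add0r.
have BE : B = affR false 0 B by rewrite /affR add0r.
have : l0 + 1 <= j /\ j + 1 <= h0 by lia.
rewrite -!(ler_int R) !rmorphD/= => -[lj jh].
have ABE x : A <= x <= B -> f x = local (e j) j w x.
  move=> xAB; have := cellwise_copy (@occurs_id e l h) xAB.
  by rewrite /affR !add0r.
split=> //.
- by move=> b q x oc xAB; rewrite cellwise_copy// ABE.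
- move=> x xo; rewrite fE /=; case: ifP => // /set_mem[b [q [oc kE]]].
  have := @xo b q (affR b (aff_inv b q) x) oc; rewrite affRVK => xo'; exfalso; apply: xo' => //.
  apply: cellAB; rewrite (affR_cell b q) affRVK -kE.
  by have /andP[-> /ltW] := cell_indexP (oddz j) x.
- by rewrite ABE ?local_out//; rewrite /A /B; [apply/negP|apply/andP; split]; lra.
- by rewrite ABE ?local_out//; rewrite /A /B; [apply/negP|apply/andP; split]; lra.
Qed.

End OneCell.

Lemma copywise_micro x c d : A <= c -> c < x < d -> d <= B -> exists f,
  [/\ copywise f, f x != x & forall y, A < y < B -> ~~ (c < y < d) -> f y = y].
Proof.
move=> Ac /andP[cx xd] dB.
have jlhP j : l0 < j < h0 -> l <= j <= h by lia.
have [j [jl jx]] : exists j, l0 < j < h0 /\ j%:~R - 1 < 2 * x < j%:~R + 1.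
  have /andP[fl fr] := floor_itv (2 * x); rewrite rmorphD/= in fr.
  set n := Num.floor (2 * x) in fl fr.
  have nh : n < h0 by rewrite -(ltr_int R); move: dB; rewrite /B; lra.
  have ln : l0 <= n by rewrite -ltzD1 -(ltr_int R) rmorphD/=; move: Ac; rewrite /A; lra.
  (* For [n = l0] the cell of [n] sticks out of [[A, B]]; the next cell contains [x] too, since
     [l0 < 2 * x]. *)
  have [nl|nl] := eqVneq n l0; last by exists n; split; [lia|apply/andP; split; lra].
  exists (n + 1); split; first by lia.
  by rewrite rmorphD/= nl; move: Ac; rewrite /A => ?; rewrite nl in fl fr; apply/andP; split; lra.
pose t := chartV (e j) j x.
have t01 : 0 < t < 1 by rewrite -chartV_in.
have [c' [d' [c'0 d'1 ct cd]]] : exists c' d' : R, [/\ 0 <= c', d' <= 1, c' < t < d' &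
    forall s, c' < s < d' -> c < chart (e j) j s < d].
  rewrite /t /chartV /chart in t01 *; case: (e j) t01 => /andP[t0 t1].
    exists (Num.max 0 ((j%:~R + 1) / 2 - d)), (Num.min 1 ((j%:~R + 1) / 2 - c)); split.
    - by rewrite le_max lexx.
    - by rewrite ge_min lexx.
    - by rewrite gt_max lt_min t0 t1/=; apply/andP; split; lra.
    - by move=> s; rewrite gt_max lt_min => /andP[/andP[_ ?] /andP[_ ?]]; apply/andP; split; lra.
  exists (Num.max 0 (c - (j%:~R - 1) / 2)), (Num.min 1 (d - (j%:~R - 1) / 2)); split.
  - by rewrite le_max lexx.
  - by rewrite ge_min lexx.
  - by rewrite gt_max lt_min t0 t1/=; apply/andP; split; lra.
  - by move=> s; rewrite gt_max lt_min => /andP[/andP[_ ?] /andP[_ ?]]; apply/andP; split; lra.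
have [u [v [uK vK wt wid]]] := groupK_commutator_micro c'0 ct d'1.
have Gw := vertices_good (jlhP j jl) uK vK.
have wL := cellwise_copywise jl Gw; exists (cellwise e (oddz j) (vertices e j l h) [~ u, v]%g).
have wE y : A <= y <= B ->
    cellwise e (oddz j) (vertices e j l h) [~ u, v]%g y = local (e j) j [~ u, v]%g y.
  move=> yAB; have := @cellwise_copy j [~ u, v]%g jl false 0 y (@occurs_id e l h) yAB.
  by rewrite /affR !add0r.
split=> //.
  rewrite wE; last by apply/andP; split; lra.
  apply: contra wt => /eqP lx; apply/eqP; apply: (can_inj (chartK (e j) j)).
  by rewrite -[RHS]/(chart (e j) j (chartV (e j) j x)) chartVK -[RHS]lx.
move=> y /andP[Ay yB] ny; rewrite wE; last by apply/andP; split; lra.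
rewrite /local wid ?chartVK//; apply: contra ny => /cd.
by rewrite chartVK.
Qed.

Lemma copywise_compress a b p q : A < a -> a <= b -> b < B -> A <= p -> p < q -> q <= B ->
  exists f, [/\ copywise f, p < f a & f b < q].
Proof.
apply: compress; first exact: copywise_subgroup.
- by move=> f _; exact: homeo_setT_lt.
- move=> f x [_ _ _ fA fB] /andP[Ax xB].
  by rewrite -{1}fA -[X in _ && (_ < X)]fB !homeo_setT_lt.
- exact: copywise_micro.
Qed.

End Windows.

(** * Fragmentation *)

Section Fragmentation.
Variable R : realType.
Local Notation unit_itv := (`[0, 1]%classic : set R).
Local Notation T := (homeo [set: R]).
Variables (e : int -> bool) (G : set T).
Hypotheses (HG : is_subgroup (@groupH R)) (GG : is_subgroup G)
  (G_full : forall p u, groupH u -> G (cellwise e p setT u))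
  (G_gen : forall S : set T, is_subgroup S ->
     (forall p u, groupH u -> S (cellwise e p setT u)) -> G `<=` S).
Implicit Types (u v w : homeo unit_itv) (x y : R) (f g : T) (k r s m : int).

Definition centers k r : set int := vertices e k (k - r) (k + r).

Definition sparse (V : set int) (N : int) : Prop :=
  forall m m', V m -> V m' -> m <> m' -> N <= `|m - m'|.

(* Both [k] and [s] count half-units: the ball is centred at [k / 2] and has
   radius [s / 2]. *)
Definition ball (V : set int) s : set R := [set x | exists2 k, V k & `|2 * x - k%:~R| <= s%:~R].

Lemma ball_sub (V : set int) s s' : s <= s' -> ball V s `<=` ball V s'.
Proof. by rewrite -(ler_int R) => ss x [k Vk xk]; exists k => //; exact: le_trans ss. Qed.

Lemma ball_move (V : set int) s m x y : `|2 * y - 2 * x| <= m%:~R ->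
  ball V s x -> ball V (s + m) y.
Proof.
move=> yx [k Vk xk]; exists k => //; rewrite rmorphD/=.
have -> : 2 * y - k%:~R = (2 * x - k%:~R) + (2 * y - 2 * x) by ring.
by rewrite (le_trans (ler_normD _ _))// lerD.
Qed.

Lemma affR_dist b q k x : `|2 * affR b q x - (aff b q k)%:~R| = `|2 * x - k%:~R|.
Proof.
case: b; rewrite /affR /aff ?(rmorphB, rmorphD, rmorphM)/=.
  rewrite -normrN; congr `|_|; ring.
by congr `|_|; ring.
Qed.

Lemma sparse_copies_disjoint k r s : s <= r -> 0 <= s -> sparse (centers k r) (2 * s) ->
  forall b q b' q' x y, occurs e (k - r) (k + r) b q -> occurs e (k - r) (k + r) b' q' ->
  (k - s)%:~R / 2 < x < (k + s)%:~R / 2 -> (k - s)%:~R / 2 <= y <= (k + s)%:~R / 2 ->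
  affR b q x = affR b' q' y -> b = b' /\ q = q'.
Proof.
move=> sr s0 sp b q b' q' x y oc oc'; rewrite !rmorphD/= !rmorphN/= => xs ys xy.
have kr : k - r <= k <= k + r by lia.
apply: (occurs_inj oc oc' kr); apply: contrapT => ne.
have := sp _ _ (ex_intro _ b (ex_intro _ q (conj oc erefl)))
  (ex_intro _ b' (ex_intro _ q' (conj oc' erefl))) ne.
have hx : `|2 * affR b q x - (aff b q k)%:~R| < s%:~R.
  by rewrite affR_dist ltr_norml; apply/andP; split; lra.
have hy : `|2 * affR b' q' y - (aff b' q' k)%:~R| <= s%:~R.
  by rewrite affR_dist ler_norml; apply/andP; split; lra.
rewrite -(ler_int R) intr_norm rmorphB rmorphM/=; move: hx hy; rewrite xy.
rewrite ltr_norml ler_norml => /andP[? ?] /andP[? ?].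
by apply/negP; rewrite -ltNge ltr_norml; apply/andP; split; lra.
Qed.

(** The same [m] serves all [s], [k] and [r]. The bound on the displacement makes the property
    stable under products: the inner factor enlarges the balls by at most its own bound. *)
Definition fragments g m : Prop := [/\ 0 <= m, forall x, `|2 * g x - 2 * x| <= m%:~R &
  forall s k r, 0 <= s -> s + m <= r -> sparse (centers k r) (2 * (s + m)) ->
  exists2 f, G f & (forall x, ball (centers k r) s x -> f x = g x) /\
    (forall x, ~ ball (centers k r) (s + m) x -> f x = x)].

Let GM f g : G f -> G g -> G (f * g)%g. Proof. by have [_ + _] := GG; exact. Qed.
Let GV f : G f -> G f^-1%g. Proof. by have [_ _] := GG; exact. Qed.

Lemma sparse_le (V : set int) N N' : N' <= N -> sparse V N -> sparse V N'.
Proof. by move=> NN sp m m' Vm Vm' mm'; rewrite (le_trans NN)// sp. Qed.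

Lemma fragmentsM f g m m' : fragments f m -> fragments g m' -> fragments (f * g)%g (m + m').
Proof.
move=> [m0 fm ff] [m'0 gm gf]; split; first by lia.
  move=> x; rewrite homeo_mulE rmorphD/=.
  have -> : 2 * f (g x) - 2 * x = (2 * f (g x) - 2 * g x) + (2 * g x - 2 * x) by ring.
  by rewrite (le_trans (ler_normD _ _))// lerD.
move=> s k r s0 sr sp.
have [|||g' Gg' [g'E g'o]] := gf s k r; [lia|lia|by apply: sparse_le sp; lia|].
have [|||f' Gf' [f'E f'o]] := ff (s + m') k r; [lia|lia|by apply: sparse_le sp; lia|].
exists (f' * g')%g; first exact: GM.
split=> x xb; rewrite !homeo_mulE.
  by rewrite g'E// f'E//; exact: ball_move (gm x) xb.
rewrite g'o; last by apply: contra_not xb; apply: ball_sub; lia.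
by rewrite f'o//; apply: contra_not xb; apply: ball_sub; lia.
Qed.

Lemma fragmentsV f m : fragments f m -> fragments f^-1%g (m + m).
Proof.
move=> [m0 fm ff].
have fVm x : `|2 * (f^-1)%g x - 2 * x| <= m%:~R.
  by rewrite distrC -{1}(homeo_invVK f x).
split; first by lia.
  by move=> x; rewrite (le_trans (fVm x))// ler_int; lia.
move=> s k r s0 sr sp.
have [|||f' Gf' [f'E f'o]] := ff (s + m) k r; [lia|lia|by apply: sparse_le sp; lia|].
exists f'^-1%g; first exact: GV.
split=> x xb.
  have xb' : ball (centers k r) (s + m) ((f^-1)%g x) by exact: ball_move (fVm x) xb.
  by rewrite -{1}(homeo_invVK f x) -(f'E _ xb') homeo_invK.
by rewrite -{1}(f'o x) ?homeo_invK//; apply: contra_not xb; apply: ball_sub; lia.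
Qed.

(* If [f] squeezes the balls around the centers into fixed intervals of
   [g := cellwise e p setT u], then [g * (f^-1 * g^-1 * f)] agrees with [g] on
   these balls. *)
Lemma fragments_fixing p u : groupH u -> fixes_interval u ->
  fragments (cellwise e p setT u) 4.
Proof.
move=> uH [a [b [a0 ab b1 ufix]]]; split=> //.
  by move=> x; rewrite (le_trans (cellwise_move e p setT u x))// ler_nat.
move=> s k r s0 sr sp; set g := cellwise e p setT u.
(* A cell of parity [p] inside the ball of radius [s + 2], to squeeze into. The [4] is 2 for the
   support of [f] and 2 for the displacement of [g]. *)
pose j := if oddz k == p then k else k + 1.
have jp : oddz j = p.
  rewrite /j; case: eqP => // kp.
  have -> : oddz (k + 1) = ~~ oddz k by rewrite /oddz; lia.
  by move: kp; case: (oddz k); case: (p).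
have jk : k - (s + 2) < j < k + (s + 2) by rewrite /j; case: ifP; lia.
have s2r : s + 2 <= r by lia.
have jr : k - r <= j <= k + r by rewrite /j; case: ifP; lia.
have s20 : 0 <= s + 2 by lia.
have sp2 : sparse (centers k r) (2 * (s + 2)) by apply: sparse_le sp; lia.
have dis := sparse_copies_disjoint s2r s20 sp2.
have [p0 [q0 [p0A q0B pq0 pqfix]]] : exists p0 q0 : R, [/\ (k - (s + 2))%:~R / 2 <= p0,
    q0 <= (k + (s + 2))%:~R / 2, p0 < q0 &
    forall x, p0 < x < q0 -> a < chartV (e j) j x < b].
  have : k - (s + 2) + 1 <= j /\ j + 1 <= k + (s + 2) by lia.
  rewrite -!(ler_int R) !rmorphD/= !rmorphN/= => -[? ?]; rewrite /chartV.
  case: (e j).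
    exists ((j%:~R + 1) / 2 - b), ((j%:~R + 1) / 2 - a).
    by split=> [| | |x /andP[? ?]]; [lra|lra|lra|apply/andP; split; lra].
  exists (a + (j%:~R - 1) / 2), (b + (j%:~R - 1) / 2).
  by split=> [| | |x /andP[? ?]]; [lra|lra|lra|apply/andP; split; lra].
have sR0 : 0 <= s%:~R :> R by rewrite ler0z.
have ll0 : k - r <= k - (s + 2) by lia.
have h0h : k + (s + 2) <= k + r by lia.
have l0h0 : k - (s + 2) + 2 <= k + (s + 2) by lia.
have Aa : (k - (s + 2))%:~R / 2 < (k - s)%:~R / 2 :> R.
  by rewrite !rmorphD/= !rmorphN/= ?rmorphD/=; lra.
have ab' : (k - s)%:~R / 2 <= (k + s)%:~R / 2 :> R.
  by rewrite !rmorphD/= !rmorphN/=; lra.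
have bB : (k + s)%:~R / 2 < (k + (s + 2))%:~R / 2 :> R by rewrite !rmorphD/=; lra.
have [f [fL fk0 fk1]] :=
  copywise_compress HG GG G_full ll0 h0h l0h0 dis Aa ab' bB p0A pq0 q0B.
have [Gf fc fo _ _] := fL.
have Gg : G g by exact: G_full.
exists (g * f^-1 * g^-1 * f)%g.
  by apply: GM => //; apply: GM; [apply: GM => //; exact: GV|exact: GV].
have foff x : ~ ball (centers k r) (s + 2) x -> f x = x.
  move=> xb; apply: fo => b' q' y oc yAB xE; apply: xb.
  exists (aff b' q' k); first by exists b', q'.
  rewrite xE affR_dist ler_norml; move: yAB; rewrite !rmorphD/= !rmorphN/= ?rmorphD/=.
  by move=> /andP[? ?]; apply/andP; split; lra.
split=> x xb; rewrite !homeo_mulE.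
  have [m [b' [q' [oc ->]]] xm] := xb.
  have [y xE] : exists y, x = affR b' q' y.
    by exists (affR b' (aff_inv b' q') x); rewrite affRVK.
  rewrite xE affR_dist ler_norml in xm; have {xm} /andP[xm1 xm2] := xm.
  have yAB : (k - (s + 2))%:~R / 2 <= y <= (k + (s + 2))%:~R / 2.
    by rewrite !rmorphD/= !rmorphN/= ?rmorphD/=; apply/andP; split; lra.
  have fyJ : p0 < f y < q0.
    apply/andP; split.
      apply: lt_le_trans fk0 _; apply: homeo_setT_le.
      by rewrite !rmorphD/= !rmorphN/=; lra.
    apply: le_lt_trans _ fk1; apply: homeo_setT_le.
    by rewrite !rmorphD/=; lra.
  have t01 := pqfix _ fyJ.
  have cell : j%:~R - 1 < 2 * f y < j%:~R + 1.
    by rewrite (chartV_in (e j)); move: t01 => /andP[? ?]; apply/andP; split; lra.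
  have gfix : g (f x) = f x.
    rewrite xE fc// /g -jp -(oddz_aff b' q' j) (@cellwiseE _ _ (aff b' q' j)) ?in_setT.
      by rewrite oc// local_aff /local ufix// chartVK.
    by have /andP[/ltW -> /ltW ->] := aff_cell b' q' cell.
  by rewrite -{1}gfix homeo_invK homeo_invK.
have fx : f x = x by apply: foff; apply: contra_not xb; apply: ball_sub; rewrite lerD2l.
have gx : f ((g^-1)%g x) = (g^-1)%g x.
  apply: foff; apply: contra_not xb => xb.
  have -> : s + 4 = s + 2 + 2 by rewrite -addrA.
  apply: ball_move xb; rewrite -{1}(homeo_invVK g x).
  exact: cellwise_move.
by rewrite fx -{1}gx homeo_invK homeo_invVK.
Qed.

Lemma fragments_exists g : G g -> exists m, fragments g m.
Proof.
move=> Gg; suff [] : (G `&` [set g | exists m, fragments g m]) g by [].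
move: g Gg; apply: G_gen.
  have [G1 _ _] := GG; split.
  - split=> //; exists 0; split=> //; first by move=> x; rewrite subrr normr0.
    by move=> s k r s0 sr sp; exists 1%g.
  - move=> f g [Gf [m fm]] [Gg [m' gm]]; split; first exact: GM.
    by exists (m + m'); exact: fragmentsM.
  - move=> f [Gf [m fm]]; split; first exact: GV.
    by exists (m + m); exact: fragmentsV.
move=> p u uH; split; first exact: G_full.
have [u1 [u2 [u1H u2H u1f u2f ->]]] := groupH_decomp HG uH.
by exists (4 + 4); rewrite cellwiseM; apply: fragmentsM; exact: fragments_fixing.
Qed.

End Fragmentation.

(** * Displacement *)

Lemma finite_representatives (X : Type) (KF : finType) (key : X -> KF) (P : X -> Prop) :
  exists s : seq X, (forall x, List.In x s -> P x) /\
    forall x, P x -> exists y, List.In y s /\ key y = key x.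
Proof.
suff [s [sP s_key]] : exists s : seq X, (forall x, List.In x s -> P x) /\
    forall x, P x -> key x \in enum KF -> exists y, List.In y s /\ key y = key x.
  by exists s; split=> // x Px; apply: s_key => //; rewrite mem_enum.
elim: (enum KF) => [|k ks [s [sP s_key]]]; first by exists [::]; split.
have [[x0 [Px0 kx0]]|nk] := pselect (exists x, P x /\ key x = k).
  exists (x0 :: s); split=> [x [<-//|/sP//]|x Px].
  rewrite inE => /orP[/eqP kx|/(s_key x Px)[y [ys yx]]]; last by exists y; split=> //; right.
  by exists x0; split; [left|rewrite kx].
exists s; split=> // x Px; rewrite inE => /orP[/eqP kx|]; last exact: s_key.
by exfalso; apply: nk; exists x.
Qed.

Section Displacement.
Variable R : realType.
Local Notation unit_itv := (`[0, 1]%classic : set R).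
Local Notation T := (homeo [set: R]).
Variables (e : int -> bool) (G : set T).
Hypotheses (HG : is_subgroup (@groupH R)) (GG : is_subgroup G)
  (G_full : forall p u, groupH u -> G (cellwise e p setT u))
  (eQ1 : recurrent e).
Variables (k r : int).
Hypothesis r0 : 0 <= r.
Local Notation V := (centers e k r).
Hypothesis V_sparse : sparse V 4.
Implicit Types (x y z : R) (f t : T) (p q i : int).

Definition adjacent p p' : Prop := [/\ V p, V p', p < p' & forall i, p < i < p' -> ~ V i].

Lemma center_before n : exists p, [/\ V p, p <= n & forall i, p < i <= n -> ~ V i].
Proof.
have [N N0 /(_ (n - N))[m mN Vm]] := vertices_syndetic eQ1 k r.
have ex : exists d : nat, `[< V (n - d%:Z) >].
  by exists `|n - m|%N; apply/asboolP; rewrite (_ : n - _ = m)//; lia.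
case: (ex_minnP ex) => d /asboolP Vd dmin.
exists (n - d%:Z); split=> // [|i ind Vi]; first by lia.
have := dmin `|n - i|%N; rewrite (_ : n - `|n - i|%N%:Z = i); last by lia.
by move=> /(_ (asboolT Vi)); lia.
Qed.

Lemma center_after n : exists p, [/\ V p, n < p & forall i, n < i < p -> ~ V i].
Proof.
have [N N0 /(_ (n + 1))[m mN Vm]] := vertices_syndetic eQ1 k r.
have ex : exists d : nat, `[< V (n + 1 + d%:Z) >].
  by exists `|(m - n - 1)%R|%N; apply/asboolP; rewrite (_ : n + 1 + _ = m)//; lia.
case: (ex_minnP ex) => d /asboolP Vd dmin.
exists (n + 1 + d%:Z); split=> // [|i ind Vi]; first by lia.
have := dmin `|(i - n - 1)%R|%N; rewrite (_ : n + 1 + `|(i - n - 1)%R|%N%:Z = i); last by lia.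
by move=> /(_ (asboolT Vi)); lia.
Qed.

Lemma adjacent_exists z : exists p p', adjacent p p' /\ p%:~R <= 2 * z <= p'%:~R.
Proof.
have /andP[fl fr] := floor_itv (2 * z); set n := Num.floor (2 * z) in fl fr.
have [p [Vp pn pmax]] := center_before n; have [p' [Vp' np' pmin]] := center_after n.
exists p, p'; split.
  split=> //; first by lia.
  move=> i /andP[pi ip']; have [inn|ni] := leP i n; first by apply: pmax; rewrite pi.
  by apply: pmin; rewrite ni.
apply/andP; split; first by rewrite (le_trans _ fl)// ler_int.
by apply: ltW; rewrite (lt_le_trans fr)// ler_int; lia.
Qed.

Lemma adjacent_uniq p p' a a' z : adjacent p p' -> adjacent a a' ->
  p%:~R < 2 * z < p'%:~R -> a%:~R <= 2 * z <= a'%:~R -> p = a /\ p' = a'.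
Proof.
move=> [Vp Vp' pp' pn] [Va Va' aa' an] /andP[pz zp'] /andP[az za'].
have ap' : a < p' by rewrite -(ltr_int R); lra.
have pa' : p < a' by rewrite -(ltr_int R); lra.
have pa : ~ p < a by move=> pa; apply: (pn a) => //; rewrite pa.
have ap : ~ a < p by move=> ap; apply: (an p) => //; rewrite ap.
have a'p' : ~ a' < p' by move=> a'p'; apply: (pn a') => //; rewrite pa'.
have p'a' : ~ p' < a' by move=> p'a'; apply: (an p') => //; rewrite ap'.
by split; lia.
Qed.

Lemma adjacent_center p p' z i : adjacent p p' -> p%:~R <= 2 * z <= p'%:~R ->
  V i -> 2 * z = i%:~R -> i = p \/ i = p'.
Proof.
move=> [Vp Vp' pp' pn] + Vi zi; rewrite zi !ler_int => /andP[pi ip'].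
have [|pi'] := eqVneq i p; first by left.
have [|ip''] := eqVneq i p'; first by right.
by exfalso; apply: (pn i) => //; lia.
Qed.

Definition image (b : bool) q p p' : int * int :=
  if b then (aff b q p', aff b q p) else (aff b q p, aff b q p').

(** Being a center depends on the letters within [r] only, so the margin [r] makes copies preserve
    centers and non-centers. *)
Definition copy_of p p' b q : Prop := occurs e (p - r) (p' + r) b q.

Lemma copy_center p p' b q i : p < p' -> copy_of p p' b q -> p <= i <= p' ->
  V i -> V (aff b q i).
Proof. by move=> pp' oc /andP[pi ip']; apply: (occurs_vertices oc); lia. Qed.

Lemma copy_centerV p p' b q i : p < p' -> copy_of p p' b q -> p <= i <= p' ->
  V (aff b q i) -> V i.
Proof. by move=> pp' oc /andP[pi ip']; apply: (occurs_verticesV oc); lia. Qed.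

Lemma image_adjacent p p' b q : adjacent p p' -> copy_of p p' b q ->
  adjacent (image b q p p').1 (image b q p p').2.
Proof.
move=> [Vp Vp' pp' pn] oc.
have Vap : V (aff b q p) by apply: copy_center oc _ _ => //; lia.
have Vap' : V (aff b q p') by apply: copy_center oc _ _ => //; lia.
rewrite /image; case: b oc Vap Vap' => oc Vap Vap'; split=> //=.
- by rewrite /aff; lia.
- move=> i ip; rewrite -(affVK true q i) => Vi.
  have pi : p < aff true (aff_inv true q) i < p' by move: ip; rewrite /aff /aff_inv; lia.
  by apply: (pn _ pi); apply: copy_centerV oc _ Vi => //; lia.
- by rewrite /aff; lia.
- move=> i ip; rewrite -(affVK false q i) => Vi.
  have pi : p < aff false (aff_inv false q) i < p' by move: ip; rewrite /aff /aff_inv; lia.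
  by apply: (pn _ pi); apply: copy_centerV oc _ Vi => //; lia.
Qed.

Lemma image_le b q p p' z : (p%:~R <= 2 * z <= p'%:~R) =
  ((image b q p p').1%:~R <= 2 * affR b q z <= (image b q p p').2%:~R).
Proof.
rewrite /image /affR /aff; case: b; rewrite /= ?(rmorphB, rmorphD, rmorphM)/=;
  by apply/idP/idP => /andP[? ?]; apply/andP; split; lra.
Qed.

Lemma image_lt b q p p' z : (p%:~R < 2 * z < p'%:~R) =
  ((image b q p p').1%:~R < 2 * affR b q z < (image b q p p').2%:~R).
Proof.
rewrite /image /affR /aff; case: b; rewrite /= ?(rmorphB, rmorphD, rmorphM)/=;
  by apply/idP/idP => /andP[? ?]; apply/andP; split; lra.
Qed.

(** Copies of opposite orientations with the same image would send the middle letter to the same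
    place. *)
Lemma image_inj p p' b q b' q' : p < p' -> copy_of p p' b q -> copy_of p p' b' q' ->
  image b q p p' = image b' q' p p' -> b = b' /\ q = q'.
Proof.
move=> pp' oc oc'.
have wp : p - r <= p <= p' + r by lia.
have [<-|bb'] := eqVneq b b'.
  by rewrite /image => im; split=> //; move: im; case: (b) => -[]; rewrite /aff; lia.
have wm : p - r <= ((p + p') %/ 2)%Z <= p' + r by lia.
have := occurs_opposite oc oc' bb' wm; rewrite /image.
case: b b' bb' {oc oc'} => -[]//= _ op [im im']; case: op; move: im im'; rewrite /aff; lia.
Qed.

Lemma copies_of_disjoint p p' b q b' q' x y : adjacent p p' ->
  copy_of p p' b q -> copy_of p p' b' q' ->
  p%:~R / 2 < x < p'%:~R / 2 -> p%:~R / 2 <= y <= p'%:~R / 2 ->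
  affR b q x = affR b' q' y -> b = b' /\ q = q'.
Proof.
move=> ad oc oc' xp yp xy; have [_ _ pp' _] := ad.
have xim : (image b q p p').1%:~R < 2 * affR b q x < (image b q p p').2%:~R.
  by rewrite -image_lt; case/andP: xp => ? ?; apply/andP; split; lra.
have yim : (image b' q' p p').1%:~R <= 2 * affR b q x <= (image b' q' p p').2%:~R.
  by rewrite xy -image_le; case/andP: yp => ? ?; apply/andP; split; lra.
have [im1 im2] := adjacent_uniq (image_adjacent ad oc) (image_adjacent ad oc') xim yim.
by apply: (image_inj pp' oc oc'); exact: injective_projections.
Qed.

Lemma affR_half b q i : affR b q (i%:~R / 2) = (aff b q i)%:~R / 2 :> R.
Proof. by rewrite /affR /aff; case: b; rewrite ?(rmorphB, rmorphD, rmorphM)/=; field. Qed.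

Lemma affR_comp b q b' q' q'' y :
  (forall j, aff b q (aff b' q' j) = aff (b (+) b') q'' j) ->
  affR b q (affR b' q' y) = affR (b (+) b') q'' y.
Proof.
move=> /(_ 0); rewrite /aff /affR; case: b; case: b' => /= h.
- have -> : q'' = q - q' by lia.
  by rewrite rmorphB/=; ring.
- have -> : q'' = q - q' by lia.
  by rewrite rmorphB/=; ring.
- have -> : q'' = q + q' by lia.
  by rewrite rmorphD/=; ring.
- have -> : q'' = q + q' by lia.
  by rewrite rmorphD/=; ring.
Qed.

Lemma image_copy_of p p' b q a a' b' q' : copy_of p p' b q -> image b q p p' = (a, a') ->
  copy_of a a' b' q' ->
  exists2 q'', copy_of p p' (b' (+) b) q'' &
    (forall z, affR b' q' (affR b q z) = affR (b' (+) b) q'' z).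
Proof.
move=> oc im oc'; have [j jp|q'' oc'' qE] := occurs_comp oc' oc.
  by move: im; rewrite /image /aff; case: (b) => -[]; lia.
by exists q'' => // z; exact: affR_comp.
Qed.

Lemma image_copy_ofV p p' b q a a' : copy_of p p' b q -> image b q p p' = (a, a') ->
  copy_of a a' b (aff_inv b q).
Proof.
move=> oc im; apply: occurs_inv oc _ => j ja.
by move: im ja; rewrite /image /aff /aff_inv; case: (b) => -[]; lia.
Qed.

Definition covered (s : seq (int * int)) : set R := [set z | exists X b q y,
  [/\ List.In X s, copy_of X.1 X.2 b q, X.1%:~R <= 2 * y <= X.2%:~R & z = affR b q y]].

Lemma covered_cons X s z : covered (X :: s) z <-> covered [:: X] z \/ covered s z.
Proof.
split=> [[Y [b [q [y [[<-|Ys] oc yY ->]]]]]|[|]].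
- by left; exists X, b, q, y; split=> //; left.
- by right; exists Y, b, q, y.
- by move=> [Y [b [q [y [[<-|//] oc yY ->]]]]]; exists X, b, q, y; split=> //; left.
- by move=> [Y [b [q [y [Ys oc yY ->]]]]]; exists Y, b, q, y; split=> //; right.
Qed.

Lemma covered_image X Y s b q : List.In Y s -> copy_of Y.1 Y.2 b q ->
  image b q Y.1 Y.2 = (X.1, X.2) -> covered [:: X] `<=` covered s.
Proof.
move=> Ys oc im z [_ [b' [q' [y [[<-|//] oc' yX ->]]]]].
have [q'' oc'' qE] := image_copy_of oc im oc'.
exists Y, (b' (+) b), q'', (affR b (aff_inv b q) y); split=> //.
  by rewrite (image_le b q) im affRVK.
by rewrite -qE affRVK.
Qed.

(** Two intervals between adjacent centers coincide or share at most endpoints, and a coincidence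
    would make [X] a copy of some [Y] in [s]. *)
Lemma covered_meet X s z : adjacent X.1 X.2 -> (forall Y, List.In Y s -> adjacent Y.1 Y.2) ->
  ~ (exists Y b q, [/\ List.In Y s, copy_of Y.1 Y.2 b q & image b q Y.1 Y.2 = (X.1, X.2)]) ->
  covered [:: X] z -> covered s z -> exists2 i, V i & 2 * z = i%:~R.
Proof.
move=> adX ads neq [_ [b [q [x [[<-|//] oc xX zx]]]]] [Y [b' [q' [y [Ys oc' yY zy]]]]].
have adY := ads _ Ys.
have adx := image_adjacent adX oc; have ady := image_adjacent adY oc'.
move: xX yY; rewrite (image_le b q X.1 X.2 x) (image_le b' q' Y.1 Y.2 y) -zx -zy => xX yY.
have [xl|xl] := eqVneq (2 * z) (image b q X.1 X.2).1%:~R.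
  by exists (image b q X.1 X.2).1 => //; case: adx.
have [xr|xr] := eqVneq (2 * z) (image b q X.1 X.2).2%:~R.
  by exists (image b q X.1 X.2).2 => //; case: adx.
exfalso; apply: neq.
have xX' : (image b q X.1 X.2).1%:~R < 2 * z < (image b q X.1 X.2).2%:~R.
  by case/andP: xX => ? ?; rewrite !lt_def xl eq_sym xr; apply/andP.
have [im1 im2] := adjacent_uniq adx ady xX' yY.
have im : image b q X.1 X.2 = ((image b' q' Y.1 Y.2).1, (image b' q' Y.1 Y.2).2).
  by rewrite -im1 -im2 -surjective_pairing.
have ocV := image_copy_ofV oc im.
have [q'' oc'' qE] := image_copy_of oc' (surjective_pairing _) ocV.
exists Y, (b (+) b'), q''; split=> //.
have aE i : aff b (aff_inv b q) (aff b' q' i) = aff (b (+) b') q'' i.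
  have := qE (i%:~R / 2); rewrite !affR_half => /(congr1 (fun z : R => z * 2)).
  by rewrite /= !divfK// => /intr_inj.
have imV : image b (aff_inv b q) (image b q X.1 X.2).1 (image b q X.1 X.2).2 = (X.1, X.2).
  by rewrite /image /aff /aff_inv; case: (b) => /=; congr pair; lia.
rewrite -imV im /image; move: aE; case: (b); case: (b') => /= aE; rewrite ?aE//.
Qed.

Lemma homeo_expgS (I : set R) (f : homeo I) n x : (f ^+ n.+1)%g x = f ((f ^+ n)%g x).
Proof. by rewrite expgS. Qed.

(** Induction on the types of intervals. Copies of a new type meet the old ones only at centers,
    which every factor fixes, so the factors do not interfere. All positive powers are controlled,
    as [commuting_conjugatesM] requires. *)
Lemma displacer_list (s : seq (int * int)) : (forall X, List.In X s -> adjacent X.1 X.2) ->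
  exists t, [/\ G t, forall i, V i -> t (i%:~R / 2) = i%:~R / 2,
    forall z, ~ covered s z -> t z = z, forall z, covered s z -> covered s (t z) &
    forall z n, covered s z -> ~ ball V 1 z -> ball V 1 ((t ^+ n.+1)%g z)].
Proof.
have [G1 GM GV] := GG.
elim: s => [_|X s IHs ads].
  have n0 z : ~ covered [::] z by case=> Y [b [q [y [[]]]]].
  by exists 1%g; split=> // z n /n0.
have adX : adjacent X.1 X.2 by apply: ads; left.
have {}ads Y : List.In Y s -> adjacent Y.1 Y.2 by move=> Ys; apply: ads; right.
have [t [Gt tV to tc tb]] := IHs ads.
have [[Y [b [q [Ys oc im]]]]|neq] := pselect (exists Y b q,
    [/\ List.In Y s, copy_of Y.1 Y.2 b q & image b q Y.1 Y.2 = (X.1, X.2)]).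
  have cE z : covered (X :: s) z <-> covered s z.
    rewrite covered_cons; split; last by right.
    by move=> [|//]; exact: covered_image im _.
  exists t; split=> //.
  - by move=> z nz; apply: to => /cE.
  - by move=> z /cE zs; apply/cE; exact: tc.
  - by move=> z n /cE; exact: tb.
have [VX VX' XX' Xn] := adX.
have X4 : X.1 + 4 <= X.2.
  have := V_sparse VX VX'; have : X.1 <> X.2 by move=> XX; rewrite XX ltxx in XX'.
  by move=> h /(_ h); move: XX'; move: (X.1) (X.2) => a a'; lia.
have X4R : X.1%:~R + 4 <= X.2%:~R :> R by rewrite -(ler_int R) rmorphD in X4.
have ll0 : X.1 - r <= X.1 by rewrite gerBl.
have h0h : X.2 <= X.2 + r by rewrite lerDl.
have l0h0 : X.1 + 2 <= X.2 by apply: le_trans X4; rewrite lerD2l.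
have dis b q b' q' x y := @copies_of_disjoint X.1 X.2 b q b' q' x y adX.
(* [f] sends [(X.1 + 1) / 2] past [(X.2 - 1) / 2], which by sparseness lies further right; so all
   later iterates stay in the unit ball around [X.2]. *)
have [||||||f [fL fa fb]] := @copywise_compress R e G HG GG G_full (X.1 - r) X.1 X.2 (X.2 + r)
  ll0 h0h l0h0 dis ((X.1 + 1)%:~R / 2) ((X.2 - 1)%:~R / 2) ((X.2 - 1)%:~R / 2) (X.2%:~R / 2);
  rewrite ?(rmorphD, rmorphB)/=; try lra.
have [Gf fc fo fA fB] := fL.
have fAB y : X.1%:~R / 2 <= y <= X.2%:~R / 2 -> X.1%:~R / 2 <= f y <= X.2%:~R / 2.
  by move=> yAB; exact: copywise_in fL yAB.
have AB2 y : (X.1%:~R / 2 <= y <= X.2%:~R / 2) = (X.1%:~R <= 2 * y <= X.2%:~R).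
  by rewrite ler_pdivrMr// ler_pdivlMr// (mulrC 2).
have coveredP z : covered [:: X] z -> exists b q y, [/\ copy_of X.1 X.2 b q,
    X.1%:~R / 2 <= y <= X.2%:~R / 2 & z = affR b q y].
  by move=> [_ [b [q [y [[<-|//] oc yX ->]]]]]; exists b, q, y; rewrite AB2.
have fcov z : covered [:: X] z -> covered [:: X] (f z).
  move=> /coveredP[b [q [y [oc yX ->]]]].
  by exists X, b, q, (f y); split; [left| |rewrite -AB2; exact: fAB|exact: fc].
have foff z : ~ covered [:: X] z -> f z = z.
  move=> nz; apply: fo => b q y oc yX zE; apply: nz.
  by exists X, b, q, y; rewrite -AB2; split=> //; left.
have fV i : V i -> f (i%:~R / 2) = i%:~R / 2.
  move=> Vi; have [/coveredP[b [q [y [oc yX iE]]]]|/foff//] := pselect (covered [:: X] (i%:~R / 2)).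
  rewrite iE fc//; congr affR.
  have i2 : 2 * affR b q y = i%:~R by rewrite -iE mulrC divfK.
  have yX' := yX; rewrite AB2 (image_le b q) in yX'.
  have yend : 2 * y = X.1%:~R \/ 2 * y = X.2%:~R.
    have affE c : i = aff b q c -> 2 * y = c%:~R.
      move=> ic; have := affR_dist b q c y; rewrite i2 ic subrr normr0 => /esym/eqP.
      by rewrite normr_eq0 subr_eq0 => /eqP.
    have := adjacent_center (image_adjacent adX oc) yX' Vi i2; rewrite /image.
    by case: (b) affE => affE /= -[] /affE; tauto.
  have y2 c : 2 * y = c -> y = c / 2 by move=> <-; rewrite mulrC mulKf.
  by case: yend => /y2 ->.
have fstep n y : (X.1 + 1)%:~R / 2 <= y -> (X.2 - 1)%:~R / 2 < (f ^+ n.+1)%g y.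
  move=> ay; elim: n => [|n IHn]; rewrite homeo_expgS.
    by rewrite (lt_le_trans fa)// homeo_setT_le.
  rewrite (lt_le_trans fa)// homeo_setT_le// (le_trans _ (ltW IHn))//.
  by rewrite rmorphD rmorphB/=; lra.
have fpow z n : covered [:: X] z -> ~ ball V 1 z -> ball V 1 ((f ^+ n.+1)%g z).
  move=> /coveredP[b [q [y [oc yX ->]]]] nb.
  have pow N : (f ^+ N)%g (affR b q y) = affR b q ((f ^+ N)%g y) /\
      X.1%:~R / 2 <= (f ^+ N)%g y <= X.2%:~R / 2.
    by elim: N => [//|N [IH1 IH2]]; rewrite !homeo_expgS IH1 fc//; split=> //; exact: fAB.
  have ay : (X.1 + 1)%:~R / 2 <= y.
    have : ~ (`|2 * y - X.1%:~R| <= 1).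
      move=> yX1; apply: nb; exists (aff b q X.1); last by rewrite affR_dist.
      by apply: copy_center oc _ VX; rewrite ?lexx ?ltW.
    rewrite rmorphD/=; case/andP: yX => yX1 yX2 /negP; rewrite -ltNge ltr_normr => /orP[] ?; lra.
  have [-> /andP[_ yn2]] := pow n.+1; have yn1 := fstep n y ay.
  exists (aff b q X.2); first by apply: copy_center oc _ VX'; rewrite ?lexx ?ltW.
  rewrite affR_dist ler_norml; rewrite rmorphB/= in yn1.
  by apply/andP; split; lra.
have meet z : covered [:: X] z -> covered s z -> exists2 i, V i & z = i%:~R / 2.
  move=> zX zs; have [i Vi zi] := covered_meet adX ads neq zX zs.
  by exists i => //; rewrite -zi mulrC mulKf.
have tfX z : covered [:: X] z -> (t * f)%g z = f z.
  move=> zX; rewrite homeo_mulE; have [fzs|/to//] := pselect (covered s (f z)).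
  by have [i Vi ->] := meet _ (fcov _ zX) fzs; exact: tV.
have tfs z : covered s z -> (t * f)%g z = t z.
  move=> zs; rewrite homeo_mulE; congr (homeo_val t _).
  have [zX|/foff//] := pselect (covered [:: X] z).
  by have [i Vi ->] := meet _ zX zs; exact: fV.
have powX z n : covered [:: X] z -> ((t * f) ^+ n)%g z = (f ^+ n)%g z /\
    covered [:: X] ((f ^+ n)%g z).
  move=> zX; elim: n => [//|n [IH1 IH2]].
  by rewrite !homeo_expgS IH1 tfX//; split=> //; exact: fcov.
have pows z n : covered s z -> ((t * f) ^+ n)%g z = (t ^+ n)%g z /\
    covered s ((t ^+ n)%g z).
  move=> zs; elim: n => [//|n [IH1 IH2]].
  by rewrite !homeo_expgS IH1 tfs//; split=> //; exact: tc.
exists (t * f)%g; split.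
- exact: GM.
- by move=> i Vi; rewrite homeo_mulE fV// tV.
- move=> z nz; rewrite homeo_mulE foff; last by move=> zX; apply/nz/covered_cons; left.
  by apply: to => zs; apply/nz/covered_cons; right.
- move=> z /covered_cons[zX|zs]; apply/covered_cons.
    by left; rewrite tfX//; exact: fcov.
  by right; rewrite tfs//; exact: tc.
- move=> z n /covered_cons[zX|zs] nb; first by rewrite (powX z n.+1 zX).1; exact: fpow.
  by rewrite (pows z n.+1 zs).1; exact: tb.
Qed.

(* Up to copies there are finitely many intervals between adjacent centers; on the
   copies of each of them an element acting copywise pushes the complement of the
   unit balls into the ball around one end. *)
Lemma displacer_exists : exists2 t, G t &
  forall n z, ~ ball V 1 z -> ball V 1 ((t ^+ n.+1)%g z).
Proof.
have [N N0 NP] := vertices_syndetic eQ1 k r.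
have gap p p' : adjacent p p' -> p' - p <= N + 1.
  move=> [Vp Vp' pp' pn]; have [m mN Vm] := NP (p + 1).
  have mp' : ~ m < p' by move=> mp'; apply: (pn m) => //; lia.
  lia.
pose M := `|(N + 1 + 2 * r + 1)%R|%N.
(* Length, parity of the left end, and letters with margin [r]: intervals with the same key are
   copies by an even translation. *)
pose key (X : int * int) : 'I_(`|(N + 1)%R|%N.+1) * bool * {ffun 'I_M -> bool} :=
  (inord `|(X.2 - X.1)%R|%N, oddz X.1, [ffun i : 'I_M => e (X.1 - r + (i : nat)%:Z)]).
have [s [s_adj s_key]] := finite_representatives key (fun X => adjacent X.1 X.2).
have [t [Gt _ _ _ tb]] := displacer_list s_adj.
exists t => // n z; apply: tb.
have [p [p' [ad zp]]] := adjacent_exists z.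
have [X [Xs kX]] := s_key (p, p') ad; have adX := s_adj _ Xs.
have [/= gX gp] := (gap _ _ adX, gap _ _ ad).
have [VX _ XX' _] := adX; have [Vp _ pp' _] := ad.
have XN : (`|(X.2 - X.1)%R| < `|(N + 1)%R|.+1)%N by lia.
have pN : (`|(p' - p)%R| < `|(N + 1)%R|.+1)%N by lia.
case: kX => /(congr1 val); rewrite /= !inordK// => k1 k2 k3.
have k12 : X.2 - X.1 = p' - p by lia.
have [q pE] : exists q, p = aff false q X.1.
  by exists ((p - X.1) %/ 2)%Z; move: k2; rewrite /oddz /aff; lia.
exists X, false, q, (affR false (aff_inv false q) z); split=> //.
- move=> i iX; rewrite addFb.
  have iM : (`|(i - (X.1 - r))%R| < M)%N by rewrite /M; lia.
  have := congr1 (fun F : {ffun 'I_M -> bool} => F (Ordinal iM)) k3; rewrite !ffunE /=.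
  have -> : X.1 - r + `|(i - (X.1 - r))%R|%N%:Z = i by lia.
  have -> : p - r + `|(i - (X.1 - r))%R|%N%:Z = aff false q i.
    by move: pE; rewrite /aff; lia.
  by [].
- have im : image false q X.1 X.2 = (p, p').
    by rewrite /image -pE; congr pair; move: pE; rewrite /aff; lia.
  by rewrite (image_le false q) affRVK im.
- by rewrite affRVK.
Qed.

End Displacement.

(** * Vanishing *)

Section Assembly.
Variable R : realType.
Local Notation T := (homeo [set: R]).
Variables (e : int -> bool) (A : set T).
Local Notation G := (generated A).
Local Notation gT := (generated_group A).
Hypotheses (HG : is_subgroup (@groupH R))
  (G_full : forall p u, groupH u -> G (cellwise e p setT u))
  (G_gen : forall S : set T, is_subgroup S ->
     (forall p u, groupH u -> S (cellwise e p setT u)) -> G `<=` S)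
  (eQ1 : recurrent e) (eQ2 : reversible e).
Implicit Types (x y z : R) (g h : gT).

Let GG : is_subgroup G := @generated_is_subgroup _ A.

Let act g : T := \val g.

Let actM g h : act (g * h)%g = (act g * act h)%g.
Proof. by []. Qed.

Let actV g : act g^-1%g = (act g)^-1%g.
Proof. by []. Qed.

Let actX g n : act (g ^+ n)%g = (act g ^+ n)%g.
Proof. by elim: n => [//|n IHn]; rewrite !expgS actM IHn. Qed.

Let actG g : G (act g). Proof. exact: set_valP. Qed.

Let act_exists f : G f -> exists g, act g = f.
Proof. by move=> Gf; exists (SigSub (mem_set Gf)). Qed.

(** The scale bounds supports. Centers lie 100 scales apart, which leaves room for the shifts by
    [10 * s'] and [10 * s' + 5 * s] in [conf_far]. *)
Record configuration := Configuration {
  conf_center : int; conf_radius : int; conf_scale : int;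
  conf_scale1 : 1 <= conf_scale;
  conf_scale_radius : conf_scale <= conf_radius;
  conf_sparse : sparse (centers e conf_center conf_radius) (100 * conf_scale) }.
Implicit Types P Q : configuration.

Local Notation pts P := (centers e (conf_center P) (conf_radius P)).

Definition conf_sup P : set gT :=
  [set g | forall x, ~ ball (pts P) (conf_scale P) x -> act g x = x].

Definition conf_fix P : set gT := [set g | forall x, ball (pts P) 1 x -> act g x = x].

Definition conf_perp P Q : Prop := forall v w, pts P v -> pts Q w ->
  conf_scale P + conf_scale Q < `|v - w|.

Definition conf_ok g P : Prop := exists m, fragments e G (act g) m /\ 1 + m <= conf_scale P.

Lemma conf_exists k N n : 1 <= N ->
  exists Q, [/\ conf_center Q = k, conf_scale Q = N & n <= conf_radius Q].
Proof.
move=> N1; have [r0 r0P] := vertices_sparse eQ2 k (100 * N).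
pose r := Num.max (Num.max r0 N) n.
have r0r : r0 <= r by rewrite !le_max lexx.
have Nr : N <= r by rewrite !le_max lexx !orbT.
by exists (Configuration N1 Nr (r0P r r0r)); rewrite le_max lexx orbT.
Qed.

(* One of the points [c + 10 s'] and [c + 10 s' + 5 s] is far from the centers
   of [P], because these are at least [100 s] apart. *)
Lemma conf_far P P' : conf_scale P <= conf_scale P' -> exists k,
  (forall v, pts P v -> 2 * conf_scale P < `|v - k|) /\
  (forall v, pts P' v -> conf_scale P + conf_scale P' < `|v - k|).
Proof.
move=> ss; have s1 := conf_scale1 P; have sp := @conf_sparse P; have sp' := @conf_sparse P'.
set s := conf_scale P in ss s1 sp *; set s' := conf_scale P' in ss sp' *.
set c := conf_center P' in sp' *; set V' := centers e c _ in sp' *.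
have Vc : V' c by exact: vertices_ref.
have far k : c + 10 * s' <= k <= c + 15 * s' -> forall v, V' v -> s + s' < `|v - k|.
  move=> kc v Vv; have [->|/eqP vc] := eqVneq v c; first lia.
  by have := sp' v c Vv Vc vc; lia.
have [near|] := pselect (exists2 v, pts P v & `|v - (c + 10 * s')| <= 2 * s); last first.
  move=> nnear; exists (c + 10 * s'); split; last by apply: far; lia.
  by move=> v Vv; rewrite ltNge; apply/negP => vn; apply: nnear; exists v.
have [v Vv vn] := near; exists (c + 10 * s' + 5 * s); split; last by apply: far; lia.
move=> w Vw; have [->|/eqP wv] := eqVneq w v; first lia.
by have := sp w v Vw Vv wv; lia.
Qed.

(** The radius of [Q] is so large that its occurrences carry along the nearby centers of [P] and
    [P']: one close to a center of [Q] would come from one close to [k]. Keeping the smaller scale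
    lets [conf_ok] pass from [P] to [Q]. *)
Lemma conf_perp_exists P P' : conf_scale P <= conf_scale P' ->
  exists Q, [/\ conf_perp P Q, conf_perp P' Q & conf_scale Q = conf_scale P].
Proof.
move=> ss; have [k [kP kP']] := conf_far ss; have s1 := conf_scale1 P.
have [Q [Qk Qs Qr]] := conf_exists k
  (2 * conf_scale P' + Num.max (conf_radius P) (conf_radius P')) s1.
have transport k0 r0 N : N + r0 <= conf_radius Q ->
    (forall v, centers e k0 r0 v -> N < `|v - k|) ->
    forall v w, centers e k0 r0 v -> pts Q w -> N < `|v - w|.
  move=> Nr kN v w Vv [b [q [oc ->]]]; rewrite Qk ltNge; apply/negP => vw.
  pose i := aff b (aff_inv b q) v; have vE : v = aff b q i by rewrite affVK.
  have ik : `|i - k| = `|v - aff b q k| by rewrite vE /aff; case: (b); lia.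
  have Vi : centers e k0 r0 i.
    by apply: (occurs_verticesV oc); rewrite -?vE //; rewrite Qk; lia.
  by have := kN _ Vi; rewrite ik; lia.
exists Q; split=> // v w Vv Qw.
- have := @transport (conf_center P) (conf_radius P) (conf_scale P + conf_scale Q) _ _ v w Vv Qw.
  by apply; [lia|move=> v' /kP; lia].
- have := @transport (conf_center P') (conf_radius P') (conf_scale P' + conf_scale Q) _ _ v w Vv Qw.
  by apply; [lia|move=> v' /kP'; lia].
Qed.

Lemma conf_perp_balls P Q x : conf_perp P Q ->
  ball (pts P) (conf_scale P) x -> ~ ball (pts Q) (conf_scale Q) x.
Proof.
move=> PQ [v Vv xv] [w Qw xw]; have := PQ v w Vv Qw.
rewrite -(ltr_int R) intr_norm rmorphB rmorphD/= ltNge => /negP; apply.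
have -> : v%:~R - w%:~R = (2 * x - w%:~R) - (2 * x - v%:~R) :> R by ring.
by rewrite (le_trans (ler_normB _ _))// addrC lerD.
Qed.

Lemma conf_perp_sup P Q : conf_perp P Q -> conf_sup P `<=` conf_fix Q.
Proof.
move=> PQ g Pg x Qx; apply: Pg => Px; apply: (conf_perp_balls PQ Px).
by apply: ball_sub Qx; exact: conf_scale1.
Qed.

Lemma conf_perp_sym P Q : conf_perp P Q -> conf_perp Q P.
Proof. by move=> PQ v w Qv Pw; rewrite distrC addrC; exact: PQ. Qed.

Lemma set_fixing_subgroup (S : set R) :
  is_subgroup [set g : gT | forall x, S x -> act g x = x].
Proof.
split=> [x Sx|g h gS hS x Sx|g gS x Sx].
- by rewrite -[1%g](mulVg 1%g) actM actV homeo_mulE homeo_invK.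
- by rewrite actM homeo_mulE hS// gS.
- by rewrite actV -{1}(gS x Sx) homeo_invK.
Qed.

Lemma bounded_cocycle_is_coboundary (c : 2.-tuple gT -> R) :
  bounded_cochain c -> coboundary c = 0 -> is_bounded_coboundary c.
Proof.
move=> bc c0; apply: (@bounded_coboundary_criterion R gT c configuration
  conf_sup conf_fix conf_perp conf_ok bc c0).
- by move=> P; exact: (set_fixing_subgroup (~` ball (pts P) (conf_scale P))).
- by move=> P; exact: (set_fixing_subgroup (ball (pts P) 1)).
- move=> P.
  have r0 : 0 <= conf_radius P.
    by have := conf_scale1 P; have := conf_scale_radius P; lia.
  have V4 : sparse (pts P) 4.
    by apply: sparse_le (@conf_sparse P); have := conf_scale1 P; lia.
  have [t' Gt' tP] := displacer_exists HG GG G_full eQ1 r0 V4.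
  have [t tE] := act_exists Gt'; exists t => n x y Px Py.
  suff : commute (act (x ^ (t ^+ n.+1))%g) (act y).
    by rewrite /commute -!actM => /val_inj.
  (* The conjugate of [x] is supported where [t' ^+ n.+1] leads outside the unit balls; by [tP] such
     points are themselves in a unit ball, where [y] is trivial. *)
  apply: (@disjoint_commute _ _ _ _ [set z | ~ ball (pts P) 1 ((t' ^+ n.+1)%g z)]) => z.
    move=> /contrapT zb; rewrite conjgE !actM actV actX tE !homeo_mulE Px//.
    exact: homeo_invK.
  by move=> /= nz; apply: Py; apply: contrapT => nb; apply: nz; exact: tP.
- move=> P Q PQ; have QP := conf_perp_sym PQ; split; [exact: conf_perp_sup|exact: conf_perp_sup|].
  move=> x y Px Qy; suff : commute (act x) (act y) by rewrite /commute -!actM => /val_inj.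
  apply: (@disjoint_commute _ _ _ _ (ball (pts P) (conf_scale P))) => z.
    exact: Px.
  by move=> Pz; apply: Qy; exact: conf_perp_balls Pz.
- move=> g P P' [m [fm mP]] [m' [fm' mP']].
  have [Q [PQ P'Q [m0 [fm0 m0Q]]]] : exists Q, [/\ conf_perp P Q, conf_perp P' Q & conf_ok g Q].
    have [ss|/ltW ss] := leP (conf_scale P) (conf_scale P').
      by have [Q [PQ P'Q Qs]] := conf_perp_exists ss; exists Q; split=> //; exists m; rewrite Qs.
    by have [Q [P'Q PQ Qs]] := conf_perp_exists ss; exists Q; split=> //; exists m'; rewrite Qs.
  have [m00 _ ff] := fm0; have sr := conf_scale_radius Q; have sp := @conf_sparse Q.
  have s1 := conf_scale1 Q.
  have [|||f Gf [fE fo]] := ff 1 (conf_center Q) (conf_radius Q); [by []|lia| |].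
    by apply: sparse_le sp; lia.
  have [l lE] := act_exists Gf; exists Q; split=> //; exists l.
    by move=> x nx; rewrite lE fo//; apply: contra_not nx; exact: ball_sub.
  by move=> x xb; rewrite actM actV lE homeo_mulE -fE// homeo_invK.
- move=> g h.
  have [m fg] := fragments_exists HG GG G_full G_gen (actG g).
  have [m' fh] := fragments_exists HG GG G_full G_gen (actG h).
  have [m0 gm ff] := fg; have [m'0 hm hf] := fh.
  (* [h] moves the unit balls into those of radius [1 + m']; the fragment [l] of [g] must agree with
     [g] there, so that the conjugate of [l^-1 * g] is trivial on the unit balls. *)
  have N1 : 1 <= 1 + m' + m by lia.
  have [P [_ Ps _]] := conf_exists 0 0 N1.
  have sr := conf_scale_radius P; have sp := @conf_sparse P; rewrite Ps in sr sp.
  have [|||f Gf [fE fo]] := ff (1 + m') (conf_center P) (conf_radius P); [lia|lia| |].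
    by apply: sparse_le sp; lia.
  have [|||f' Gf' [f'E f'o]] := hf 1 (conf_center P) (conf_radius P); [lia|lia| |].
    by apply: sparse_le sp; lia.
  have [l lE] := act_exists Gf; have [l' l'E] := act_exists Gf'.
  exists P, l, l'; split; split.
  + by exists m; split=> //; rewrite Ps; lia.
  + by exists m'; split=> //; rewrite Ps; lia.
  + exists (m + m'); split; last by rewrite Ps; lia.
    by rewrite actM; exact: fragmentsM.
  + by move=> x; rewrite Ps lE => nx; exact: fo.
  + move=> x; rewrite Ps l'E => nx; apply: f'o; apply: contra_not nx; apply: ball_sub; lia.
  + move=> x xb; rewrite actM actV lE homeo_mulE -fE ?homeo_invK//.
    by apply: ball_sub xb; lia.
  + by move=> x xb; rewrite actM actV l'E homeo_mulE -f'E// homeo_invK.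
  + move=> x xb; rewrite conjgE !actM !actV lE l'E !homeo_mulE f'E// -fE.
      by rewrite homeo_invK -f'E// homeo_invK.
    exact: ball_move (hm x) xb.
Qed.

End Assembly.

(** * The generators as cellwise homeomorphisms *)

Section Generators.
Variable R : realType.
Variables (nu : 'I_3 -> homeo (`[0, 1]%classic : set R)) (rho : int -> letter).
Hypotheses (nu_generates : generated (range nu) = @groupH R) (rho_labelling : labelling rho).

Lemma cellwise_zeta (u : homeo (`[0, 1]%classic : set R)) :
  is_zeta rho u (cellwise (sign rho) true setT u).
Proof.
move=> n; have n1 : oddz (2 * n + 1) = true by rewrite /oddz; lia.
have nE : (2 * n + 1)%:~R = 2 * n%:~R + 1 :> R by rewrite rmorphD rmorphM.
split=> rhon x; rewrite in_itv => xn; have {xn} /andP[? ?] : n%:~R <= x <= n%:~R + 1 := xn;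
  have := @cellwiseE R (sign rho) (2 * n + 1) setT u x; rewrite n1 in_setT nE => -> //;
  try (by apply/andP; split; lra); rewrite /sign rhon /local /chart /chartV /isom /isom_or /= nE.
  by rewrite subr0; congr (_ + homeo_val u _); field.
by rewrite subr0; congr (_ - homeo_val u _); field.
Qed.

Lemma cellwise_chi (u : homeo (`[0, 1]%classic : set R)) :
  is_chi rho u (cellwise (sign rho) false setT u).
Proof.
move=> n; have n1 : oddz (2 * n) = false by rewrite /oddz; lia.
have nE : (2 * n)%:~R = 2 * n%:~R :> R by rewrite rmorphM.
split=> rhon x; rewrite in_itv => xn;
  have {xn} /andP[? ?] : n%:~R - 2^-1 <= x <= n%:~R + 2^-1 := xn;
  have := @cellwiseE R (sign rho) (2 * n) setT u x; rewrite n1 in_setT nE => -> //;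
  try (by apply/andP; split; lra); rewrite /sign rhon /local /chart /chartV /isom /isom_or /= nE.
  by rewrite subr0; congr (_ + homeo_val u _); field.
by rewrite subr0; congr (_ - homeo_val u _); field.
Qed.

Let G := generated (groupG_gens rho nu).

Lemma groupG_cellwise p u : groupH u -> G (cellwise (sign rho) p setT u).
Proof.
have [G1 GM GV] := generated_is_subgroup (groupG_gens rho nu).
rewrite -nu_generates => /(_ [set u | G (cellwise (sign rho) p setT u)]); apply.
split=> [|_ [i _ <-]] /=.
  split=> /=.
  - by rewrite cellwise1.
  - by move=> v w Gv Gw; rewrite cellwiseM; exact: GM.
  - by move=> v Gv; rewrite cellwiseV; exact: GV.
move=> S [_ gS]; apply: gS; exists i.
by case: p; [left; exact: cellwise_zeta|right; exact: cellwise_chi].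
Qed.

Lemma groupG_min (S : set (homeo [set: R])) : is_subgroup S ->
  (forall p u, groupH u -> S (cellwise (sign rho) p setT u)) -> G `<=` S.
Proof.
move=> SG S_full g /(_ S); apply; split=> // h [i hP].
have nuH : groupH (nu i) by rewrite -nu_generates => S' [_ nuS']; apply: nuS'; exists i.
case: hP => hP.
  by rewrite (zeta_unique rho_labelling hP (cellwise_zeta (nu i))); exact: S_full.
by rewrite (chi_unique rho_labelling hP (cellwise_chi (nu i))); exact: S_full.
Qed.

End Generators.

Theorem theorem1p2 (R : realType)
  (nu : 'I_3 -> homeo (`[0, 1]%classic : set R))
  (nu_generates : generated (range nu) = @groupH R)
  (rho : int -> letter)
  (rho_labelling : labelling rho)
  (rho_quasi_periodic : quasi_periodic rho) :
  forall c : bounded_cohomology R (groupG rho nu) 2, c = 0.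
Proof.
(* That [H] is a group is read off from its being generated by [nu]. *)
have HG : is_subgroup (@groupH R) by rewrite -nu_generates; exact: generated_is_subgroup.
move=> c; elim/quotW: c => z; have [bz cz] := asboolP _ (valP z).
have zP : is_bounded_coboundary (z : _ -> R).
  apply: (bounded_cocycle_is_coboundary HG _ _ _ _ bz cz).
  - exact: groupG_cellwise nu_generates.
  - exact: groupG_min nu_generates rho_labelling.
  - exact: sign_recurrent rho_labelling rho_quasi_periodic.
  - exact: sign_reversible rho_labelling rho_quasi_periodic.
have z0 : z - 0 \in @bounded_coboundary_pred R (groupG rho nu) 2.
  by rewrite subr0; apply/asboolP.
move: z0; rewrite Quotient.idealrBE => /eqP ->.
exact: pi_zeror.
Qed.
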